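(* For every irrational number $\rho\in[0,1)$ there exists a Cherry flow on the torus $\mathbb{T}^2$ with rotation number $\rho$ whose quasi-minimal set is an attractor (in the sense defined below). Moreover, the basin of attraction of this quasi-minimal set has non-empty interior.
   Context: A Cherry flow is a $C^\infty$ flow on the $2$-torus $\mathbb{T}^2$ that has no closed trajectories and has exactly two singularities, a sink and a saddle, both hyperbolic. Such a flow admits a Poincaré section: a closed curve $\mathbb{S}^1\subset\mathbb{T}^2$, not homotopic to a point, that is everywhere transverse to the flow. The first return map to the section is a continuous, non-decreasing, degree one circle map. The rotation number of the Cherry flow is the rotation number of this first return map. For a point $x$, the $\omega$-limit set is $\omega(x)=\{y:\exists t_n\to\infty,\ X_{t_n}(x)\to y\}$. A trajectory is recurrent if it is contained in both its $\omega$-limit set and its $\alpha$-limit set. A recurrent trajectory is non-trivial if it is neither a fixed point nor periodic. The closure of a non-trivial recurrent trajectory is called a quasi-minimal set. A closed set $A\subset\mathbb{T}^2$ is an attractor if both of the following hold: (1) its realm of attraction $\Lambda(A)=\{x:\omega(x)\subset A\}$ has positive Lebesgue measure; (2) there is no strictly smaller closed set $A'\subsetneq A$ such that $\Lambda(A')$ coincides with $\Lambda(A)$ up to a Lebesgue-null set. *)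

(* Defs.v *)
From HB Require Import structures.
From mathcomp Require Import all_boot all_order all_algebra.
From mathcomp Require Import all_classical all_reals all_analysis.
From mathcomp Require Import complex.
Set Implicit Arguments. Unset Strict Implicit. Unset Printing Implicit Defensive.
Import Order.TTheory GRing.Theory Num.Theory.
Import numFieldNormedType.Exports.
Local Open Scope classical_set_scope.
Local Open Scope ring_scope.

(* The torus T^2 = R^2 / Z^2 is handled through its universal cover R * R:
   vector fields, flows and subsets of T^2 are represented by Z^2-periodic
   (resp. Z^2-equivariant, Z^2-invariant) objects on R * R. *)

Section Cherry.
Variable R : realType.
Local Notation P := (R * R)%type.

Definition intv (k : int * int) : P := ((k.1)%:~R, (k.2)%:~R).
Definition in_Z2 (z : P) : Prop := exists k : int * int, z = intv k.

Definition Z2_invariant (A : set P) : Prop :=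
  forall z k, A z -> A (z + intv k).

Definition e0 : P := (1, 0).
Definition e1 : P := (0, 1).
Definition edir (b : bool) : P := if b then e1 else e0.

Fixpoint pderiv (s : seq bool) (f : P -> R) : P -> R :=
  match s with
  | [::] => f
  | b :: s' => fun z => 'D_(edir b) (pderiv s' f) z
  end.

Definition smooth (f : P -> R) : Prop :=
  forall s : seq bool,
    continuous (pderiv s f) /\
    forall z b, derivable (pderiv s f) z (edir b).

Definition comp (i : bool) (z : P) : R := if i then z.2 else z.1.

Definition smooth_torus_field (v : P -> P) : Prop :=
  (forall i, smooth (fun z => comp i (v z))) /\
  (forall z k, v (z + intv k) = v z).

Definition flow_of (v : P -> P) (phi : R -> P -> P) : Prop :=
  (forall z, phi 0 z = z) /\
  (forall s t z, phi (s + t) z = phi s (phi t z)) /\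
  (forall t z, is_derive t (1 : R) (fun s : R => phi s z) (v (phi t z))).

Definition jacobian (v : P -> P) (z : P) : 'M[R]_2 :=
  \matrix_(i < 2, j < 2)
     'D_(edir (j == 1%N :> nat)) (fun w => comp (i == 1%N :> nat) (v w)) z.

Definition eigenvalueC (M : 'M[R]_2) (l : R[i]) : Prop :=
  root (map_poly (fun x : R => complex.Complex x 0) (char_poly M)) l.

Definition hyperbolic_sink (v : P -> P) (z : P) : Prop :=
  v z = 0 /\ forall l, eigenvalueC (jacobian v z) l -> complex.Re l < 0.

Definition hyperbolic_saddle (v : P -> P) (z : P) : Prop :=
  v z = 0 /\
  (forall l, eigenvalueC (jacobian v z) l -> complex.Re l != 0) /\
  (exists l, eigenvalueC (jacobian v z) l /\ complex.Re l < 0) /\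
  (exists l, eigenvalueC (jacobian v z) l /\ 0 < complex.Re l).

Definition periodic_point (v : P -> P) (phi : R -> P -> P) (z : P) : Prop :=
  v z != 0 /\ exists T, 0 < T /\ in_Z2 (phi T z - z).

Definition cherry_flow (v : P -> P) (phi : R -> P -> P) : Prop :=
  smooth_torus_field v /\ flow_of v phi /\
  (forall z, ~ periodic_point v phi z) /\
  exists zs zp : P,
    hyperbolic_sink v zs /\ hyperbolic_saddle v zp /\
    ~ in_Z2 (zs - zp) /\
    (forall z, v z = 0 -> in_Z2 (z - zs) \/ in_Z2 (z - zp)).

(* The circle {y = 0} (mod Z^2) is a Poincare section (transverse, crossed
   upward), F is a lift of the first return map: continuous, non-decreasing,
   degree one, equal to the actual first return wherever the trajectory of
   (x,0) returns, and rho is its rotation number (taken in [0,1)). *)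
Definition return_map_lift (phi : R -> P -> P) (F : R -> R) : Prop :=
  continuous F /\ {homo F : x y / x <= y} /\ (forall x, F (x + 1) = F x + 1) /\
  forall x t, 0 < t -> (phi t (x, 0)).2 = 1 ->
    (forall s, 0 < s < t -> (phi s (x, 0)).2 < 1) ->
    F x = (phi t (x, 0)).1.

Definition rotation_number_of_flow (v : P -> P) (phi : R -> P -> P) (rho : R)
  : Prop :=
  (forall x : R, 0 < (v (x, 0)).2) /\
  exists F : R -> R, return_map_lift phi F /\
    exists r : R, ((fun n : nat => (iter n F 0) / n%:R) @ \oo --> r) /\
      exists m : int, rho = r - m%:~R.

Definition omega_limit (phi : R -> P -> P) (z : P) : set P :=
  [set y | exists (t : nat -> R) (k : nat -> int * int),
      (t n @[n --> \oo] --> +oo) /\ ((phi (t n) z - intv (k n)) @[n --> \oo] --> y)].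

Definition alpha_limit (phi : R -> P -> P) (z : P) : set P :=
  [set y | exists (t : nat -> R) (k : nat -> int * int),
      (t n @[n --> \oo] --> -oo) /\ ((phi (t n) z - intv (k n)) @[n --> \oo] --> y)].

Definition trajectory (phi : R -> P -> P) (z : P) : set P :=
  [set y | exists t k, y = phi t z + intv k].

Definition recurrent (phi : R -> P -> P) (z : P) : Prop :=
  trajectory phi z `<=` omega_limit phi z `&` alpha_limit phi z.

Definition nontrivial_recurrent (v : P -> P) (phi : R -> P -> P) (z : P) : Prop :=
  recurrent phi z /\ v z != 0 /\ ~ periodic_point v phi z.

Definition quasi_minimal_set_of (phi : R -> P -> P) (z : P) : set P :=
  closure (trajectory phi z).

Definition realm (phi : R -> P -> P) (A : set P) : set P :=
  [set x | omega_limit phi x `<=` A].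

Definition leb2 : set P -> \bar R :=
  (@lebesgue_measure R \x @lebesgue_measure R)%E.

Definition positive_measure (A : set P) : Prop := ~ leb2.-negligible A.

Definition ae_equal (A B : set P) : Prop :=
  leb2.-negligible ((A `\` B) `|` (B `\` A)).

Definition closed_torus_set (A : set P) : Prop := closed A /\ Z2_invariant A.

Definition attractor (phi : R -> P -> P) (A : set P) : Prop :=
  closed_torus_set A /\
  positive_measure (realm phi A) /\
  ~ (exists A', closed_torus_set A' /\ A' `<` A /\
                ae_equal (realm phi A') (realm phi A)).

Definition nonempty_interior (A : set P) : Prop := (interior A) !=set0.

End Cherry.

(* Main.v *)
(* Nothing in the definition of a Cherry flow prevents the saddle from having a homoclinic
   loop. The field (u1, u2) derives from a multivalued Hamiltonian HH and has one saddle, with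
   a homoclinic loop, and one center inside the loop. Adding EE times the rotated field, where
   EE >= 0 is positive exactly inside the loop, turns the center into a sink and changes
   nothing outside. There HH is conserved, and on y = n it equals - pi x + rho pi n, so the
   return map is the rotation x -> x + rho. A trajectory outside the loop that is bounded in
   the y-direction tends to the saddle, which confines HH to a countable set; all other
   trajectories outside the loop cross every level y = n and, rho being irrational, accumulate
   on the whole section, hence on all of {EE = 0}. So {EE = 0} is the only quasi-minimal set;
   it lies in its own realm, and the omega-limit set of almost every point of some rectangle
   contains it, which makes it an attractor. *)
Require Import Defs.
From HB Require Import structures.
From mathcomp Require Import all_boot all_order all_algebra.
From mathcomp Require Import all_classical all_reals all_analysis.
From mathcomp Require Import complex.
From mathcomp Require Import ring lra zify.
Set Implicit Arguments. Unset Strict Implicit. Unset Printing Implicit Defensive.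
Import Order.TTheory GRing.Theory Num.Theory.
Import numFieldNormedType.Exports.
Local Open Scope classical_set_scope.
Local Open Scope ring_scope.

(** * Differential calculus and smooth functions *)

(** The separatrices are never studied. Which trajectories tend to the saddle is left undetermined;
    it is enough that their values of [HH] lie in the countable [Qset]. Such values are dodged in
    two ways: along paths on which [HH] is strictly monotone, which gives density, and slice by
    slice in a rectangle, which gives measure zero. Nor is the loop parametrised: its inside is
    [D0], cut out of a box by [HH > hs], and the inequality [HH <= hs] on the sides of that box
    replaces the Jordan curve theorem. A smooth [EE] needs a flat cut-off [chi] at the level [hs];
    the same cut-off satisfies [chi s <= s], which keeps trajectories from leaving the inside in
    finite backward time. The rotated field is [1 / pi] times the gradient of [HH], so [HH] strictly
    increases along the non-singular trajectories inside, and none of them is recurrent. Outside, a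
    closed trajectory would give [rho * k.2 = k.1] for its lattice displacement [k], so [k.2 = 0],
    although integer levels are crossed upwards only. *)

Section Calculus.
Context {R : realType}.
Local Notation der f x d := (is_derive x (1 : R) (f : R -> R) (d : R)).

Lemma der_cst (a x : R) : der (fun=> a) x 0.
Proof. exact: is_derive_cst. Qed.

Lemma der_id (x : R) : der (fun t => t) x 1.
Proof. exact: is_derive_id. Qed.

Lemma derD (f g : R -> R) x a b :
  der f x a -> der g x b -> der (fun t => f t + g t) x (a + b).
Proof. by move=> fa gb; exact: is_deriveD. Qed.

Lemma derN (f : R -> R) x a : der f x a -> der (fun t => - f t) x (- a).
Proof. by move=> fa; exact: is_deriveN. Qed.

Lemma derM (f g : R -> R) x a b :
  der f x a -> der g x b -> der (fun t => f t * g t) x (a * g x + f x * b).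
Proof.
move=> fa gb; have := @is_deriveM _ _ f g x 1 a b fa gb.
move=> /is_derive_eq; apply.
by rewrite /GRing.scale /= addrC [g x * a]mulrC.
Qed.

Lemma der_comp (g f : R -> R) x a b :
  der f x a -> der g (f x) b -> der (fun t => g (f t)) x (b * a).
Proof.
move=> fa gb; have := @is_derive1_comp R g f x b a gb fa.
by [].
Qed.

Lemma der_eq (f : R -> R) x a b : der f x a -> a = b -> der f x b.
Proof. by move=> ? <-. Qed.

Lemma der_sin x : der sin x (cos x). Proof. exact: is_derive_sin. Qed.
Lemma der_cos x : der cos x (- sin x). Proof. exact: is_derive_cos. Qed.
Lemma der_exp x : der expR x (expR x). Proof. exact: is_derive_expR. Qed.

Lemma der_cont (f : R -> R) x a : der f x a -> {for x, continuous f}.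
Proof.
by move=> [fa _]; apply: differentiable_continuous; apply/derivable1_diffP.
Qed.

Lemma der_MVT (f df : R -> R) (a b : R) : a <= b ->
  (forall x, a <= x <= b -> der f x (df x)) ->
  exists2 c, a <= c <= b & f b - f a = df c * (b - a).
Proof.
move=> ab H.
have [||c cab E] := @MVT_segment R f df a b ab.
- by move=> x; rewrite in_itv /= => /andP[ax xb]; apply: H; rewrite !ltW.
- apply: derivable_within_continuous => x; rewrite in_itv /= => xab.
  exact: (@ex_derive _ _ _ _ _ _ _ (H x xab)).
by exists c => //; move: cab; rewrite in_itv.
Qed.
End Calculus.

Section SmoothClass.
Context {R : realType}.
Local Notation P := (R * R)%type.
Local Notation der f x d := (is_derive x (1 : R) (f : R -> R) (d : R)).

(** Both sides are the same difference quotient, so the one-variable rules yield the directional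
    ones. *)
Lemma is_derive_lineE (f : P -> R) (z v : P) (d : R) :
  is_derive z v f d <-> der (fun h : R => f (h *: v + z)) 0 d.
Proof.
have E : 'D_v f z = 'D_1 (fun h : R => f (h *: v + z)) (0 : R).
  rewrite /derive; set g1 := fun h => h^-1 *: _; set g2 := fun h => h^-1 *: _.
  suff -> : g1 = g2 by [].
  by rewrite funeqE /g1 /g2 => h /=; rewrite addr0 scale0r add0r [_%:A]mulr1.
split=> -[dv dE]; split.
- by move/derivable1P : dv.
- by rewrite -E.
- by apply/derivable1P.
- by rewrite E.
Qed.

Lemma derdir_comp (g : R -> R) (f : P -> R) z v a b :
  is_derive z v f a -> der g (f z) b -> is_derive z v (fun w => g (f w)) (b * a).
Proof.
move=> /is_derive_lineE fa gb; apply/is_derive_lineE.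
by apply: (@der_comp _ g (fun h : R => f (h *: v + z))) => //; rewrite scale0r add0r.
Qed.

Lemma derdirM (f g : P -> R) z v a b : is_derive z v f a -> is_derive z v g b ->
  is_derive z v (fun w => f w * g w) (a * g z + f z * b).
Proof.
move=> fa gb; have := @is_deriveM _ _ f g z v a b fa gb.
by move=> /is_derive_eq; apply; rewrite /GRing.scale /= addrC [g z * a]mulrC.
Qed.

(* The infinite sequence [g] of successive derivatives in [smc_comp] makes this class
   stable under partial derivatives, so its members are smooth. *)
Inductive smc : (P -> R) -> Prop :=
| smc_cst a : smc (fun=> a)
| smc_fst : smc (fun z => z.1)
| smc_snd : smc (fun z => z.2)
| smc_add f g : smc f -> smc g -> smc (fun z => f z + g z)
| smc_mul f g : smc f -> smc g -> smc (fun z => f z * g z)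
| smc_comp (g : nat -> R -> R) f : (forall n x, der (g n) x (g n.+1 x)) ->
    smc f -> smc (fun z => g 0%N (f z)).

Lemma smc_cont f : smc f -> continuous f.
Proof.
elim=> [a|||g h _ gc _ hc|g h _ gc _ hc|g h gD _ hc] z.
- exact: cst_continuous.
- exact: cvg_fst.
- exact: cvg_snd.
- by apply: cvgD; [exact: gc|exact: hc].
- by apply: cvgM; [exact: gc|exact: hc].
- by apply: (continuous_comp (hc z)); exact: der_cont (gD 0%N (h z)).
Qed.

Lemma derdir_fst (z : P) b : is_derive z (edir R b) (fun z => z.1) (edir R b).1.
Proof.
apply/is_derive_lineE.
have -> : (fun h : R => (h *: edir R b + z).1) = (fun h => h * (edir R b).1 + z.1).
  by [].
apply: (@der_eq _ _ _ ((1 * (edir R b).1 + 0 * 0) + 0)); last by rewrite mul0r !addr0 mul1r.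
by apply: derD (der_cst _ _); apply: derM (der_id _) (der_cst _ _).
Qed.

Lemma derdir_snd (z : P) b : is_derive z (edir R b) (fun z => z.2) (edir R b).2.
Proof.
apply/is_derive_lineE.
have -> : (fun h : R => (h *: edir R b + z).2) = (fun h => h * (edir R b).2 + z.2).
  by [].
apply: (@der_eq _ _ _ ((1 * (edir R b).2 + 0 * 0) + 0)); last by rewrite mul0r !addr0 mul1r.
by apply: derD (der_cst _ _); apply: derM (der_id _) (der_cst _ _).
Qed.

Lemma smc_der f b : smc f ->
  exists2 g, smc g & forall z, is_derive z (edir R b) f (g z).
Proof.
elim=> [a|||g h gS [g' g'S g'D] hS [h' h'S h'D]|g h gS [g' g'S g'D] hS [h' h'S h'D]|
  g h gD hS [h' h'S h'D]].
- by exists (fun=> 0); [exact: smc_cst|move=> z; exact: is_derive_cst].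
- by exists (fun=> (edir R b).1); [exact: smc_cst|move=> z; exact: derdir_fst].
- by exists (fun=> (edir R b).2); [exact: smc_cst|move=> z; exact: derdir_snd].
- exists (fun z => g' z + h' z); first exact: smc_add.
  by move=> z; exact: is_deriveD.
- exists (fun z => g' z * h z + g z * h' z); first by apply: smc_add; exact: smc_mul.
  by move=> z; exact: derdirM.
- exists (fun z => g 1%N (h z) * h' z).
    apply: smc_mul => //.
    by apply: (@smc_comp (fun n => g n.+1)) => // n x; exact: gD.
  by move=> z; exact: derdir_comp (h'D z) (gD 0%N (h z)).
Qed.

(** [EE] is built with integer parts, which [smc] does not offer; near each point it agrees with a
    member of [smc], and continuity and iterated partial derivatives see no more than that. *)
Definition locally_smc (f : P -> R) :=
  forall z0 : P, exists2 g, smc g & \forall z \near z0, f z = g z.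

Lemma smc_locally f : smc f -> locally_smc f.
Proof. by move=> fS z0; exists f => //; near=> z.
Unshelve. all: by end_near. Qed.

Lemma locally_smc_add f g :
  locally_smc f -> locally_smc g -> locally_smc (fun z => f z + g z).
Proof.
move=> fS gS z0; have [f' f'S ff'] := fS z0; have [g' g'S gg'] := gS z0.
exists (fun z => f' z + g' z); first exact: smc_add.
by near=> z; congr (_ + _); near: z.
Unshelve. all: by end_near. Qed.

Lemma locally_smc_mul f g :
  locally_smc f -> locally_smc g -> locally_smc (fun z => f z * g z).
Proof.
move=> fS gS z0; have [f' f'S ff'] := fS z0; have [g' g'S gg'] := gS z0.
exists (fun z => f' z * g' z); first exact: smc_mul.
by near=> z; congr (_ * _); near: z.
Unshelve. all: by end_near. Qed.

Lemma locally_smc_cont f : locally_smc f -> continuous f.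
Proof.
move=> fS z0; have [g gS fg] := fS z0.
have gc : g z @[z --> z0] --> f z0 by rewrite (nbhs_singleton fg); exact: smc_cont.
apply: cvg_trans gc; apply: near_eq_cvg.
by near=> z; apply/esym; near: z.
Unshelve. all: by end_near. Qed.

Lemma locally_smc_derivable f b z : locally_smc f -> derivable f z (edir R b).
Proof.
move=> fS; have [g gS fg] := fS z; have [g' _ g'D] := smc_der b gS.
apply: (@near_eq_derivable _ _ _ g); last by have [] := g'D z.
by near=> w; apply/esym; near: w.
Unshelve. all: by end_near. Qed.

Lemma locally_smc_derive f b : locally_smc f -> locally_smc (fun z => 'D_(edir R b) f z).
Proof.
move=> fS z0; have [g gS fg] := fS z0; have [g' g'S g'D] := smc_der b gS.
(* Agreement near [z0] is agreement near every point close to [z0], so the derivatives agree on a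
   neighbourhood and not only at [z0]. *)
exists g' => //; have := near_join fg; apply: filterS => z fgz.
rewrite (near_eq_derive _ fgz); have [_ ->] := g'D z.
by [].
Unshelve. all: by end_near. Qed.

Lemma locally_smc_smooth f : locally_smc f -> smooth f.
Proof.
move=> fS s; suff sS : locally_smc (pderiv s f).
  by split; [exact: locally_smc_cont|move=> z b; exact: locally_smc_derivable].
by elim: s => //= b s; exact: locally_smc_derive.
Qed.

Lemma smc_opp f : smc f -> smc (fun z => - f z).
Proof.
move=> fS; have -> : (fun z => - f z) = (fun z => (-1) * f z).
  by apply/funext => z; rewrite mulN1r.
by apply: smc_mul => //; exact: smc_cst.
Qed.

Lemma smc_sub f g : smc f -> smc g -> smc (fun z => f z - g z).
Proof. by move=> fS gS; apply: smc_add => //; exact: smc_opp. Qed.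

Lemma smc_sin f : smc f -> smc (fun z => sin (f z)).
Proof.
(* The successive derivatives of sine are its shifts by multiples of [pi / 2], which is the sequence
   that [smc_comp] asks for. *)
move=> fS; pose g (n : nat) (x : R) := sin (x + n%:R * (pi / 2)).
have -> : (fun z => sin (f z)) = (fun z => g 0%N (f z)).
  by apply/funext => z; rewrite /g mul0r addr0.
apply: smc_comp => // n x.
apply: (@der_eq _ _ _ (cos (x + n%:R * (pi / 2)) * (1 + 0))).
rewrite addr0 mulr1 -sinDpihalf /g; congr (sin _).
have -> : n.+1%:R = n%:R + 1 :> R by rewrite natr1.
by ring.
Qed.

Lemma smc_cos f : smc f -> smc (fun z => cos (f z)).
Proof.
move=> fS; have -> : (fun z => cos (f z)) = (fun z => sin (f z + pi / 2)).
  by apply/funext => z; rewrite sinDpihalf.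
by apply: smc_sin; apply: smc_add => //; exact: smc_cst.
Qed.

End SmoothClass.

(** * A flat cut-off function *)

Section Flat.
Context {R : realType}.
Local Notation P := (R * R)%type.
Local Notation der f x d := (is_derive x (1 : R) (f : R -> R) (d : R)).

(** The polynomial factor makes the family closed under differentiation; [p = 1] gives the classical
    flat function. *)
Definition flat (p : {poly R}) (s : R) : R :=
  if 0 < s then p.[s^-1] * expR (- s^-1) else 0.

(** Term by term: the exponential series bounds [x ^+ n] by [n! * expR x]. *)
Lemma horner_le_expR (p : {poly R}) :
  exists2 C, 0 <= C & forall x, 0 <= x -> `|p.[x]| <= C * expR x.
Proof.
exists (\sum_(i < size p) `|p`_i| * i`!%:R).
  by apply: sumr_ge0 => i _; rewrite mulr_ge0 ?normr_ge0.
move=> x x0; rewrite horner_coef mulr_suml (le_trans (ler_norm_sum _ _ _))//.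
apply: ler_sum => i _; rewrite normrM -mulrA ler_wpM2l ?normr_ge0//.
rewrite ger0_norm ?exprn_ge0//.
case: (nat_of_ord i) => [|n]; first by rewrite expr0 fact0 mul1r -(expR0) ler_expR.
rewrite mulrC -ler_pdivrMr ?ltr0n ?fact_gt0//.
by apply: le_trans (expR_ge1Dxn n x0); rewrite lerDr.
Qed.

(** The preceding bound for ['X^2 * p], taken at [s^-1]. Being quadratic in [s], it makes the
    difference quotient at 0 tend to 0. *)
Lemma flat_bound p : exists2 C, 0 <= C & forall s, `|flat p s| <= C * s ^+ 2.
Proof.
have [C C0 H] := horner_le_expR ('X^2 * p); exists C => // s.
rewrite /flat; case: ltP => s0; last by rewrite normr0 mulr_ge0 ?sqr_ge0.
have := H s^-1; rewrite invr_ge0 (ltW s0) => /(_ isT).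
rewrite hornerM hornerXn normrM ger0_norm ?sqr_ge0// => E.
rewrite normrM (ger0_norm (expR_ge0 _)) expRN ler_pdivrMr ?expR_gt0//.
rewrite exprVn in E.
by rewrite mulrAC -ler_pdivrMr ?exprn_gt0// mulrC.
Qed.

Lemma near0_norm_le (e : R) : 0 < e -> \forall x \near (0 : R), `|x| <= e.
Proof. by move=> e0; exists e => // x /=; rewrite sub0r normrN => /ltW. Qed.

Lemma flat_chain p (x : R) : der (flat p) x (flat ('X^2 * (p - p^`())) x).
Proof.
have [x0|x0|<-] := ltrgtP 0 x.
- have xN0 : x != 0 by rewrite gt_eqF.
  apply: (@near_eq_is_derive R R R (fun s => p.[s^-1] * expR (- s^-1)) (flat p) x 1).
    near=> s; rewrite /flat; suff -> : 0 < s by [].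
    by near: s; exact: lt_nbhsr.
  have dI : der (fun s : R => s^-1) x (- (x ^- 2)).
    have := @is_deriveV R id x 1 1 xN0 (der_id x).
    by move=> /der_eq; apply; rewrite /GRing.scale /= mulr1.
  have D := derM (der_comp dI (is_derive_poly p _)) (der_comp (derN dI) (der_exp _)).
  apply: (der_eq D); rewrite /flat x0.
  rewrite hornerM hornerXn hornerD hornerN exprVn /=.
  by ring.
- have -> : flat ('X^2 * (p - p^`())) x = 0 by rewrite /flat ltNge ltW.
  apply: (@near_eq_is_derive R R R (fun=> 0) (flat p) x 1).
    near=> s; rewrite /flat ltNge; suff -> : s <= 0 by [].
    by apply: ltW; near: s; exact: lt_nbhsl.
- rewrite {2}/flat ltxx; apply/is_derive1_caratheodory.
  exists (fun s => flat p s / s); split.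
  + move=> z; rewrite {2}/flat ltxx !subr0.
    have [->|z0] := eqVneq z 0; first by rewrite /flat ltxx mulr0.
    by rewrite divfK.
  + have [C C0 H] := flat_bound p.
    have E0 : flat p 0 / 0 = 0 by rewrite invr0 mulr0.
    suff : flat p s / s @[s --> (0:R)] --> (0:R) by rewrite -{2}E0.
    apply/cvgr0Pnorm_le => e e0.
    near=> s; rewrite normrM normfV.
    have [->|sN0] := eqVneq s 0; first by rewrite normr0 invr0 mulr0 ltW.
    rewrite ler_pdivrMr ?normr_gt0// (le_trans (H s))//.
    have -> : s ^+ 2 = `|s| * `|s| by rewrite -expr2 real_normK ?num_real.
    rewrite mulrA ler_wpM2r ?normr_ge0//.
    have sb : `|s| <= e / (C + 1).
      by near: s; apply: near0_norm_le; rewrite divr_gt0 ?ltr_wpDl.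
    rewrite (le_trans (ler_wpM2l C0 sb))// mulrCA ler_piMr ?(ltW e0)// ler_pdivrMr ?ltr_wpDl//.
    by rewrite mul1r lerDl.
  + by rewrite invr0 mulr0.
Unshelve. all: by end_near. Qed.

Definition chi (s : R) : R := flat 1 s.

Lemma chi_gt0 s : (0 < chi s) = (0 < s).
Proof. by rewrite /chi /flat; case: ifP => s0; rewrite ?ltxx// hornerC mul1r expR_gt0. Qed.

Lemma chi_ge0 s : 0 <= chi s.
Proof. by rewrite /chi /flat; case: ifP => s0 //; rewrite hornerC mul1r expR_ge0. Qed.

Lemma chi_le1 s : chi s <= 1.
Proof.
rewrite /chi /flat; case: ifP => s0 //; rewrite hornerC mul1r -expR0 ler_expR.
by rewrite oppr_le0 invr_ge0 ltW.
Qed.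

(** From [s^-1 <= expR s^-1]. Because of this linear bound, [HH - hs] decays at most exponentially
    in backward time inside the loop. *)
Lemma chi_le_id s : 0 <= s -> chi s <= s.
Proof.
move=> s0; rewrite /chi /flat; case: ifP => [s1|//]; rewrite hornerC mul1r expRN.
rewrite -[leRHS]invrK lef_pV2 ?posrE ?expR_gt0 ?invr_gt0//.
by apply: le_trans (expR_ge1Dx _); rewrite lerDr.
Qed.

Lemma smc_chi (f : P -> R) : smc f -> smc (fun z => chi (f z)).
Proof.
move=> fS.
apply: (@smc_comp _ (fun n => flat (iter n (fun p : {poly R} => 'X^2 * (p - p^`())) 1))) => //.
by move=> n x; exact: flat_chain.
Qed.

End Flat.

(** * The flow of a Lipschitz vector field *)

Section ODE.
Context {R : realType}.
Local Notation der f x d := (is_derive x (1 : R) (f : R -> R) (d : R)).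

Lemma der_ge0_le (f df : R -> R) (a b : R) : a <= b ->
  (forall t, a <= t <= b -> der f t (df t)) ->
  (forall t, a <= t <= b -> 0 <= df t) -> f a <= f b.
Proof.
move=> ab fD f0; have [c cab E] := der_MVT ab fD.
by rewrite -subr_ge0 E mulr_ge0 ?f0 ?subr_ge0.
Qed.

Lemma der_le0_ge (f df : R -> R) (a b : R) : a <= b ->
  (forall t, a <= t <= b -> der f t (df t)) ->
  (forall t, a <= t <= b -> df t <= 0) -> f b <= f a.
Proof.
move=> ab fD f0; have [c cab E] := der_MVT ab fD.
by rewrite -subr_le0 E mulr_le0_ge0 ?f0 ?subr_ge0.
Qed.

Lemma der_unique (f : R -> R) x a b : der f x a -> der f x b -> a = b.
Proof. by move=> [_ <-] [_ <-]. Qed.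

Lemma antiderivative_gtN1 (f : R -> R) : continuous f ->
  exists F : R -> R, forall x : R, -1 < x -> der F x (f x).
Proof.
move=> fc.
exists (fun x => (\int[lebesgue_measure]_(t in [set` Interval (BLeft (-1)) (BRight x)]) f t)%R).
move=> x x1.
have [||||dF FE] := @continuous_FTC1 R f (BLeft (-1)) x (x + 1).
- by rewrite ltrDl.
- apply: continuous_compact_integrable; first exact: segment_compact.
  by apply: continuous_subspaceT.
- by rewrite /= lte_fin.
- exact: fc.
split; [exact: dF|by rewrite -derive1E FE].
Qed.

(** The integral from -1 serves only to the right of -1. The rest of the line comes from the same
    construction for [t => f (- t)]; both pieces, normalised to vanish at 0, agree on ]-1, 1[. *)
Lemma antiderivative (f : R -> R) : continuous f ->
  exists F : R -> R, F 0 = 0 /\ forall x : R, der F x (f x).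
Proof.
move=> fc; have [F1 F1D] := antiderivative_gtN1 fc.
have [F2 F2D] : exists F : R -> R, forall x : R, x < 1 -> der F x (f x).
  have fNc : continuous (fun t => f (- t)).
    by move=> t; apply: continuous_comp; [exact: opp_continuous|exact: fc].
  have [G GD] := antiderivative_gtN1 fNc.
  exists (fun x => - G (- x)) => x x1.
  have xN : -1 < - x by rewrite ltrN2.
  apply: (der_eq (derN (der_comp (derN (der_id x)) (GD _ xN)))).
  by rewrite opprK mulrN1 opprK.
have E (x : R) : -1 < x < 1 -> F1 x - F1 0 = F2 x - F2 0.
  move=> /andP[x1 x2].
  have D (t : R) : -1 < t < 1 -> der (fun t => F1 t - F2 t) t 0.
    move=> /andP[t1 t2]; apply: (der_eq (derD (F1D _ t1) (derN (F2D _ t2)))).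
    exact: subrr.
  suff : F1 x - F2 x = F1 0 - F2 0 by move=> H; lra.
  have [x0|x0] := leP x 0.
    have [|c cx] := @der_MVT _ (fun t => F1 t - F2 t) (fun=> 0) x 0 x0.
      by move=> t /andP[xt t0]; apply: D; apply/andP; split; lra.
    by rewrite mul0r => /eqP; rewrite subr_eq0 => /eqP <-.
  have [|c cx] := @der_MVT _ (fun t => F1 t - F2 t) (fun=> 0) 0 x (ltW x0).
    by move=> t /andP[xt t0]; apply: D; apply/andP; split; lra.
  by rewrite mul0r => /eqP; rewrite subr_eq0 => /eqP ->.
exists (fun x => if 0 <= x then F1 x - F1 0 else F2 x - F2 0); split.
  by rewrite lexx subrr.
move=> x; have [x0|x0] := ltP (-1) x.
  apply: (@near_eq_is_derive R R R (fun x => F1 x - F1 0)); last first.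
    exact: (der_eq (derD (F1D _ x0) (der_cst (- F1 0) x)) (addr0 _)).
  near=> t; have t1 : -1 < t by near: t; exact: lt_nbhsr.
  by case: leP => // t0; apply: E; rewrite t1/=; lra.
have x1 : x < 1 by lra.
apply: (@near_eq_is_derive R R R (fun x => F2 x - F2 0)); last first.
  exact: (der_eq (derD (F2D _ x1) (der_cst (- F2 0) x)) (addr0 _)).
near=> t; have t0 : t < 0 by near: t; apply: lt_nbhsl; lra.
by case: leP => // t0'; lra.
Unshelve. all: by end_near. Qed.

Definition prim (f : R -> R) : R -> R :=
  get [set F : R -> R | F 0 = 0 /\ forall x : R, der F x (f x)].

Lemma primP f : continuous f -> prim f 0 = 0 /\ forall x : R, der (prim f) x (f x).
Proof.
move=> /antiderivative[F FP].
by apply: (@getPex _ [set F : R -> R | F 0 = 0 /\ forall x : R, der F x (f x)]); exists F.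
Qed.

(* A weight for which the Picard operator contracts by a factor 2 on the whole line. *)
Definition wt (k t : R) : R := expR (k * t) + expR (- (k * t)).

Lemma wt_gt0 k t : 0 < wt k t.
Proof. by rewrite addr_gt0 ?expR_gt0. Qed.

Lemma wt_ge1 k t : 1 <= wt k t.
Proof.
have [kt|kt] := leP 0 (k * t).
  by rewrite (le_trans (_ : _ <= expR (k * t))) ?lerDl ?expR_ge0// -expR0 ler_expR.
rewrite (le_trans (_ : _ <= expR (- (k * t)))) ?lerDr ?expR_ge0// -expR0 ler_expR.
by rewrite oppr_ge0 ltW.
Qed.

Lemma der_expM k t : der (fun t => expR (k * t)) t (k * expR (k * t)).
Proof.
apply: (der_eq (der_comp (derM (der_cst k t) (der_id t)) (der_exp _))).
by ring.
Qed.

(** The function [G] below has derivative exactly [c * wt k] and vanishes at 0, so [G - F] and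
    [G + F] are non-decreasing; hence [|F| <= |G|] on both half-lines. *)
Lemma wt_compare (F f : R -> R) c k : 0 < k -> 0 <= c -> F 0 = 0 ->
  (forall t : R, der F t (f t)) -> (forall t, `|f t| <= c * wt k t) ->
  forall t, `|F t| <= c / k * wt k t.
Proof.
move=> k0 c0 F0 FD fb t.
pose G t := c / k * (expR (k * t) - expR (- k * t)).
have GD (s : R) : der G s (c * wt k s).
  have D := derM (der_cst (c / k) s) (derD (der_expM k s) (derN (der_expM (- k) s))).
  apply: (der_eq D); rewrite /wt mulNr mul0r add0r.
  by field; rewrite gt_eqF.
have G0 : G 0 = 0 by rewrite /G !mulr0 subrr mulr0.
have Gle s : `|G s| <= c / k * wt k s.
  rewrite /G normrM ger0_norm ?divr_ge0 ?(ltW k0)// ler_wpM2l ?divr_ge0 ?(ltW k0)//.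
  by rewrite (le_trans (ler_normB _ _))// !ger0_norm ?expR_ge0// mulNr.
have H1 (s : R) : der (fun t => G t - F t) s (c * wt k s - f s) by exact: derD (GD s) (derN (FD s)).
have H2 (s : R) : der (fun t => G t + F t) s (c * wt k s + f s) by exact: derD (GD s) (FD s).
have P1 s : 0 <= c * wt k s - f s.
  by rewrite subr_ge0 (le_trans (ler_norm _)).
have P2 s : 0 <= c * wt k s + f s.
  by rewrite addrC -[X in _ + X]opprK subr_ge0 lerNl (le_trans (ler_norm _))// normrN.
apply: le_trans (Gle t).
have [t0|t0] := leP 0 t.
  have := der_ge0_le t0 (fun s _ => H1 s) (fun s _ => P1 s).
  have := der_ge0_le t0 (fun s _ => H2 s) (fun s _ => P2 s).
  rewrite /= G0 F0 subrr addr0 => A1 A2; rewrite (le_trans _ (ler_norm _))// ler_norml.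
  by apply/andP; split; lra.
have := der_ge0_le (ltW t0) (fun s _ => H1 s) (fun s _ => P1 s).
have := der_ge0_le (ltW t0) (fun s _ => H2 s) (fun s _ => P2 s).
rewrite /= G0 F0 subrr addr0 => A1 A2; apply: (@le_trans _ _ (- G t)); last by rewrite -normrN ler_norm.
by rewrite ler_norml; apply/andP; split; lra.
Qed.

(** The intervals of radius [2 * C * 2^-1 ^+ n] about [u n] are nested, so the supremum of their
    left ends lies in all of them. *)
Lemma geometric_cvg (u : nat -> R) C : (forall n, `|u n.+1 - u n| <= C * 2^-1 ^+ n) ->
  exists l, forall n, `|u n - l| <= 2 * C * 2^-1 ^+ n.
Proof.
move=> H; pose a n := u n - 2 * C * 2^-1 ^+ n; pose b n := u n + 2 * C * 2^-1 ^+ n.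
have C0 : 0 <= C by have := H 0%N; rewrite expr0 mulr1; apply: le_trans.
have pos n : 0 <= C * 2^-1 ^+ n by rewrite mulr_ge0// exprn_ge0.
have aS n : a n <= a n.+1.
  have := H n; have := pos n; rewrite ler_norml /a exprS => p /andP[]; lra.
have bS n : b n.+1 <= b n.
  have := H n; have := pos n; rewrite ler_norml /b exprS => p /andP[]; lra.
have am m n : (m <= n)%N -> a m <= a n.
  by move=> /subnK <-; elim: (n - m)%N => // k IH; rewrite addSn (le_trans IH).
have bm m n : (m <= n)%N -> b n <= b m.
  by move=> /subnK <-; elim: (n - m)%N => // k IH; rewrite addSn (le_trans _ IH).
have ab m n : a m <= b n.
  apply: (le_trans (am _ _ (leq_maxl m n))); apply: (le_trans _ (bm _ _ (leq_maxr m n))).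
  by rewrite /a /b; have := pos (maxn m n); lra.
have hs : has_sup (range a).
  split; first by exists (a 0%N), 0%N.
  by exists (b 0%N) => _ [m _ <-].
exists (sup (range a)) => n.
have h1 : a n <= sup (range a) by apply: ub_le_sup; [exact: hs.2|exists n].
have h2 : sup (range a) <= b n by apply: ge_sup; [exact: hs.1|move=> _ [m _ <-]].
by rewrite ler_norml; move: h1 h2; rewrite /a /b; lra.
Qed.

Lemma half_pow_small (e : R) : 0 < e -> exists n, 2^-1 ^+ n < e.
Proof.
move=> e0; have [n nE] : exists n : nat, e^-1 < n%:R.
  by exists (Num.truncn e^-1).+1; exact: truncnS_gt.
exists n; rewrite exprVn invf_plt ?posrE ?exprn_gt0//.
apply: (lt_le_trans nE); rewrite -natrX ler_nat ltnW//; exact: ltn_expl.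
Qed.

Lemma eq0_half_pow (a C : R) : (forall n, `|a| <= C * 2^-1 ^+ n) -> a = 0.
Proof.
move=> H; apply/eqP; rewrite -normr_le0 leNgt; apply/negP => a0.
have C0 : 0 < C by have := H 0%N; rewrite expr0 mulr1; exact: lt_le_trans.
have [n nE] := half_pow_small (divr_gt0 a0 C0).
have := H n; rewrite leNgt => /negP; apply.
by rewrite mulrC -ltr_pdivlMr.
Qed.

End ODE.

Lemma cont_near (R : realType) (f : R -> R) t0 e : {for t0, continuous f} -> 0 < e ->
  \forall t \near t0, `|f t0 - f t| <= e.
Proof. by move=> /cvgrPdist_le; exact. Qed.

Section Picard.
Context {R : realType}.
Local Notation P := (R * R)%type.
Local Notation der f x d := (is_derive x (1 : R) (f : R -> R) (d : R)).
Variables (v : P -> P) (L : R).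
Hypothesis L_gt0 : 0 < L.
Hypothesis vL : forall i (z w : P), `|Defs.comp i (v z) - Defs.comp i (v w)| <=
  L * (`|z.1 - w.1| + `|z.2 - w.2|).

Lemma lip_curve_cont i (f g : R -> R) : continuous f -> continuous g ->
  continuous (fun s => Defs.comp i (v (f s, g s))).
Proof.
move=> fc gc s0; apply/cvgrPdist_le => e e0.
have e1 : 0 < e / (2 * L) by rewrite divr_gt0 ?mulr_gt0.
have f1 := cont_near (fc s0) e1.
have g1 := cont_near (gc s0) e1.
near=> s; apply: (le_trans (vL _ _ _)) => /=.
have A : `|f s0 - f s| <= e / (2 * L) by near: s.
have B : `|g s0 - g s| <= e / (2 * L) by near: s.
rewrite (le_trans (ler_wpM2l (ltW L_gt0) (lerD A B)))//.
by rewrite le_eqVlt; apply/orP; left; apply/eqP; field; rewrite gt_eqF.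
Unshelve. all: by end_near. Qed.

Arguments lip_curve_cont i {f g}.

Variable z : P.

Fixpoint pic (n : nat) : bool -> R -> R :=
  if n is m.+1 then
    fun i t => Defs.comp i z + prim (fun s => Defs.comp i (v (pic m false s, pic m true s))) t
  else fun i _ => Defs.comp i z.

Let rhs n i s := Defs.comp i (v (pic n false s, pic n true s)).

Lemma pic_cont n i : continuous (pic n i).
Proof.
elim: n i => [|n IH] i; first by move=> t; exact: cst_continuous.
have [_ D] := primP (lip_curve_cont i (IH false) (IH true)).
by move=> t; apply: cvgD; [exact: cvg_cst|exact: der_cont (D t)].
Qed.

Let rhs_cont n i : continuous (rhs n i).
Proof. by apply: lip_curve_cont; exact: pic_cont. Qed.

(** The two components cost a factor [2 * L] in the Lipschitz bound, and integration against
    [wt (4 * L)] divides by [4 * L]: each iteration halves the error. [K] is the size of the first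
    step in this weight. *)
Let K := (`|Defs.comp false (v z)| + `|Defs.comp true (v z)|) / (4 * L).

Let K_ge0 : 0 <= K.
Proof. by rewrite divr_ge0 ?addr_ge0 ?mulr_ge0// ltW. Qed.

Let W t := wt (4 * L) t.

Lemma pic_step n i t : `|pic n.+1 i t - pic n i t| <= K * 2^-1 ^+ n * W t.
Proof.
have L4 : 0 < 4 * L by rewrite mulr_gt0.
elim: n i t => [|n IH] i t.
  have [F0 FD] := primP (@rhs_cont 0%N i).
  rewrite expr0 mulr1 /= addrC addKr; apply: (wt_compare L4 _ F0 FD).
    by rewrite addr_ge0.
  move=> s; rewrite /rhs /= -surjective_pairing.
  apply: (@le_trans _ _ ((`|Defs.comp false (v z)| + `|Defs.comp true (v z)|) * 1)).
    by rewrite mulr1; clear; case: i; rewrite ?lerDr ?lerDl.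
  by rewrite ler_wpM2l ?addr_ge0// wt_ge1.
have [F0 FD] := primP (@rhs_cont n.+1 i).
have [G0 GD] := primP (@rhs_cont n i).
pose F s := prim (rhs n.+1 i) s - prim (rhs n i) s.
have -> : pic n.+2 i t - pic n.+1 i t = F t.
  by rewrite /F /rhs /=; ring.
have -> : K * 2^-1 ^+ n.+1 = (2 * L * (K * 2^-1 ^+ n)) / (4 * L).
  by rewrite exprS; field; rewrite gt_eqF.
apply: (wt_compare L4 (f := fun s => rhs n.+1 i s - rhs n i s)).
- apply: mulr_ge0; first by rewrite mulr_ge0// ltW.
  by rewrite mulr_ge0// exprn_ge0.
- by rewrite /F F0 G0 subrr.
- move=> s; apply: (le_trans (vL _ _ _)).
  rewrite (le_trans (ler_wpM2l (ltW L_gt0) (lerD (IH _ _) (IH _ _))))//.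
  by rewrite le_eqVlt; apply/orP; left; apply/eqP; rewrite /W; ring.
Qed.

(** The limit is chosen pointwise by its rate of convergence, so that the error estimate is its
    specification. *)
Definition psol (i : bool) (t : R) : R :=
  get [set l | forall n, `|pic n i t - l| <= 2 * (K * W t) * 2^-1 ^+ n].

Lemma psolP i t n : `|pic n i t - psol i t| <= 2 * (K * W t) * 2^-1 ^+ n.
Proof.
have [m|l lP] := @geometric_cvg R (fun n => pic n i t) (K * W t).
  by rewrite (mulrAC K); exact: pic_step.
by apply: (@getPex _ [set l | forall n, `|pic n i t - l| <= 2 * (K * W t) * 2^-1 ^+ n]); exists l.
Qed.

Lemma W_cont : continuous W.
Proof.
move=> t; apply: (@der_cont _ W).
Qed.

(** Convergence is uniform where [W] is bounded, and [W t <= W t0 + 1] near [t0]; a continuous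
    iterate then passes its continuity on, with three errors of [e / 3]. *)
Lemma psol_cont i : continuous (psol i).
Proof.
move=> t0; apply/cvgrPdist_le => e e0.
have w1 : 0 < W t0 + 1 by apply: addr_gt0 => //; exact: wt_gt0.
pose C := 2 * (K * (W t0 + 1)) + 1.
have C0 : 0 < C.
  by apply: ltr_wpDl => //; apply: mulr_ge0 => //; apply: mulr_ge0 => //; exact: ltW.
have [n nE] := half_pow_small (divr_gt0 e0 (mulr_gt0 (ltr0n R 3) C0)).
have H t : W t <= W t0 + 1 -> `|pic n i t - psol i t| <= e / 3.
  move=> Wt; apply: (le_trans (psolP i t n)).
  apply: (@le_trans _ _ (C * 2^-1 ^+ n)).
    rewrite ler_wpM2r ?exprn_ge0// /C.
    by rewrite (le_trans (_ : _ <= 2 * (K * (W t0 + 1)))) ?lerDl// ler_wpM2l// ler_wpM2l.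
  apply: (le_trans (ler_wpM2l (ltW C0) (ltW nE))).
  by rewrite le_eqVlt; apply/orP; left; apply/eqP; field; rewrite gt_eqF.
have e3 : 0 < e / 3 by rewrite divr_gt0.
have f1 := cont_near (@pic_cont n i t0) e3.
have f2 := cont_near (@W_cont t0) (@ltr01 R).
near=> t.
have A : `|pic n i t0 - pic n i t| <= e / 3 by near: t.
have B : `|W t0 - W t| <= 1 by near: t.
have H1 := H t; have H0 := H t0.
have {}H1 := H1 (_ : W t <= W t0 + 1).
have {}H0 := H0 (_ : W t0 <= W t0 + 1).
have {}H1 : `|pic n i t - psol i t| <= e / 3 by apply: H1; move: B; rewrite ler_norml => /andP[]; lra.
have {}H0 : `|pic n i t0 - psol i t0| <= e / 3 by apply: H0; rewrite lerDl.
move: A H1 H0; rewrite !ler_norml => /andP[? ?] /andP[? ?] /andP[? ?].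
by apply/andP; split; lra.
Unshelve. all: by end_near. Qed.

(** Both sides are compared with the iterates: the error is at most a fixed multiple of [2^-1 ^+ n]
    for every [n]. *)
Lemma psolE i t :
  psol i t = Defs.comp i z + prim (fun s => Defs.comp i (v (psol false s, psol true s))) t.
Proof.
have L4 : 0 < 4 * L by rewrite mulr_gt0.
have [F0 FD] := primP (lip_curve_cont i (@psol_cont false) (@psol_cont true)).
set F := prim _ in F0 FD *.
apply/eqP; rewrite -subr_eq0; apply/eqP.
apply: (@eq0_half_pow _ _ (2 * (K * W t))) => n.
have [G0 GD] := primP (@rhs_cont n i).
have B : `|prim (rhs n i) t - F t| <= (4 * L * (K * 2^-1 ^+ n)) / (4 * L) * W t.
  apply: (wt_compare L4 (F := fun t => prim (rhs n i) t - F t)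
    (f := fun s => rhs n i s - Defs.comp i (v (psol false s, psol true s)))).
  - apply: mulr_ge0; first by rewrite mulr_ge0// ltW.
    by rewrite mulr_ge0// exprn_ge0.
  - by rewrite F0 G0 subrr.
  - move=> s; apply: (le_trans (vL _ _ _)).
    rewrite (le_trans (ler_wpM2l (ltW L_gt0) (lerD (psolP _ _ n) (psolP _ _ n))))//.
    by rewrite le_eqVlt; apply/orP; left; apply/eqP; rewrite /W; ring.
have A := psolP i t n.+1.
have E : (4 * L * (K * 2^-1 ^+ n)) / (4 * L) * W t = (K * W t) * 2^-1 ^+ n.
  by field; rewrite gt_eqF.
have E2 : 2 * (K * W t) * 2^-1 ^+ n.+1 = (K * W t) * 2^-1 ^+ n by rewrite exprS; field.
rewrite E in B; rewrite E2 in A.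
rewrite /= -/(rhs n i) in A.
move: A B; rewrite !ler_norml => /andP[? ?] /andP[? ?].
by apply/andP; split; lra.
Qed.

Lemma psol0 i : psol i 0 = Defs.comp i z.
Proof.
rewrite psolE; have [-> _] := primP (lip_curve_cont i (@psol_cont false) (@psol_cont true)).
by rewrite addr0.
Qed.

Lemma psol_der i t : der (psol i) t (Defs.comp i (v (psol false t, psol true t))).
Proof.
have [_ D] := primP (lip_curve_cont i (@psol_cont false) (@psol_cont true)).
have := derD (der_cst (Defs.comp i z) t) (D t); rewrite add0r.
suff -> : psol i = fun t => Defs.comp i z +
  prim (fun s => Defs.comp i (v (psol false s, psol true s))) t by [].
by apply/funext => s; exact: psolE.
Qed.

End Picard.

Section FlowOfLipschitzField.
Context {R : realType}.
Local Notation P := (R * R)%type.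
Local Notation der f x d := (is_derive x (1 : R) (f : R -> R) (d : R)).

Lemma gronwall (e e' : R -> R) c : 0 <= c -> (forall t : R, der e t (e' t)) ->
  (forall t, `|e' t| <= c * e t) -> forall t, e t <= e 0 * expR (c * `|t|).
Proof.
move=> c0 eD eb t.
have [t0|t0] := leP 0 t.
  rewrite ger0_norm//.
  have D (s : R) := derM (eD s) (der_expM (- c) s).
  have : e t * expR (- c * t) <= e 0 * expR (- c * 0).
    apply: (der_le0_ge t0 (fun s _ => D s)) => s _.
    have -> : e' s * expR (- c * s) + e s * (- c * expR (- c * s)) =
      (e' s - c * e s) * expR (- c * s) by ring.
    rewrite mulr_le0_ge0 ?expR_ge0// subr_le0; apply: le_trans (eb s).
    exact: ler_norm.
  by rewrite mulr0 expR0 mulr1 mulNr expRN ler_pdivrMr ?expR_gt0.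
rewrite ltr0_norm//.
have D (s : R) := derM (eD s) (der_expM c s).
have : e t * expR (c * t) <= e 0 * expR (c * 0).
  apply: (der_ge0_le (ltW t0) (fun s _ => D s)) => s _.
  have -> : e' s * expR (c * s) + e s * (c * expR (c * s)) =
    (c * e s - (- e' s)) * expR (c * s) by ring.
  rewrite mulr_ge0 ?expR_ge0// subr_ge0; apply: le_trans (eb s).
  by rewrite -normrN ler_norm.
by rewrite mulr0 expR0 mulr1 mulrN expRN ler_pdivlMr ?expR_gt0.
Qed.

Lemma cvg_to_pair (T : Type) (F : set_system T) (FF : Filter F) (f g : T -> R) (a b : R) :
  f @ F --> a -> g @ F --> b -> (fun x => (f x, g x)) @ F --> ((a, b) : P).
Proof. by move=> fa gb; exact: (@cvg_pair T R R F (nbhs a) (nbhs b) _ _ _ f g fa gb). Qed.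

Lemma der_pair (f g : R -> R) (t a b : R) : der f t a -> der g t b ->
  is_derive t (1 : R) (fun s => (f s, g s) : P) (a, b).
Proof.
move=> [fD fE] [gD gE].
have H : (fun h => h^-1 *: (((fun s => (f s, g s) : P) \o shift t) (h *: (1 : R)) -
    (f t, g t))) @ 0^' --> ((a, b) : P).
  have -> : (fun h => h^-1 *: (((fun s => (f s, g s) : P) \o shift t) (h *: (1 : R)) -
     (f t, g t))) = (fun h => (h^-1 *: ((f \o shift t) (h *: (1 : R)) - f t),
     h^-1 *: ((g \o shift t) (h *: (1 : R)) - g t)) : P) by [].
  by apply: cvg_to_pair; [rewrite -fE|rewrite -gE].
split; first by apply/cvg_ex; exists (a, b).
by apply: cvg_lim => //; exact: norm_hausdorff.
Qed.

Variables (v : P -> P) (L : R).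
Hypothesis L_gt0 : 0 < L.
Hypothesis vL : forall i (z w : P), `|Defs.comp i (v z) - Defs.comp i (v w)| <=
  L * (`|z.1 - w.1| + `|z.2 - w.2|).

Definition solution (f g : R -> R) := forall t : R,
  der f t (v (f t, g t)).1 /\ der g t (v (f t, g t)).2.

(** Gronwall for the squared Euclidean distance, which, unlike the sum of absolute values, is
    differentiable; its derivative is at most [4 * L] times itself. *)
Lemma solution_dist f g f' g' : solution f g -> solution f' g' -> forall t,
  (f t - f' t) ^+ 2 + (g t - g' t) ^+ 2 <=
  ((f 0 - f' 0) ^+ 2 + (g 0 - g' 0) ^+ 2) * expR (4 * L * `|t|).
Proof.
move=> S S'.
have D (t : R) := derD
  (derM (derD (S t).1 (derN (S' t).1)) (derD (S t).1 (derN (S' t).1)))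
  (derM (derD (S t).2 (derN (S' t).2)) (derD (S t).2 (derN (S' t).2))).
apply: (gronwall _ D); first by rewrite mulr_ge0// ltW.
move=> t /=; set a := f t - f' t; set b := g t - g' t.
have := vL false (f t, g t) (f' t, g' t); have := vL true (f t, g t) (f' t, g' t).
rewrite /= -/a -/b; set p := (_.2 - _.2); set q := (_.1 - _.1) => pb qb.
have -> : q * a + a * q + (p * b + b * p) = 2 * (a * q + b * p) by ring.
rewrite normrM ger0_norm//.
have H : `|a * q + b * p| <= L * (`|a| + `|b|) ^+ 2.
  apply: (le_trans (ler_normD _ _)); rewrite !normrM.
  apply: (@le_trans _ _ (`|a| * (L * (`|a| + `|b|)) + `|b| * (L * (`|a| + `|b|)))).
    by apply: lerD; apply: ler_wpM2l.
  by rewrite le_eqVlt; apply/orP; left; apply/eqP; ring.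
have H2 : (`|a| + `|b|) ^+ 2 <= 2 * (a ^+ 2 + b ^+ 2).
  have <- : `|a| ^+ 2 = a ^+ 2 by rewrite real_normK ?num_real.
  have <- : `|b| ^+ 2 = b ^+ 2 by rewrite real_normK ?num_real.
  rewrite -subr_ge0.
  by have -> : 2 * (`|a| ^+ 2 + `|b| ^+ 2) - (`|a| + `|b|) ^+ 2 = (`|a| - `|b|) ^+ 2;
    [ring|exact: sqr_ge0].
have := ler_wpM2l (ltW L_gt0) H2 => H3.
rewrite -!expr2 in H3 *; lra.
Qed.

Lemma solution_unique f g f' g' : solution f g -> solution f' g' ->
  f 0 = f' 0 -> g 0 = g' 0 -> forall t, (f t, g t) = (f' t, g' t).
Proof.
move=> S S' f0 g0 t; have := solution_dist S S' t.
rewrite f0 g0 !subrr expr0n addr0 mul0r => H.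
have a0 : 0 <= (f t - f' t) ^+ 2 by exact: sqr_ge0.
have b0 : 0 <= (g t - g' t) ^+ 2 by exact: sqr_ge0.
have /eqP : (f t - f' t) ^+ 2 = 0 by lra.
rewrite sqrf_eq0 subr_eq0 => /eqP ->.
have /eqP : (g t - g' t) ^+ 2 = 0 by lra.
by rewrite sqrf_eq0 subr_eq0 => /eqP ->.
Qed.

Definition lflow_def (t : R) (z : P) : P := (psol v L z false t, psol v L z true t).
(* Locked so that simplification keeps [lflow t z] folded under projections. *)
Definition lflow : R -> P -> P := locked lflow_def.

Lemma lflowE t z : lflow t z = (psol v L z false t, psol v L z true t).
Proof. by rewrite /lflow -lock. Qed.

Lemma lflow_solution z : solution (fun t => (lflow t z).1) (fun t => (lflow t z).2).
Proof.
rewrite /lflow -lock.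
by move=> t; split; [exact: (psol_der L_gt0 vL z false)|exact: (psol_der L_gt0 vL z true)].
Qed.

Lemma lflow0 z : lflow 0 z = z.
Proof. by rewrite lflowE !psol0// -surjective_pairing. Qed.

Lemma lflow_der1 z (t : R) : der (fun t => (lflow t z).1) t (v (lflow t z)).1.
Proof. by have [] := lflow_solution z t; rewrite -surjective_pairing. Qed.

Lemma lflow_der2 z (t : R) : der (fun t => (lflow t z).2) t (v (lflow t z)).2.
Proof. by have [] := lflow_solution z t; rewrite -surjective_pairing. Qed.

Lemma lflow_eq f g z : solution f g -> f 0 = z.1 -> g 0 = z.2 ->
  forall t, (f t, g t) = lflow t z.
Proof.
move=> S f0 g0 t; rewrite [RHS]surjective_pairing.
by apply: (solution_unique S (lflow_solution z)); rewrite lflow0.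
Qed.

Lemma lflowD s t z : lflow (s + t) z = lflow s (lflow t z).
Proof.
pose f s := (lflow (s + t) z).1; pose g s := (lflow (s + t) z).2.
have S : solution f g.
  move=> u; split; rewrite /f /g -surjective_pairing.
    have := der_comp (derD (der_id u) (der_cst t u)) (lflow_der1 z (u + t)).
    by rewrite addr0 mulr1.
  have := der_comp (derD (der_id u) (der_cst t u)) (lflow_der2 z (u + t)).
  by rewrite addr0 mulr1.
by rewrite -(lflow_eq (z := lflow t z) S) /f /g ?add0r// -surjective_pairing.
Qed.

Lemma lflow_flow : flow_of v lflow.
Proof.
split; first exact: lflow0.
split; first by move=> s t z; exact: lflowD.
move=> t z; have := der_pair (lflow_der1 z t) (lflow_der2 z t).
suff -> : (fun s => lflow s z) = fun s => ((lflow s z).1, (lflow s z).2).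
  by rewrite -surjective_pairing.
by apply/funext => s; exact: surjective_pairing.
Qed.

Lemma lflow_lip t z w : `|(lflow t z).1 - (lflow t w).1| + `|(lflow t z).2 - (lflow t w).2| <=
  2 * expR (2 * L * `|t|) * (`|z.1 - w.1| + `|z.2 - w.2|).
Proof.
have := solution_dist (lflow_solution z) (lflow_solution w) t.
rewrite !lflow0; set a := _ - _; set b := (_.2 - _.2); set c := (z.1 - _); set d := (z.2 - _).
have -> : expR (4 * L * `|t|) = expR (2 * L * `|t|) ^+ 2.
  by rewrite expr2 -expRD; congr expR; ring.
set E := expR _ => H.
have E0 : 0 <= E by exact: expR_ge0.
have H2 : c ^+ 2 + d ^+ 2 <= (`|c| + `|d|) ^+ 2.
  have <- : `|c| ^+ 2 = c ^+ 2 by rewrite real_normK ?num_real.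
  have <- : `|d| ^+ 2 = d ^+ 2 by rewrite real_normK ?num_real.
  rewrite -subr_ge0.
  have -> : (`|c| + `|d|) ^+ 2 - (`|c| ^+ 2 + `|d| ^+ 2) = 2 * (`|c| * `|d|) by ring.
  by rewrite mulr_ge0 ?mulr_ge0.
have H3 : a ^+ 2 + b ^+ 2 <= (E * (`|c| + `|d|)) ^+ 2.
  by rewrite exprMn mulrC; apply: (le_trans H); rewrite ler_wpM2r ?sqr_ge0.
have pos : 0 <= E * (`|c| + `|d|) by rewrite mulr_ge0 ?addr_ge0.
have K (x : R) : x ^+ 2 <= (E * (`|c| + `|d|)) ^+ 2 -> `|x| <= E * (`|c| + `|d|).
  by rewrite -[x ^+ 2]real_normK ?num_real// ler_sqr ?nnegrE.
have A : `|a| <= E * (`|c| + `|d|) by apply: K; apply: le_trans H3; rewrite lerDl sqr_ge0.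
have B : `|b| <= E * (`|c| + `|d|) by apply: K; apply: le_trans H3; rewrite lerDr sqr_ge0.
by lra.
Qed.

Lemma lflow_cont t : continuous (lflow t).
Proof.
move=> z; have Epos : 0 < 2 * expR (2 * L * `|t|) :> R by rewrite mulr_gt0 ?expR_gt0.
have near12 (e : R) : 0 < e -> \forall w \near z,
    `|z.1 - w.1| + `|z.2 - w.2| <= e.
  move=> e0; have e2 : 0 < e / 2 by rewrite divr_gt0.
  have /cvgrPdist_le /(_ _ e2) A : (fun w : P => w.1) @ z --> z.1 by exact: cvg_fst.
  have /cvgrPdist_le /(_ _ e2) B : (fun w : P => w.2) @ z --> z.2 by exact: cvg_snd.
  near=> w; rewrite [leRHS](splitr e); apply: lerD; near: w; [exact: A|exact: B].
suff H : forall e : R, 0 < e -> \forall w \near z,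
    `|(lflow t z).1 - (lflow t w).1| + `|(lflow t z).2 - (lflow t w).2| <= e.
  rewrite /continuous_at [X in _ --> X]surjective_pairing.
  have -> : lflow t = fun w => ((lflow t w).1, (lflow t w).2).
    by apply/funext => w; exact: surjective_pairing.
  apply: cvg_to_pair => /=; apply/cvgrPdist_le => e e0; apply: filterS (H e e0) => w; apply: le_trans.
    by rewrite lerDl.
  by rewrite lerDr.
move=> e e0; have := near12 (e / (2 * expR (2 * L * `|t|))); rewrite divr_gt0// => /(_ isT).
apply: filterS => w; rewrite ler_pdivlMr// mulrC => H.
exact: le_trans (lflow_lip t z w) H.
Unshelve. all: by end_near. Qed.

Hypothesis vP : forall z k, v (z + intv R k) = v z.

Lemma lflow_translate t z k : lflow t (z + intv R k) = lflow t z + intv R k.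
Proof.
pose f s := (lflow s z).1 + (intv R k).1; pose g s := (lflow s z).2 + (intv R k).2.
have E s : (f s, g s) = lflow s z + intv R k by [].
have S : solution f g.
  move=> u; split; rewrite E vP.
    have := derD (lflow_der1 z u) (der_cst (intv R k).1 u).
    by rewrite addr0.
  have := derD (lflow_der2 z u) (der_cst (intv R k).2 u).
  by rewrite addr0.
by rewrite -(lflow_eq (z := z + intv R k) S) /f /g ?lflow0.
Qed.

End FlowOfLipschitzField.

(** * The model vector field *)

Section CircleFunctions.
Context {R : realType}.
Local Notation P := (R * R)%type.
Local Notation der f x d := (is_derive x (1 : R) (f : R -> R) (d : R)).

Definition S2 (t : R) : R := sin (2 * pi * t).
Definition C2 (t : R) : R := cos (2 * pi * t).

Lemma C2S2 t : C2 t ^+ 2 + S2 t ^+ 2 = 1. Proof. exact: cos2Dsin2. Qed.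
Lemma C2_ge t : -1 <= C2 t. Proof. exact: cos_geN1. Qed.
Lemma C2_le t : C2 t <= 1. Proof. exact: cos_le1. Qed.
Lemma S2_ge t : -1 <= S2 t. Proof. exact: sin_geN1. Qed.
Lemma S2_le t : S2 t <= 1. Proof. exact: sin_le1. Qed.

Lemma C2N t : C2 (- t) = C2 t. Proof. by rewrite /C2 mulrN cosN. Qed.
Lemma S2N t : S2 (- t) = - S2 t. Proof. by rewrite /S2 mulrN sinN. Qed.

Lemma C2int t (k : int) : C2 (t + k%:~R) = C2 t.
Proof.
have H (n : nat) s : C2 (s + n%:R) = C2 s.
  rewrite /C2 mulrDr.
  have -> : 2 * pi * n%:R = pi *+ 2 *+ n :> R by rewrite -[pi *+ 2]mulr_natl mulr_natr.
  by rewrite (periodicn (@cosD2pi R)).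
case: k => n; first by rewrite -pmulrn H.
by rewrite NegzE mulrNz -pmulrn -(H n.+1 (t - _)) subrK.
Qed.

Lemma S2int t (k : int) : S2 (t + k%:~R) = S2 t.
Proof.
have H (n : nat) s : S2 (s + n%:R) = S2 s.
  rewrite /S2 mulrDr.
  have -> : 2 * pi * n%:R = pi *+ 2 *+ n :> R by rewrite -[pi *+ 2]mulr_natl mulr_natr.
  by rewrite (periodicn (@sinD2pi R)).
case: k => n; first by rewrite -pmulrn H.
by rewrite NegzE mulrNz -pmulrn -(H n.+1 (t - _)) subrK.
Qed.

Lemma C2flip t : C2 (1 - t) = C2 t.
Proof. by rewrite addrC -C2N opprD opprK -[X in _ - X]/(1%:~R) -mulrNz C2int. Qed.

Lemma S2flip t : S2 (1 - t) = - S2 t.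
Proof. by rewrite addrC -[X in _ + X]/(1%:~R) S2int S2N. Qed.

Lemma der_C2 (t : R) : der C2 t (- (2 * pi * S2 t)).
Proof.
apply: (der_eq (der_comp (derM (der_cst (2 * pi) t) (der_id t)) (der_cos _))).
by rewrite /S2; ring.
Qed.

Lemma der_S2 (t : R) : der S2 t (2 * pi * C2 t).
Proof.
apply: (der_eq (der_comp (derM (der_cst (2 * pi) t) (der_id t)) (der_sin _))).
by rewrite /C2; ring.
Qed.

Lemma smc_C2 (f : P -> R) : smc f -> smc (fun z => C2 (f z)).
Proof. by move=> fS; apply: smc_cos; apply: smc_mul => //; exact: smc_cst. Qed.

Lemma smc_S2 (f : P -> R) : smc f -> smc (fun z => S2 (f z)).
Proof. by move=> fS; apply: smc_sin; apply: smc_mul => //; exact: smc_cst. Qed.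

Let pi0 : 0 < pi :> R. Proof. exact: pi_gt0. Qed.

Lemma C2_half : C2 (1 / 2) = -1.
Proof. by rewrite /C2 (_ : 2 * pi * (1 / 2) = pi :> R) ?cospi//; field. Qed.

Lemma S2_half : S2 (1 / 2) = 0.
Proof. by rewrite /S2 (_ : 2 * pi * (1 / 2) = pi :> R) ?sinpi//; field. Qed.

Lemma C2_sixth : C2 (1 / 6) = 1 / 2.
Proof.
have E1 : C2 (1 / 6 + 1 / 6) = 2 * C2 (1 / 6) ^+ 2 - 1.
  rewrite /C2 mulrDr cosD -!expr2; have := C2S2 (1 / 6); rewrite /C2 /S2 => H; lra.
have E2 : S2 (1 / 6 + 1 / 6) = 2 * (S2 (1 / 6) * C2 (1 / 6)).
  by rewrite /S2 /C2 mulrDr sinD; ring.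
have E3 : C2 (1 / 2) = C2 (1 / 6 + 1 / 6) * C2 (1 / 6) - S2 (1 / 6 + 1 / 6) * S2 (1 / 6).
  rewrite /C2 /S2 -cosD -mulrDr; congr (cos (_ * _)); lra.
rewrite C2_half E1 E2 in E3.
have H := C2S2 (1 / 6).
have c0 : 0 < C2 (1 / 6).
  by apply: cos_gt0_pihalf; have := pi0 => ?; apply/andP; split; lra.
move: E3 H c0; set c := C2 (1 / 6); set s := S2 (1 / 6) => E3 H c0.
(* The triple-angle formula at [1 / 6] reads [4 * c ^+ 3 - 3 * c = -1]; it factors like this, and
   [c > 0] excludes the root -1. *)
have : (c + 1) * (2 * c - 1) ^+ 2 = 0.
  have -> : (c + 1) * (2 * c - 1) ^+ 2 = 4 * c ^+ 3 - 3 * c + 1 by ring.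
  have E : s ^+ 2 = 1 - c ^+ 2 by lra.
  have : -1 = (2 * c ^+ 2 - 1) * c - 2 * c * s ^+ 2 by apply: (etrans E3); ring.
  rewrite E => E4; lra.
move/eqP; rewrite mulf_eq0 sqrf_eq0 => /orP[|] /eqP; lra.
Qed.

Lemma C2_decr (x y : R) : 0 <= x <= 1 / 2 -> 0 <= y <= 1 / 2 -> (C2 x < C2 y) = (y < x).
Proof.
have in0pi (t : R) : 0 <= t <= 1 / 2 -> 0 <= 2 * pi * t <= pi.
  move=> /andP[t0 t1]; have := pi0 => p0; have := mulr_ge0 (ltW p0) t0.
  have : 0 <= pi * (1 / 2 - t) by rewrite mulr_ge0 ?subr_ge0// ltW.
  by move=> ? ?; apply/andP; split; lra.
move=> xI yI; rewrite /C2 ltr_cos.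
- by rewrite ltr_pM2l// mulr_gt0.
- by rewrite in_itv /=; exact: in0pi.
- by rewrite in_itv /=; exact: in0pi.
Qed.

Lemma C2_gt_half t : -(1 / 6) < t < 1 / 6 -> 1 / 2 < C2 t.
Proof.
move=> /andP[t1 t2]; rewrite -C2_sixth.
have [t0|t0] := leP 0 t; first by rewrite C2_decr//; apply/andP; split; lra.
by rewrite -(C2N t) C2_decr; [lra|apply/andP; split; lra|apply/andP; split; lra].
Qed.

Lemma C2_lt_half t : 1 / 6 < t < 5 / 6 -> C2 t < 1 / 2.
Proof.
move=> /andP[t1 t2]; rewrite -C2_sixth.
have [t0|t0] := leP t (1 / 2); first by rewrite C2_decr//; apply/andP; split; lra.
by rewrite -(C2flip t) C2_decr; [lra|apply/andP; split; lra|apply/andP; split; lra].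
Qed.

Lemma C2_fiveSixth : C2 (5 / 6) = 1 / 2.
Proof. by rewrite -C2_sixth -C2flip; congr C2; field. Qed.

Lemma C2_le_half t : 1 / 6 <= t <= 5 / 6 -> C2 t <= 1 / 2.
Proof.
move=> /andP[]; rewrite le_eqVlt => /orP[/eqP <- _|t1]; first by rewrite C2_sixth.
rewrite le_eqVlt => /orP[/eqP ->|t2]; first by rewrite C2_fiveSixth.
by rewrite ltW// C2_lt_half// t1.
Qed.

Lemma C2_ge_half t : -(1 / 6) <= t <= 1 / 6 -> 1 / 2 <= C2 t.
Proof.
move=> /andP[]; rewrite le_eqVlt => /orP[/eqP <- _|t1]; first by rewrite C2N C2_sixth.
rewrite le_eqVlt => /orP[/eqP ->|t2]; first by rewrite C2_sixth.
by rewrite ltW// C2_gt_half// t1.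
Qed.

Lemma S2_gt0 t : 0 < t < 1 / 2 -> 0 < S2 t.
Proof.
move=> /andP[t0 t1]; apply: sin_gt0_pi; have := mulr_gt0 pi0 t0.
have : 0 < pi * (1 / 2 - t) by rewrite mulr_gt0 ?subr_gt0.
by move=> ? ?; apply/andP; split; lra.
Qed.

Lemma S2_ge0 t : 0 <= t <= 1 / 2 -> 0 <= S2 t.
Proof.
move=> /andP[t0 t1]; apply: sin_ge0_pi; have := mulr_ge0 (ltW pi0) t0.
have : 0 <= pi * (1 / 2 - t) by rewrite mulr_ge0 ?subr_ge0// ltW.
by move=> ? ?; apply/andP; split; lra.
Qed.

Lemma S2_le0 t : 1 / 2 <= t <= 1 -> S2 t <= 0.
Proof.
move=> /andP[t0 t1]; rewrite -oppr_ge0 -S2flip.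
by apply: S2_ge0; apply/andP; split; lra.
Qed.

Lemma S2_sixth_gt0 : 0 < S2 (1 / 6). Proof. by apply: S2_gt0; apply/andP; split; lra. Qed.

Lemma C2_eqN1 t : 0 <= t < 1 -> C2 t = -1 -> t = 1 / 2.
Proof.
move=> /andP[t0 t1]; rewrite -C2_half => E.
have [tl|tg|//] := ltgtP t (1 / 2).
  have : C2 (1 / 2) < C2 t by rewrite C2_decr//; apply/andP; split; lra.
  by rewrite E ltxx.
have : C2 (1 / 2) < C2 (1 - t) by rewrite C2_decr; [lra|apply/andP; split; lra|apply/andP; split; lra].
by rewrite C2flip E ltxx.
Qed.

Lemma C2_eq_half t : -(1 / 6) <= t < 5 / 6 -> C2 t = 1 / 2 -> t = - (1 / 6) \/ t = 1 / 6.
Proof.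
move=> /andP[t0 t1] E.
have [|t2|->] := ltgtP t (1 / 6); [|by have := @C2_lt_half t; rewrite t2 t1 E ltxx => /(_ isT)|by right].
move=> t2; have [t3|t3|->] := ltgtP t (- (1 / 6)); [lra| |by left].
by have := @C2_gt_half t; rewrite t3 t2 E ltxx => /(_ isT).
Qed.

Lemma pi_le4 : pi <= 4 :> R.
Proof. by have := pihalf_lt2 R; lra. Qed.

End CircleFunctions.

Section PeriodicFunctions.
Context {R : realType}.
Local Notation P := (R * R)%type.
Local Notation der f x d := (is_derive x (1 : R) (f : R -> R) (d : R)).

Definition Z2_periodic (T : Type) (f : P -> T) := forall z k, f (z + intv R k) = f z.

Lemma periodic_bounded (f : P -> R) : continuous f -> Z2_periodic f ->
  exists2 M, 0 <= M & forall z, `|f z| <= M.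
Proof.
move=> fc fP; pose A := `[0, 1]%classic `*` `[0, 1]%classic : set P.
have cA : compact A by apply: compact_setX; exact: segment_compact.
have [||c cA' cM] := @compact_EVT_max P R (fun z => `|f z|) A _ cA.
- by exists (0, 0); split => /=; rewrite in_itv /= lexx ler01.
- apply: continuous_subspaceT => z; apply: continuous_comp; first exact: fc.
  exact: norm_continuous.
exists `|f c| => // z.
have -> : f z = f (z - intv R (Num.floor z.1, Num.floor z.2)).
  by rewrite -[in LHS](subrK (intv R (Num.floor z.1, Num.floor z.2)) z) fP.
apply: cM; rewrite inE; split => /=; rewrite in_itv /=.
  by have /andP[a b] := floor_itv z.1; rewrite intrD in b; apply/andP; split; lra.
by have /andP[a b] := floor_itv z.2; rewrite intrD in b; apply/andP; split; lra.
Qed.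

Lemma derive_periodic (f : P -> R) v : Z2_periodic f -> Z2_periodic (fun z => 'D_v f z).
Proof.
move=> fP z k; rewrite /derive.
have -> : (fun h : R => h^-1 *: ((f \o shift (z + intv R k)) (h *: v) - f (z + intv R k))) =
  (fun h : R => h^-1 *: ((f \o shift z) (h *: v) - f z)) by apply/funext => h /=; rewrite addrA !fP.
by [].
Qed.

Lemma der_axis1 (f : P -> R) (x y d : R) :
  is_derive ((x, y) : P) (edir R false) f d -> der (fun t => f (t, y)) x d.
Proof.
move=> /is_derive_lineE H.
have H' : der (fun h : R => f (h *: edir R false + ((x, y) : P))) (x + - x) d by rewrite subrr.
have := der_comp (derD (der_id x) (der_cst (- x) x)) H'.
rewrite addr0 mulr1; congr (is_derive _ _ _ _); apply/funext => t.
congr f; apply: injective_projections => /=; last by rewrite scaler0 add0r.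
by rewrite [_%:A]mulr1 subrK.
Qed.

Lemma der_axis2 (f : P -> R) (x y d : R) :
  is_derive ((x, y) : P) (edir R true) f d -> der (fun t => f (x, t)) y d.
Proof.
move=> /is_derive_lineE H.
have H' : der (fun h : R => f (h *: edir R true + ((x, y) : P))) (y + - y) d by rewrite subrr.
have := der_comp (derD (der_id y) (der_cst (- y) y)) H'.
rewrite addr0 mulr1; congr (is_derive _ _ _ _); apply/funext => t.
congr f; apply: injective_projections => /=; first by rewrite scaler0 add0r.
by rewrite [_%:A]mulr1 subrK.
Qed.

Lemma der_lipschitz (f df : R -> R) M : (forall t : R, der f t (df t)) ->
  (forall t, `|df t| <= M) -> forall a b, `|f a - f b| <= M * `|a - b|.
Proof.
move=> fD fM a b; wlog ab : a b / b <= a => [W|].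
  by case: (leP b a) => [|/ltW] ab; [exact: W|rewrite distrC [`|a - b|]distrC; exact: W].
by have [c _ ->] := der_MVT ab (fun t _ => fD t); rewrite normrM ler_wpM2r.
Qed.

(** The partial derivatives are periodic and continuous, hence bounded; integrate along a path
    parallel to the axes. *)
Lemma periodic_lipschitz (f : P -> R) : locally_smc f -> Z2_periodic f ->
  exists2 M, 0 <= M & forall z w : P, `|f z - f w| <= M * (`|z.1 - w.1| + `|z.2 - w.2|).
Proof.
move=> fS fP.
have B b := periodic_bounded (locally_smc_cont (locally_smc_derive b fS))
  (derive_periodic (edir R b) fP).
have [M1 M10 H1] := B false; have [M2 M20 H2] := B true.
have D b z : is_derive z (edir R b) f ('D_(edir R b) f z).
  by apply: derivableP; exact: locally_smc_derivable.
exists (M1 + M2); first exact: addr_ge0.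
move=> [x y] [x' y'] /=.
have -> : f (x, y) - f (x', y') = (f (x, y) - f (x', y)) + (f (x', y) - f (x', y')) by ring.
apply: (le_trans (ler_normD _ _)).
have A1 := der_lipschitz (fun t : R => der_axis1 (D false (t, y))) (fun t => H1 (t, y)) x x'.
have A2 := der_lipschitz (fun t : R => der_axis2 (D true (x', t))) (fun t => H2 (x', t)) y y'.
have p1 : 0 <= M1 * `|y - y'| by rewrite mulr_ge0.
have p2 : 0 <= M2 * `|x - x'| by rewrite mulr_ge0.
by rewrite /= in A1 A2; lra.
Qed.

End PeriodicFunctions.

Section Model.
Context {R : realType}.
Local Notation P := (R * R)%type.
Variable rho : R.

(** The oscillation of [bb] creates the singularities: its derivative is what lets [u2] vanish. The
    constant 4 gives [bb >= 3], which dominates [rho <= 1] in the sign of [u1] and raises [hs] above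
    the values of [HH] on the bottom and top sides of the box. *)
Definition bb (x : R) : R := 4 + S2 x.
(* With s = sin(pi y) and c = cos(pi y), these read u1 = 2c(s b + rho c),
   u2 = 1 - 2 s^2 cos(2 pi x) and HH = - pi x + s^2 b + rho(pi y + s c), so that
   HH_x = - pi u2 and HH_y = pi u1; [hs] is the value of HH at the saddle. *)
Definition u1 (z : P) : R := S2 z.2 * bb z.1 + rho * (1 + C2 z.2).
Definition u2 (z : P) : R := 1 - (1 - C2 z.2) * C2 z.1.
Definition HH (z : P) : R :=
  - (pi * z.1) + (1 - C2 z.2) / 2 * bb z.1 + rho * (pi * z.2 + S2 z.2 / 2).
Definition hs : R := HH (- (1 / 6), 1 / 2).
(** [HH > hs] alone describes an unbounded region, since [HH] tends to infinity as [x] decreases;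
    the other four factors confine the bump to one box. *)
Definition ebump (z : P) : R := chi (HH z - hs) *
  (chi (z.1 + 1 / 6) * chi (5 / 6 - z.1) * (chi (z.2 - 1 / 6) * chi (5 / 6 - z.2))).
(** The shift by 1/6 matches the box of [ebump], which spans -1/6 to 5/6 horizontally. Each
    translated box lies in one cell, so [EE] is the periodic extension of [ebump]. *)
Definition cell (z : P) : int * int := (Num.floor (z.1 + 1 / 6), Num.floor z.2).
Definition EE (z : P) : R := ebump (z - intv R (cell z)).
(** As [(- u2, u1)] is [1 / pi] times the gradient of [HH], the added term makes [HH] grow at the
    rate [pi * EE * (u1 ^+ 2 + u2 ^+ 2)]. *)
Definition vf (z : P) : P := (u1 z - EE z * u2 z, u2 z + EE z * u1 z).

Lemma intvN k : intv R (- k.1, - k.2) = - intv R k.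
Proof. by rewrite /intv /= !mulrNz. Qed.

Lemma bb_ge x : 3 <= bb x. Proof. by rewrite /bb; have := S2_ge x; lra. Qed.
Lemma bb_le x : bb x <= 5. Proof. by rewrite /bb; have := S2_le x; lra. Qed.

Lemma u1_int : Z2_periodic u1.
Proof. by move=> z k; rewrite /u1 /bb /= !S2int C2int. Qed.

Lemma u2_int : Z2_periodic u2.
Proof. by move=> z k; rewrite /u2 /= !C2int. Qed.

Lemma HH_int z k : HH (z + intv R k) = HH z - pi * k.1%:~R + rho * pi * k.2%:~R.
Proof. by rewrite /HH /bb /= !S2int C2int; ring. Qed.

Lemma cell_int z k : cell (z + intv R k) = ((cell z).1 + k.1, (cell z).2 + k.2).
Proof.
rewrite /cell /=; congr pair; last by rewrite floorDrz ?intr_int// intrKfloor.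
by rewrite addrAC floorDrz ?intr_int// intrKfloor.
Qed.

Lemma EE_int : Z2_periodic EE.
Proof.
move=> z k; rewrite /EE cell_int; congr ebump.
apply: injective_projections => /=; rewrite intrD; ring.
Qed.

Lemma vf_int : Z2_periodic vf.
Proof. by move=> z k; rewrite /vf u1_int u2_int EE_int. Qed.

Definition inbox (z : P) := [/\ - (1 / 6) < z.1, z.1 < 5 / 6, 1 / 6 < z.2 & z.2 < 5 / 6].

Lemma ebump_ge0 z : 0 <= ebump z.
Proof. by rewrite !mulr_ge0 ?chi_ge0. Qed.

Lemma EE_ge0 z : 0 <= EE z. Proof. exact: ebump_ge0. Qed.

Lemma chi_neq0 s : (chi s != 0 :> R) = (0 < s).
Proof. by rewrite -chi_gt0 lt_neqAle eq_sym chi_ge0 andbT. Qed.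

Lemma ebump_gt0 z : 0 < ebump z <-> inbox z /\ hs < HH z.
Proof.
split=> [e0|[[a b c d] h]]; last first.
  by rewrite !mulr_gt0 ?chi_gt0 ?subr_gt0//; lra.
have : ebump z != 0 by rewrite gt_eqF.
rewrite /ebump !mulf_eq0 !negb_or !chi_neq0 !subr_gt0.
move=> /andP[h /andP[/andP[a b] /andP[c d]]]; split=> //; split=> //; lra.
Qed.

Lemma ebump_eq0 z : ~ (inbox z /\ hs < HH z) -> ebump z = 0.
Proof.
move=> H; apply/eqP; rewrite eq_le ebump_ge0 andbT leNgt; apply/negP => /ebump_gt0.
exact: H.
Qed.

Lemma ebump_le z : ebump z <= chi (HH z - hs).
Proof.
rewrite /ebump -[leRHS]mulr1 ler_wpM2l ?chi_ge0// !mulr_ile1 ?mulr_ge0 ?chi_ge0 ?chi_le1//.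
Qed.

Lemma EE_cell z : - (1 / 6) <= z.1 < 5 / 6 -> 0 <= z.2 < 1 -> EE z = ebump z.
Proof.
move=> /andP[a b] /andP[c d]; rewrite /EE /cell.
have -> : Num.floor (z.1 + 1 / 6) = 0 by apply: floor_def; rewrite add0r; apply/andP; split; lra.
have -> : Num.floor z.2 = 0 by apply: floor_def; rewrite add0r; apply/andP; split; lra.
by congr ebump; rewrite (_ : intv R (0, 0) = 0) ?subr0.
Qed.

Lemma cell_box z : let w := z - intv R (cell z) in
  - (1 / 6) <= w.1 < 5 / 6 /\ 0 <= w.2 < 1.
Proof.
rewrite /cell /=.
have /andP[a b] := floor_itv (z.1 + 1 / 6); have /andP[c d] := floor_itv z.2.
by rewrite intrD in b; rewrite intrD in d; split; apply/andP; split; lra.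
Qed.

Lemma smc_shift (f : P -> R) (a b : R) : smc f -> smc (fun z => f (z.1 + a, z.2 + b)).
Proof.
elim=> [c|||g h _ gS _ hS|g h _ gS _ hS|g h gD _ hS].
- exact: smc_cst.
- by apply: smc_add; [exact: smc_fst|exact: smc_cst].
- by apply: smc_add; [exact: smc_snd|exact: smc_cst].
- exact: smc_add.
- exact: smc_mul.
- exact: (@smc_comp _ g (fun z => h (z.1 + a, z.2 + b))).
Qed.

Lemma smc_bb (f : P -> R) : smc f -> smc (fun z => bb (f z)).
Proof. by move=> fS; apply: smc_add; [exact: smc_cst|exact: smc_S2]. Qed.

Lemma smc_u1 : smc u1.
Proof.
apply: smc_add; apply: smc_mul.
- by apply: smc_S2; exact: smc_snd.
- by apply: smc_bb; exact: smc_fst.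
- exact: smc_cst.
- by apply: smc_add; [exact: smc_cst|apply: smc_C2; exact: smc_snd].
Qed.

Lemma smc_u2 : smc u2.
Proof.
apply: smc_sub; first exact: smc_cst.
apply: smc_mul; last by apply: smc_C2; exact: smc_fst.
by apply: smc_sub; [exact: smc_cst|apply: smc_C2; exact: smc_snd].
Qed.

Lemma smc_HH : smc HH.
Proof.
apply: smc_add; first apply: smc_add.
- by apply: smc_opp; apply: smc_mul; [exact: smc_cst|exact: smc_fst].
- apply: smc_mul; last by apply: smc_bb; exact: smc_fst.
  apply: smc_mul; last exact: smc_cst.
  by apply: smc_sub; [exact: smc_cst|apply: smc_C2; exact: smc_snd].
- apply: smc_mul; first exact: smc_cst.
  apply: smc_add; first by apply: smc_mul; [exact: smc_cst|exact: smc_snd].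
  by apply: smc_mul; [apply: smc_S2; exact: smc_snd|exact: smc_cst].
Qed.

Lemma smc_ebump : smc ebump.
Proof.
apply: smc_mul; first by apply: smc_chi; apply: smc_sub; [exact: smc_HH|exact: smc_cst].
apply: smc_mul; apply: smc_mul; apply: smc_chi.
- by apply: smc_add; [exact: smc_fst|exact: smc_cst].
- by apply: smc_sub; [exact: smc_cst|exact: smc_fst].
- by apply: smc_sub; [exact: smc_snd|exact: smc_cst].
- by apply: smc_sub; [exact: smc_cst|exact: smc_snd].
Qed.

Lemma locally_smc_EE : locally_smc EE.
Proof.
move=> z0; pose k := (cell z0).1; pose m := (cell z0).2.
pose s (i j : int) (z : P) := ebump (z.1 + (i - k)%:~R, z.2 + (j - m)%:~R).
(* Near [z0] each cell index is that of [z0] or one less, which leaves four candidates for [EE]. At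
   each point the three wrong ones vanish, because the point is outside their boxes. *)
exists (fun z => s 0 0 z + s 1 0 z + (s 0 1 z + s 1 1 z)).
  by do 2?apply: smc_add; apply: smc_shift; exact: smc_ebump.
have k0 : k%:~R <= z0.1 + 1 / 6 < k%:~R + 1 by have := floor_itv (z0.1 + 1 / 6); rewrite intrD.
have m0 : m%:~R <= z0.2 < m%:~R + 1 by have := floor_itv z0.2; rewrite intrD.
have z1c : (fun z : P => z.1) @ z0 --> z0.1 by exact: cvg_fst.
have z2c : (fun z : P => z.2) @ z0 --> z0.2 by exact: cvg_snd.
near=> z.
have /andP[a1 a2] : (k - 1)%:~R - 1 / 6 < z.1 < (k + 1)%:~R - 1 / 6.
  apply/andP; split; near: z.
    by apply: (cvgr_gt z0.1 z1c); rewrite intrB; move: k0 => /andP[]; lra.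
  by apply: (cvgr_lt z0.1 z1c); rewrite intrD; move: k0 => /andP[]; lra.
have /andP[b1 b2] : (m - 1)%:~R < z.2 < (m + 1)%:~R.
  apply/andP; split; near: z.
    by apply: (cvgr_gt z0.2 z2c); rewrite intrB; move: m0 => /andP[]; lra.
  by apply: (cvgr_lt z0.2 z2c); rewrite intrD; move: m0 => /andP[]; lra.
rewrite intrB in a1; rewrite intrD in a2; rewrite intrB in b1; rewrite intrD in b2.
have bR (b : bool) : (b%:R : int)%:~R = b%:R :> R by case: b.
have i1 (a : int) : (a + 1)%:~R = a%:~R + 1 :> R by rewrite intrD.
have ck : Num.floor (z.1 + 1 / 6) = k - ((z.1 + 1 / 6 < k%:~R)%R : bool)%:R.
  apply: floor_def; rewrite i1 !intrB bR.
  by case: ltP => c; apply/andP; split => /=; clear -c a1 a2; lra.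
have cm : Num.floor z.2 = m - ((z.2 < m%:~R)%R : bool)%:R.
  apply: floor_def; rewrite i1 !intrB bR.
  by case: ltP => c; apply/andP; split => /=; clear -c b1 b2; lra.
rewrite /EE /cell ck cm.
have E (i j : int) : ebump (z - intv R (k - i, m - j)) = s i j z.
  by rewrite /s; congr ebump; apply: injective_projections => /=; rewrite !intrB; ring.
rewrite E.
have Z (i j : int) : ~ inbox (z.1 + (i - k)%:~R, z.2 + (j - m)%:~R) -> s i j z = 0.
  by move=> H; apply: ebump_eq0 => -[].
have Zi (j : int) : s (1 - ((z.1 + 1 / 6 < k%:~R)%R : bool)%:R) j z = 0.
  by apply: Z => -[/= p q _ _]; move: p q; rewrite !intrB bR; case: (ltP (z.1 + 1 / 6)) => c p q;
    move: p q c => /=; clear; lra.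
have Zj (i : int) : s i (1 - ((z.2 < m%:~R)%R : bool)%:R) z = 0.
  by apply: Z => -[/= _ _ p q]; move: p q; rewrite !intrB bR; case: (ltP z.2) => c p q;
    move: p q c => /=; clear; lra.
move: Zi Zj; case: ltP => c; case: ltP => d /=; rewrite ?subrr ?subr0 => Zi Zj;
  by rewrite ?Zi ?Zj ?add0r ?addr0.
Unshelve. all: by end_near. Qed.

End Model.

(** * The homoclinic loop is invariant *)

Section RealAnalysis.
Context {R : realType}.

(** Real induction, by the supremum of the times up to which [Q] has held throughout. *)
Lemma continuous_induction (Q : R -> Prop) (a b : R) : a <= b -> Q a ->
  (forall s, a <= s <= b -> Q s -> exists2 e, 0 < e & forall r, `|r - s| < e -> Q r) ->
  (forall s, a < s <= b -> (forall r, a <= r < s -> Q r) -> Q s) ->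
  forall s, a <= s <= b -> Q s.
Proof.
move=> ab Qa Qo Qc.
pose S : set R := [set s | a <= s <= b /\ forall r, a <= r <= s -> Q r].
have Sa : S a by split; [rewrite lexx ab|move=> r r1; have -> : r = a by lra].
have Sb : ubound S b by move=> s [/andP[]].
have hS : has_sup S by split; [exists a|exists b].
set c := sup S.
have ac : a <= c by apply: ub_le_sup => //; exact: hS.2.
have cb : c <= b by apply: ge_sup => //; exact: hS.1.
have Qlt r : a <= r < c -> Q r.
  move=> /andP[ar rc]; have cr : 0 < c - r by rewrite subr_gt0.
  have [s [sab sQ]] := sup_adherent cr hS; rewrite -/c subKr => rs.
  by apply: sQ; rewrite ar ltW.
have Qcc : Q c.
  have [<-//|ac'] := eqVneq a c.
  by apply: Qc => //; rewrite cb andbT lt_neqAle ac' ac.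
have Qle r : a <= r <= c -> Q r.
  move=> /andP[ar]; rewrite le_eqVlt => /orP[/eqP ->//|rc]; by apply: Qlt; rewrite ar.
suff : b <= c by move=> bc s /andP[s1 s2]; apply: Qle; rewrite s1 (le_trans s2).
rewrite leNgt; apply/negP => cb'.
have [|e e0 eQ] := Qo c _ Qcc; first by rewrite ac.
pose d := Order.min (c + e / 2) b.
have cd : c < d by rewrite lt_min cb' andbT ltrDl divr_gt0.
have : d <= c.
  apply: ub_le_sup; first exact: hS.2.
  split; first by rewrite (le_trans ac (ltW cd)) ge_min lexx orbT.
  move=> r /andP[ar rd]; have [rc|rc] := leP r c; first by apply: Qle; rewrite ar.
  apply: eQ; rewrite ger0_norm ?subr_ge0 ?ltW//.
  have : d <= c + e / 2 by rewrite ge_min lexx.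
  by lra.
by rewrite leNgt cd.
Qed.

Lemma cont_left_le (f : R -> R) (a s c : R) : {for s, continuous f} -> a < s ->
  (forall r, a <= r < s -> f r <= c) -> f s <= c.
Proof.
move=> fc as_ H; rewrite leNgt; apply/negP => cf.
have := cont_near fc (divr_gt0 (_ : 0 < f s - c) (ltr0n R 2)).
rewrite subr_gt0 => /(_ cf) [e /= e0 eH].
pose r := Order.max a (s - e / 2).
have rs : r < s by rewrite gt_max as_ /= ltrBlDr ltrDl divr_gt0.
have ra : a <= r by rewrite le_max lexx.
have re : s - e / 2 <= r by rewrite le_max lexx orbT.
have : `|f s - f r| <= (f s - c) / 2.
  by apply: eH => /=; rewrite ger0_norm ?subr_ge0 ?ltW//; lra.
have := H r; rewrite ra rs => /(_ isT) h; rewrite ler_norml => /andP[]; lra.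
Qed.

End RealAnalysis.

Section ModelFlow.
Context {R : realType}.
Local Notation P := (R * R)%type.
Local Notation der f x d := (is_derive x (1 : R) (f : R -> R) (d : R)).
Variable rho : R.
Hypothesis rho_ge0 : 0 <= rho.
Hypothesis rho_le1 : rho <= 1.
Local Notation u1 := (u1 rho).
Local Notation HH := (HH rho).
Local Notation hs := (hs rho).
Local Notation ebump := (ebump rho).
Local Notation EE := (EE rho).
Local Notation vf := (vf rho).

Lemma locally_smc_vf i : locally_smc (fun z => Defs.comp i (vf z)).
Proof.
have E := @locally_smc_EE R rho.
have s1 := smc_locally (smc_u1 rho); have s2 := smc_locally (@smc_u2 R).
case: i => /=.
  by apply: locally_smc_add => //; exact: locally_smc_mul.
apply: (@locally_smc_add _ _ (fun z => - (EE z * u2 z))) => //.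
have -> : (fun z => - (EE z * u2 z)) = (fun z => (-1) * (EE z * u2 z)).
  by apply/funext => z; rewrite mulN1r.
apply: locally_smc_mul; first by apply: smc_locally; exact: smc_cst.
exact: locally_smc_mul.
Qed.

Lemma vf_smooth : smooth_torus_field vf.
Proof.
split; last exact: vf_int.
by move=> i; apply: locally_smc_smooth; exact: locally_smc_vf.
Qed.

Lemma vf_lip : exists2 L, 0 < L & forall i (z w : P),
  `|Defs.comp i (vf z) - Defs.comp i (vf w)| <= L * (`|z.1 - w.1| + `|z.2 - w.2|).
Proof.
have H i : exists2 M, 0 <= M & forall z w : P,
    `|Defs.comp i (vf z) - Defs.comp i (vf w)| <= M * (`|z.1 - w.1| + `|z.2 - w.2|).
  apply: (periodic_lipschitz (locally_smc_vf i)) => z k; by rewrite vf_int.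
have [M1 M10 H1] := H false; have [M2 M20 H2] := H true.
exists (M1 + M2 + 1); first by lra.
by case=> z w; [apply: (le_trans (H2 z w))|apply: (le_trans (H1 z w))];
  rewrite ler_wpM2r ?addr_ge0//; lra.
Qed.

Lemma der_HH (f g : R -> R) (t a b : R) : der f t a -> der g t b ->
  der (fun t => HH (f t, g t)) t (pi * (u1 (f t, g t) * b - u2 (f t, g t) * a)).
Proof.
move=> fD gD.
have Dx := derN (derM (der_cst pi t) fD).
have Dc := derM (derD (der_cst 1 t) (derN (der_comp gD (der_C2 (g t))))) (der_cst 2^-1 t).
have Db := derD (der_cst 4 t) (der_comp fD (der_S2 (f t))).
have Dy := derM (der_cst rho t) (derD (derM (der_cst pi t) gD)
  (derM (der_comp gD (der_S2 (g t))) (der_cst 2^-1 t))).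
apply: (der_eq (derD (derD Dx (derM Dc Db)) Dy)).
by rewrite /u1 /u2 /bb /=; field.
Qed.

Lemma u1_ge0 x y : 1 / 6 <= y <= 1 / 2 -> 0 <= u1 (x, y).
Proof.
move=> /andP[y1 y2]; rewrite /u1 /= addr_ge0 ?mulr_ge0//.
- by apply: S2_ge0; apply/andP; split; lra.
- by have := bb_ge x; lra.
- by have := C2_ge y; lra.
Qed.

(** Here [S2 y] is non-positive and competes with the [rho] term. From
    [S2 ^+ 2 = (1 - C2) * (1 + C2)] and [C2 <= 1 / 2] comes [(1 + C2) / 3 <= - S2]; then [bb >= 3]
    and [rho <= 1] decide. *)
Lemma u1_le0 x y : 1 / 2 <= y <= 5 / 6 -> u1 (x, y) <= 0.
Proof.
move=> /andP[y1 y2]; rewrite /u1 /=.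
have s0 : S2 y <= 0 by apply: S2_le0; apply/andP; split; lra.
have c1 : C2 y <= 1 / 2 by apply: C2_le_half; apply/andP; split; lra.
have c2 := C2_ge y; have H := C2S2 y; have b3 := bb_ge x.
have K : (1 + C2 y) / 3 <= - S2 y.
  have sN : 0 <= - S2 y by lra.
  rewrite -ler_sqr ?nnegrE//; last by rewrite divr_ge0//; lra.
  rewrite sqrrN; have -> : S2 y ^+ 2 = (1 - C2 y) * (1 + C2 y) by lra.
  by nra.
have A : rho * (1 + C2 y) <= 1 + C2 y by rewrite ler_piMl//; lra.
have B : S2 y * bb x <= S2 y * 3 by rewrite ler_wnM2l.
by lra.
Qed.

Lemma HH_le_mid x y : 1 / 6 <= y <= 5 / 6 -> HH (x, y) <= HH (x, 1 / 2).
Proof.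
move=> /andP[y1 y2].
have D (s : R) := der_HH (der_cst x s) (der_id s).
have [yl|yl] := leP y (1 / 2).
  apply: (der_ge0_le yl (fun s _ => D s)) => s /andP[s1 s2].
  by rewrite mulr1 mulr0 subr0 mulr_ge0 ?pi_ge0// u1_ge0//; apply/andP; split; lra.
apply: (der_le0_ge (ltW yl) (fun s _ => D s)) => s /andP[s1 s2].
by rewrite mulr1 mulr0 subr0 mulr_ge0_le0 ?pi_ge0// u1_le0//; apply/andP; split; lra.
Qed.

Lemma hsE : hs = pi / 6 + (4 - S2 (1 / 6)) + rho * pi / 2.
Proof. by rewrite /hs /HH /bb /= C2_half S2_half S2N; field. Qed.

(** [HH <= hs] on all four sides: on the left one because [HH] peaks there at the saddle, on the
    right one because it is the left one translated, with [HH] lower by [pi], on the bottom and top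
    by plain estimates. So [D0] can be left only through [HH = hs]. *)
Lemma closed_box z : - (1 / 6) <= z.1 <= 5 / 6 -> 1 / 6 <= z.2 <= 5 / 6 ->
  hs < HH z -> inbox z.
Proof.
case: z => x y /= /andP[x1 x2] /andP[y1 y2] h.
have p0 := pi_gt0 R; have p4 := pi_le4 (R := R).
have rp0 : 0 <= rho * pi by rewrite mulr_ge0// ltW.
have rp4 : rho * pi <= 4.
  by rewrite (le_trans _ p4)// ler_piMl// ltW.
have s0 := S2_sixth_gt0 (R := R); have s1 := S2_le (1 / 6 : R).
have rs0 : 0 <= rho * S2 (1 / 6) by rewrite mulr_ge0// ltW.
have rs1 : rho * S2 (1 / 6) <= 1 by rewrite mulr_ile1// ltW.
have px : - (pi * x) <= pi / 6.
  have : 0 <= pi * (x + 1 / 6) by apply: mulr_ge0; lra.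
  by lra.
have bx := bb_le x.
have yI : 1 / 6 <= y <= 5 / 6 by rewrite y1.
split=> /=; rewrite lt_neqAle.
- rewrite x1 andbT; apply/eqP => E; move: h; rewrite -E.
  by rewrite ltNge (HH_le_mid _ yI).
- rewrite x2 andbT; apply/eqP => E; move: h.
  have -> : (x, y) = (- (1 / 6), y) + intv R (1, 0).
    by apply: injective_projections => /=; rewrite ?mulr1z ?addr0// E; lra.
  rewrite HH_int /= mulr1 mulr0 addr0 ltNge => /negP; apply.
  by have := HH_le_mid (- (1 / 6)) yI; rewrite -/hs; lra.
- rewrite y1 andbT; apply/eqP => E; move: h; rewrite -E ltNge => /negP; apply.
  by rewrite hsE /HH /= C2_sixth; lra.
- rewrite y2 andbT; apply/eqP => E; move: h; rewrite E ltNge => /negP; apply.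
  rewrite hsE /HH /= C2_fiveSixth.
  have -> : S2 (5 / 6) = - S2 (1 / 6) :> R.
    by rewrite -S2flip; congr S2; field.
  by lra.
Qed.

(** The inside of the homoclinic loop in the base cell, which is exactly where [ebump] is
    positive. *)
Definition D0 (z : P) := inbox z /\ hs < HH z.

Lemma D0_open z : D0 z -> \forall w \near z, D0 w.
Proof.
move=> [[a b c d] h].
have z1c : (fun z : P => z.1) @ z --> z.1 by exact: cvg_fst.
have z2c : (fun z : P => z.2) @ z --> z.2 by exact: cvg_snd.
have hc : HH @ z --> HH z by exact: smc_cont (smc_HH rho) z.
near=> w; split; [split|]; near: w.
- exact: cvgr_gt z1c _ a.
- exact: cvgr_lt z1c _ b.
- exact: cvgr_gt z2c _ c.
- exact: cvgr_lt z2c _ d.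
- exact: cvgr_gt hc _ h.
Unshelve. all: by end_near. Qed.

Lemma D0_EE z : D0 z -> EE z = ebump z.
Proof.
by move=> [[a b c d] _]; apply: EE_cell; apply/andP; split; lra.
Qed.

Lemma D0_EE_gt0 z : D0 z -> 0 < EE z.
Proof. by move=> zD; rewrite D0_EE//; apply/ebump_gt0. Qed.

Lemma EE_gt0_D0 z : 0 < EE z -> D0 (z - intv R (cell z)).
Proof. by move=> /ebump_gt0. Qed.

Variable L : R.
Hypothesis L_gt0 : 0 < L.
Hypothesis vL : forall i (z w : P),
  `|Defs.comp i (vf z) - Defs.comp i (vf w)| <= L * (`|z.1 - w.1| + `|z.2 - w.2|).
Local Notation phi := (lflow vf L).

Lemma phi0 z : phi 0 z = z. Proof. exact: lflow0. Qed.
Lemma phiD s t z : phi (s + t) z = phi s (phi t z). Proof. exact: lflowD. Qed.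
Lemma phi_int t z k : phi t (z + intv R k) = phi t z + intv R k.
Proof. by apply: lflow_translate => // w l; exact: vf_int. Qed.
Lemma phiNK t z : phi (- t) (phi t z) = z.
Proof. by rewrite -phiD addNr phi0. Qed.
Lemma phi_der1 z (t : R) : der (fun t => (phi t z).1) t (vf (phi t z)).1.
Proof. exact: lflow_der1. Qed.
Lemma phi_der2 z (t : R) : der (fun t => (phi t z).2) t (vf (phi t z)).2.
Proof. exact: lflow_der2. Qed.

Lemma phi_derH z (t : R) :
  der (fun t => HH (phi t z)) t (pi * EE (phi t z) * (u1 (phi t z) ^+ 2 + u2 (phi t z) ^+ 2)).
Proof.
have D := der_HH (phi_der1 z t) (phi_der2 z t).
have E : (fun t => HH ((phi t z).1, (phi t z).2)) = (fun t => HH (phi t z)).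
  by apply/funext => s; rewrite -surjective_pairing.
rewrite E -surjective_pairing in D; apply: (der_eq D).
by rewrite /vf /=; ring.
Qed.

Lemma phi_H_ge z s t : s <= t -> HH (phi s z) <= HH (phi t z).
Proof.
move=> st; apply: (der_ge0_le st (fun r _ => phi_derH z r)) => r _.
apply: mulr_ge0; last by apply: addr_ge0; exact: sqr_ge0.
by apply: mulr_ge0; [exact: pi_ge0|exact: EE_ge0].
Qed.

Lemma phi_tcont z : continuous (fun t => phi t z).
Proof.
move=> t; rewrite /continuous_at [X in _ --> X]surjective_pairing.
have -> : (fun t => phi t z) = fun t => ((phi t z).1, (phi t z).2).
  by apply/funext => w; exact: surjective_pairing.
by apply: cvg_to_pair; [exact: der_cont (phi_der1 z t)|exact: der_cont (phi_der2 z t)].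
Qed.

Lemma D0_open_time z s : D0 (phi s z) ->
  exists2 e, 0 < e & forall r, `|r - s| < e -> D0 (phi r z).
Proof.
move=> H; have := phi_tcont (D0_open H) => -[e /= e0 eH].
by exists e => // r rs; apply: eH => /=; rewrite distrC.
Qed.

(** This is [7 ^+ 2 + 3 ^+ 2], from [|u1| <= 7] and [|u2| <= 3]. With [pi <= 4] it gives the
    exponent [232 = 4 * 58] of the backward estimate. *)
Lemma usq_le z : u1 z ^+ 2 + u2 z ^+ 2 <= 58.
Proof.
have a1 := S2_ge z.2; have a2 := S2_le z.2; have b1 := bb_ge z.1; have b2 := bb_le z.1.
have c1 := C2_ge z.2; have c2 := C2_le z.2; have d1 := C2_ge z.1; have d2 := C2_le z.1.
have B (a b p q : R) : `|a| <= p -> `|b| <= q -> `|a * b| <= p * q.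
  by move=> ap bq; rewrite normrM ler_pM.
have t1 : `|S2 z.2 * bb z.1| <= 1 * 5 by apply: B; rewrite ler_norml; apply/andP; split; lra.
have t2 : `|rho * (1 + C2 z.2)| <= 1 * 2.
  by apply: B; rewrite ler_norml; apply/andP; split; have := rho_ge0; have := rho_le1; lra.
have t3 : `|(1 - C2 z.2) * C2 z.1| <= 2 * 1 by apply: B; rewrite ler_norml; apply/andP; split; lra.
have A1 : `|u1 z| <= 7 by rewrite /u1 (le_trans (ler_normD _ _))//; lra.
have B1 : `|u2 z| <= 3 by rewrite /u2 (le_trans (ler_normB _ _))// normr1; lra.
have <- : `|u1 z| ^+ 2 = u1 z ^+ 2 by rewrite real_normK ?num_real.
have <- : `|u2 z| ^+ 2 = u2 z ^+ 2 by rewrite real_normK ?num_real.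
have A0 := normr_ge0 (u1 z); have B0 := normr_ge0 (u2 z).
nra.
Qed.

(** The time change [g] lets one statement serve both directions of time: it will be the identity or
    the negation. *)
Lemma D0_closed_box_limit z (a s : R) (g : R -> R) : continuous g -> a < s ->
  (forall r, a <= r < s -> D0 (phi (g r) z)) ->
  - (1 / 6) <= (phi (g s) z).1 <= 5 / 6 /\ 1 / 6 <= (phi (g s) z).2 <= 5 / 6.
Proof.
move=> gc as_ H.
have c1 : {for s, continuous (fun t => (phi (g t) z).1)}.
  by apply: (@continuous_comp _ _ _ g (fun t => (phi t z).1) s (gc s)); exact: der_cont (phi_der1 z (g s)).
have c2 : {for s, continuous (fun t => (phi (g t) z).2)}.
  by apply: (@continuous_comp _ _ _ g (fun t => (phi t z).2) s (gc s)); exact: der_cont (phi_der2 z (g s)).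
have c1N : {for s, continuous (fun t => - (phi (g t) z).1)} by exact: continuousN.
have c2N : {for s, continuous (fun t => - (phi (g t) z).2)} by exact: continuousN.
split; apply/andP; split.
- rewrite -lerN2; apply: (cont_left_le c1N as_) => r /H[[? ? ? ?] _]; lra.
- by apply: (cont_left_le c1 as_) => r /H[[? ? ? ?] _]; lra.
- rewrite -lerN2; apply: (cont_left_le c2N as_) => r /H[[? ? ? ?] _]; lra.
- by apply: (cont_left_le c2 as_) => r /H[[? ? ? ?] _]; lra.
Qed.

(** [HH] does not decrease, so it stays above [hs]; a limit of points of the box is in the closed
    box, and [closed_box] puts it back inside. *)
Lemma D0_forward z t : 0 <= t -> D0 z -> D0 (phi t z).
Proof.
move=> t0 zD; suff H : forall s, 0 <= s <= t -> D0 (phi s z) by apply: H; rewrite t0 lexx.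
apply: continuous_induction => //; first by rewrite phi0.
  by move=> s _; exact: D0_open_time.
move=> s /andP[s0 st] H.
have hlt : hs < HH (phi s z).
  by apply: (lt_le_trans zD.2); rewrite -[in leLHS](phi0 z); exact: phi_H_ge (ltW s0).
have [b1 b2] := @D0_closed_box_limit z 0 s id (fun x => cvg_id) s0 H.
by split=> //; exact: closed_box.
Qed.

(* Backwards in time HH decreases, but EE <= HH - hs inside the loop, so by Gronwall
   HH - hs does not vanish in finite time. *)
Lemma D0_backward z t : 0 <= t -> D0 z -> D0 (phi (- t) z).
Proof.
move=> t0 zD; suff H : forall s, 0 <= s <= t -> D0 (phi (- s) z) by apply: H; rewrite t0 lexx.
apply: (@continuous_induction _ (fun s => D0 (phi (- s) z))) => //; first by rewrite oppr0 phi0.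
  move=> s _ /D0_open_time[e e0 eH]; exists e => // r rs; apply: eH.
  by rewrite (_ : - r - - s = - (r - s)) ?normrN//; ring.
move=> s /andP[s0 st] H.
have oc : continuous (fun x : R => - x) by exact: opp_continuous.
have [b1 b2] := @D0_closed_box_limit z 0 s (fun x => - x) oc s0 H.
pose K r := HH (phi (- r) z) - hs.
have KD (r : R) := derD (der_comp (derN (der_id r)) (phi_derH z (- r))) (der_cst (- hs) r).
have hD (r : R) := derM (KD r) (der_expM 232 r).
pose k := K 0 * expR (- (232 * s)).
have k0 : 0 < k by rewrite mulr_gt0 ?expR_gt0// /K oppr0 phi0 subr_gt0; exact: zD.2.
have Kge r : 0 <= r < s -> k <= K r.
  move=> /andP[r0 rs].
  have : K 0 * expR (232 * 0) <= K r * expR (232 * r).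
    apply: (der_ge0_le r0 (fun q _ => hD q)) => q /andP[q0 qr].
    have qD : D0 (phi (- q) z) by apply: H; rewrite q0 (le_lt_trans qr).
    rewrite addr0 mulrN1.
    set w := phi (- q) z in qD *; set x := expR _.
    have -> : - (pi * EE w * (u1 w ^+ 2 + u2 w ^+ 2)) * x + (HH w - hs) * (232 * x) =
      ((HH w - hs) * 232 - pi * EE w * (u1 w ^+ 2 + u2 w ^+ 2)) * x by ring.
    apply: mulr_ge0; last exact: expR_ge0.
    have hw : 0 <= HH w - hs by rewrite subr_ge0 ltW// qD.2.
    have Ew : EE w <= HH w - hs.
      by rewrite D0_EE// (le_trans (ebump_le _ _))// chi_le_id.
    have E0 := EE_ge0 rho w; have U := usq_le w.
    have U0 : 0 <= u1 w ^+ 2 + u2 w ^+ 2 by apply: addr_ge0; exact: sqr_ge0.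
    rewrite subr_ge0 (_ : 232 = 4 * 58); last by ring.
    rewrite mulrA [_ * 4]mulrC; apply: ler_pM => //.
      by rewrite mulr_ge0 ?pi_ge0.
    by rewrite ler_pM ?pi_ge0 ?pi_le4.
  rewrite mulr0 expR0 mulr1 => A.
  rewrite /k expRN ler_pdivrMr ?expR_gt0//; apply: (le_trans A).
  have Kr : 0 <= K r by rewrite /K subr_ge0 ltW//; have [] := H r _; rewrite ?r0.
  by rewrite ler_wpM2l// ler_expR ler_wpM2l// ltW.
have Hge : k <= K s.
  have cK : {for s, continuous (fun r => - K r)}.
    by apply: (@der_cont _ (fun r => - K r)); exact: derN (KD s).
  rewrite -lerN2; apply: (cont_left_le cK s0) => r rI.
  by rewrite lerN2; exact: Kge.
have hlt : hs < HH (phi (- s) z) by rewrite -subr_gt0; exact: lt_le_trans Hge.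
by split=> //; exact: closed_box.
Qed.

Lemma D0_inv z t : D0 z -> D0 (phi t z).
Proof.
move=> zD; have [t0|t0] := leP 0 t; first exact: D0_forward.
by rewrite -[t]opprK; apply: D0_backward => //; rewrite oppr_ge0 ltW.
Qed.

Lemma EE_gt0_phi z t : 0 < EE (phi t z) -> 0 < EE z.
Proof.
move=> /EE_gt0_D0; rewrite -intvN -phi_int => /(D0_inv (- t)).
by rewrite phiNK => /D0_EE_gt0; rewrite EE_int.
Qed.

Lemma EE_eq0_phi z t : EE z = 0 -> EE (phi t z) = 0.
Proof.
move=> z0; apply/eqP; rewrite eq_le EE_ge0 andbT leNgt; apply/negP => /EE_gt0_phi.
by rewrite z0 ltxx.
Qed.

Lemma EE_eq0_H z t : EE z = 0 -> HH (phi t z) = HH z.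
Proof.
move=> z0; rewrite -[in RHS](phi0 z).
by apply: (@is_derive_0_is_cst _ (fun t => HH (phi t z))) => s;
  apply: (der_eq (phi_derH z s)); rewrite EE_eq0_phi// mulr0 mul0r.
Qed.

Lemma vf_EE0 z : EE z = 0 -> vf z = (u1 z, u2 z).
Proof. by move=> z0; rewrite /vf z0 !mul0r subr0 addr0. Qed.

End ModelFlow.

(** * Trapped trajectories *)

Section Barrier.
Context {R : realType}.
Local Notation der f x d := (is_derive x (1 : R) (f : R -> R) (d : R)).

Lemma der_gt0_local (f : R -> R) (s d : R) : der f s d -> 0 < d ->
  exists2 e, 0 < e & forall r, `|r - s| < e -> (s < r -> f s < f r) /\ (r < s -> f r < f s).
Proof.
move=> /is_derive1_caratheodory[g [gE gc gs]] d0.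
have [e /= e0 eH] : \forall t \near s, 0 < g t by apply: (cvgr_gt (g s) gc); rewrite gs.
exists e => // r rs; have gr : 0 < g r by apply: eH => /=; rewrite distrC.
have E := gE r; split => H.
  by rewrite -subr_gt0 E mulr_gt0// subr_gt0.
by rewrite -subr_lt0 E pmulr_rlt0// subr_lt0.
Qed.

(** A level that can be crossed only upwards is not met again. The induction carries the alternative
    [s <= t1] because [f t1 = c] is allowed. *)
Lemma barrier (f df : R -> R) (c t1 t : R) : (forall s : R, der f s (df s)) ->
  (forall s, t1 <= s -> f s = c -> 0 < df s) -> c <= f t1 -> t1 < t -> c < f t.
Proof.
move=> fD cross c1 t1t.
have H : forall s, t1 <= s <= t -> s <= t1 \/ c < f s.
  apply: continuous_induction; first exact: ltW.
  - by left.
  - move=> s /andP[s1 st]; have [ct|cs|cs] := ltgtP c (f s).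
    + move=> _; have := cont_near (der_cont (fD s)) (_ : 0 < (f s - c) / 2).
      rewrite divr_gt0 ?subr_gt0// => /(_ isT)[e /= e0 eH].
      exists e => // r rs; right.
      have : `|f s - f r| <= (f s - c) / 2 by apply: eH => /=; rewrite distrC.
      by rewrite ler_norml => /andP[]; lra.
    + by move=> [ss|//]; have E : s = t1 by [lra]; rewrite E in cs; lra.
    + move=> [ss|//].
      have E : s = t1 by lra.
      have [e e0 eH] := der_gt0_local (fD s) (cross s s1 (esym cs)).
      exists e => // r rs; have [rl|rg] := leP r t1; [by left|right].
      by rewrite cs; apply: (eH r rs).1; rewrite E.
  - move=> s /andP[s1 st] Hr; right.
    have ge : c <= f s.
      rewrite -lerN2; apply: (@cont_left_le _ (fun x => - f x) t1) => //.
        exact: der_cont (derN (fD s)).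
      move=> r rI; rewrite lerN2; have [rl|/ltW//] := Hr r rI.
      by have -> : r = t1 by [move/andP: rI => []; lra].
    rewrite lt_neqAle ge andbT; apply/eqP => E.
    have [e e0 eH] := der_gt0_local (fD s) (cross s (ltW s1) (esym E)).
    pose r := Order.max ((t1 + s) / 2) (s - e / 2).
    have rs : r < s by rewrite gt_max; apply/andP; split; lra.
    have r1 : (t1 + s) / 2 <= r by rewrite le_max lexx.
    have r2 : s - e / 2 <= r by rewrite le_max lexx orbT.
    have re : `|r - s| < e by rewrite ltr0_norm ?subr_lt0//; lra.
    have := (eH r re).2 rs; rewrite -E.
    have rI : t1 <= r < s by apply/andP; split; lra.
    by have [rl|] := Hr r rI; lra.
have tI : t1 <= t <= t by rewrite lexx ltW.
by have [|//] := H t tI; lra.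
Qed.

Lemma escape (f df : R -> R) (T c M : R) : (forall s : R, der f s (df s)) -> 0 < c ->
  (forall s, T <= s -> c <= df s) -> exists2 t, T <= t & M < f t.
Proof.
move=> fD c0 dc.
pose d := (`|M - f T| + 1) / c.
have d0 : 0 <= d by rewrite divr_ge0 ?addr_ge0// ltW.
exists (T + d); first by rewrite lerDl.
have [|s /andP[s1 _] E] := @der_MVT _ f df T (T + d) _ (fun s _ => fD s); first by rewrite lerDl.
have : c * d <= f (T + d) - f T by rewrite E addrAC subrr add0r ler_wpM2r// dc.
have -> : c * d = `|M - f T| + 1 by rewrite /d mulrC divfK// gt_eqF.
by have := ler_norm (M - f T); lra.
Qed.

Lemma monotone_cauchy (f : R -> R) (T M : R) :
  (forall s t, T <= s -> s <= t -> f s <= f t) -> (forall t, T <= t -> f t <= M) ->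
  forall e, 0 < e -> exists2 T', T <= T' & forall s t, T' <= s -> T' <= t -> `|f s - f t| <= e.
Proof.
move=> fm fM e e0.
pose S : set R := [set y | exists2 t, T <= t & y = f t].
have hS : has_sup S.
  split; first by exists (f T), T.
  by exists M => _ [t tT ->]; exact: fM.
have [_ [T' TT' ->] H] := sup_adherent e0 hS.
exists T' => // s t s1 t1.
have ub r : T' <= r -> f r <= sup S.
  by move=> r1; apply: ub_le_sup; [exact: hS.2|exists r => //; exact: le_trans r1].
have lb r : T' <= r -> f T' <= f r by move=> r1; exact: fm.
have := ub _ s1; have := ub _ t1; have := lb _ s1; have := lb _ t1.
by move=> *; rewrite ler_norml; apply/andP; split; lra.
Qed.
End Barrier.

Section Trapped.
Context {R : realType}.
Local Notation P := (R * R)%type.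
Local Notation der f x d := (is_derive x (1 : R) (f : R -> R) (d : R)).
Variable rho : R.
Hypothesis rho_ge0 : 0 <= rho.
Hypothesis rho_le1 : rho <= 1.
Local Notation u1 := (u1 rho).
Local Notation HH := (HH rho).
Local Notation hs := (hs rho).
Local Notation EE := (EE rho).
Local Notation vf := (vf rho).
Local Notation D0 := (D0 rho).

Definition zsink : P := (1 / 6, 1 / 2).
Definition zsaddle : P := (- (1 / 6), 1 / 2).

(** [vf] is the image of [(u1, u2)] under the identity plus [EE] times a rotation, of determinant
    [1 + EE ^+ 2 > 0]; so the bump creates no singularity. *)
Lemma vf_eq0 z : vf z = 0 <-> u1 z = 0 /\ u2 z = 0.
Proof.
split=> [|[a b]]; last by rewrite /vf a b !mulr0 subr0 addr0.
rewrite /vf => -[/eqP a /eqP b]; move: a b; rewrite subr_eq0 addr_eq0 => /eqP a /eqP b.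
have : u1 z * (1 + EE z ^+ 2) = 0.
  by rewrite mulrDr mulr1 {1}a b; ring.
have p : 0 < 1 + EE z ^+ 2 by rewrite ltr_pwDl ?sqr_ge0.
move/eqP; rewrite mulf_eq0 (gt_eqF p) orbF => /eqP u0; split=> //.
by rewrite b u0 mulr0 oppr0.
Qed.

(** Squaring and cancelling [1 + C2], if it is not 0, leaves
    [(1 - C2) * bb ^+ 2 = rho ^+ 2 * (1 + C2)], whose left side is at least 9/2 and right side at
    most 2. *)
Lemma u1_eq0 z : u1 z = 0 -> C2 z.2 <= 1 / 2 -> C2 z.2 = -1.
Proof.
rewrite /u1 => H c1.
have H2 : S2 z.2 ^+ 2 * bb z.1 ^+ 2 = rho ^+ 2 * (1 + C2 z.2) ^+ 2.
  have -> : S2 z.2 ^+ 2 * bb z.1 ^+ 2 = (S2 z.2 * bb z.1) ^+ 2 by rewrite exprMn.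
  have -> : S2 z.2 * bb z.1 = - (rho * (1 + C2 z.2)) by lra.
  by rewrite sqrrN exprMn.
have S : S2 z.2 ^+ 2 = (1 - C2 z.2) * (1 + C2 z.2) by have := C2S2 z.2; lra.
rewrite S in H2.
have c0 := C2_ge z.2; have b3 := bb_ge z.1.
have [->//|cN] := eqVneq (C2 z.2) (-1).
have cp : 0 < 1 + C2 z.2 by rewrite lt_neqAle eq_sym; apply/andP; split; [apply/eqP; move/eqP: cN; lra|lra].
have E : (1 - C2 z.2) * bb z.1 ^+ 2 = rho ^+ 2 * (1 + C2 z.2).
  apply: (mulIf (lt0r_neq0 cp)); rewrite -[RHS]mulrA -expr2 -H2; ring.
have A : (1 / 2) * 9 <= (1 - C2 z.2) * bb z.1 ^+ 2.
  by apply: ler_pM => //; [lra| nra].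
have B : rho ^+ 2 * (1 + C2 z.2) <= 1 * 2.
  by apply: ler_pM; [exact: sqr_ge0|lra|rewrite expr_le1|lra].
by lra.
Qed.

Lemma u_eq0 z : u1 z = 0 -> u2 z = 0 -> C2 z.2 = -1 /\ C2 z.1 = 1 / 2.
Proof.
move=> h1 h2.
have c : C2 z.2 <= 1 / 2.
  rewrite leNgt; apply/negP => c; move: h2; rewrite /u2.
  have := C2_le z.1; have := C2_le z.2 => a b.
  have : (1 - C2 z.2) * C2 z.1 <= (1 - C2 z.2) * 1 by rewrite ler_wpM2l// subr_ge0.
  by lra.
have E := u1_eq0 h1 c; split => //.
by move: h2; rewrite /u2 E; lra.
Qed.

Lemma HH_mid_gt x : - (1 / 6) < x < 1 / 6 -> hs < HH (x, 1 / 2).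
Proof.
move=> /andP[x1 x2].
have D (s : R) := der_HH rho (der_id s) (der_cst (1 / 2) s).
(* The midpoint of [- (1 / 6)] and [x]. The derivative vanishes at the saddle, so strict growth is
   claimed only from [m] to [x]. *)
pose m := (x - 1 / 6) / 2.
have u2N s : - (1 / 6) <= s <= 1 / 6 -> u2 ((s, 1 / 2) : P) <= 0.
  by move=> sI; rewrite /u2 /= C2_half; have := C2_ge_half sI; lra.
have A : hs <= HH (m, 1 / 2).
  apply: (@der_ge0_le _ (fun x => HH (x, 1 / 2)) _ (- (1 / 6)) m _ (fun s _ => D s)).
    by rewrite /m; lra.
  move=> s /andP[s1 s2]; rewrite mulr0 sub0r mulr1 mulr_ge0 ?pi_ge0// oppr_ge0.
  by apply: u2N; rewrite /m in s2; apply/andP; split; lra.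
apply: (le_lt_trans A).
have mx : m <= x by rewrite /m; lra.
have [s /andP[s1 s2] E] := der_MVT mx (fun s _ => D s).
rewrite -subr_gt0 E mulr_gt0//; last by rewrite /m; lra.
rewrite mulr0 sub0r mulr1 mulr_gt0 ?pi_gt0// oppr_gt0 /u2 /= C2_half.
have := @C2_gt_half _ s; rewrite (_ : - (1 / 6) < s < 1 / 6); last first.
  by rewrite /m in s1; apply/andP; split; lra.
by move=> /(_ isT); lra.
Qed.

Lemma D0_mid x : - (1 / 6) < x < 1 / 6 -> D0 (x, 1 / 2).
Proof.
move=> xI; split; last exact: HH_mid_gt.
by move/andP: xI => [? ?]; split => /=; lra.
Qed.

Lemma C2_sub (t : R) (k : int) : C2 (t - k%:~R) = C2 t.
Proof. by rewrite -mulrNz C2int. Qed.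

(** A point of this level with [C2 z.1 > 1 / 2] is a translate of one strictly between the saddle
    and the sink, which is inside the loop. This yields [u2 >= 0] on the level outside the loop. *)
Lemma mid_line z (n : int) : EE z = 0 -> z.2 = n%:~R + 1 / 2 -> C2 z.1 <= 1 / 2.
Proof.
move=> z0 z2; rewrite leNgt; apply/negP => c.
pose k := (Num.floor (z.1 + 1 / 6), n); pose w := z - intv R k.
have : 0 < EE w.
  apply: D0_EE_gt0.
  have w2 : w.2 = 1 / 2 by rewrite /w /= z2; lra.
  have cw : C2 w.1 = C2 z.1 by rewrite /w /= C2_sub.
  have /andP[a b] := floor_itv (z.1 + 1 / 6); rewrite intrD in b.
  have w1 : - (1 / 6) <= w.1 < 5 / 6 by rewrite /w /=; apply/andP; split; lra.
  rewrite [w]surjective_pairing w2; apply: D0_mid.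
  move/andP: w1 => [p q]; apply/andP; split.
    rewrite lt_neqAle p andbT; apply/eqP => E.
    by move: cw; rewrite -E C2N C2_sixth; lra.
  rewrite ltNge; apply/negP => r.
  have := @C2_le_half _ w.1; rewrite r (ltW q) cw => /(_ isT); lra.
by rewrite /w -intvN EE_int z0 ltxx.
Qed.

Lemma vf_zero z : vf z = 0 -> in_Z2 (z - zsink) \/ in_Z2 (z - zsaddle).
Proof.
move=> /vf_eq0[h1 h2]; have [c2 c1] := u_eq0 h1 h2.
pose k := cell z; have [/= b1 b2] := cell_box z.
have y : z.2 - (Num.floor z.2)%:~R = 1 / 2 by apply: C2_eqN1 => //; rewrite C2_sub.
have [|e|e] := @C2_eq_half _ (z.1 - (Num.floor (z.1 + 1 / 6))%:~R) b1; first by rewrite C2_sub.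
  right; exists k; apply: injective_projections => /=; rewrite /zsaddle /=; lra.
left; exists k; apply: injective_projections => /=; rewrite /zsink /=; lra.
Qed.

Lemma EE_sink : 0 < EE zsink.
Proof.
apply: D0_EE_gt0; split; first by split => /=; lra.
have p4 := pi_le4 (R := R); have s0 := S2_sixth_gt0 (R := R).
(* [HH zsink - hs] is [2 * S2 (1 / 6) - pi / 3], and [pi <= 4] makes [2 / 3] the value to beat. *)
have s1 : 2 / 3 < S2 (1 / 6 : R).
  rewrite -ltr_sqr ?nnegrE//; [|exact: ltW].
  by have := C2S2 (1 / 6 : R); rewrite C2_sixth => H; lra.
rewrite hsE /HH /bb /= C2_half S2_half; lra.
Qed.

Lemma vf_zero_saddle z : vf z = 0 -> EE z = 0 -> in_Z2 (z - zsaddle).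
Proof.
move=> /vf_zero[|//] [k kE] z0.
have : EE (zsink + intv R k) = 0 by rewrite -kE addrC subrK.
by rewrite EE_int => E; have := EE_sink; rewrite E ltxx.
Qed.

End Trapped.

Section TrappedFlow.
Context {R : realType}.
Local Notation P := (R * R)%type.
Local Notation der f x d := (is_derive x (1 : R) (f : R -> R) (d : R)).
Variable rho : R.
Hypothesis rho_ge0 : 0 <= rho.
Hypothesis rho_le1 : rho <= 1.
Local Notation u1 := (u1 rho).
Local Notation HH := (HH rho).
Local Notation EE := (EE rho).
Local Notation vf := (vf rho).
Variable L : R.
Hypothesis L_gt0 : 0 < L.
Hypothesis vL : forall i (z w : P),
  `|Defs.comp i (vf z) - Defs.comp i (vf w)| <= L * (`|z.1 - w.1| + `|z.2 - w.2|).
Local Notation phi := (lflow vf L).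

Let phiD s t z : phi (s + t) z = phi s (phi t z). Proof. exact: phiD. Qed.
Let phi0 z : phi 0 z = z. Proof. exact: phi0. Qed.

Lemma phi_fix z t : vf z = 0 -> phi t z = z.
Proof.
move=> vz; rewrite [RHS]surjective_pairing; apply/esym.
apply: (lflow_eq L_gt0 vL (f := fun=> z.1) (g := fun=> z.2)) => // s.
by rewrite -surjective_pairing vz; split; exact: der_cst.
Qed.

Lemma phi_vf_neq0 z t : vf z <> 0 -> vf (phi t z) <> 0.
Proof.
move=> vz h; apply: vz; have := phi_fix (- t) h.
by rewrite -phiD addNr phi0 => ->.
Qed.

Lemma phi_x z (t : R) : EE z = 0 -> der (fun t => (phi t z).1) t (u1 (phi t z)).
Proof.
move=> z0; have := phi_der1 L_gt0 vL z t.
by rewrite (vf_EE0 (EE_eq0_phi rho_ge0 rho_le1 L_gt0 vL t z0)).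
Qed.

Lemma phi_y z (t : R) : EE z = 0 -> der (fun t => (phi t z).2) t (u2 (phi t z)).
Proof.
move=> z0; have := phi_der2 L_gt0 vL z t.
by rewrite (vf_EE0 (EE_eq0_phi rho_ge0 rho_le1 L_gt0 vL t z0)).
Qed.

Lemma C2_addint t (k : int) : C2 (k%:~R + t : R) = C2 t.
Proof. by rewrite addrC C2int. Qed.

Lemma S2_addint t (k : int) : S2 (k%:~R + t : R) = S2 t.
Proof. by rewrite addrC S2int. Qed.

Lemma u2_near_int (z : P) : 1 / 2 <= C2 z.2 -> 1 / 2 <= u2 z.
Proof.
move=> c; rewrite /u2; have a := C2_le z.1; have b := C2_le z.2.
have : (1 - C2 z.2) * C2 z.1 <= (1 - C2 z.2) * 1 by rewrite ler_wpM2l// subr_ge0.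
by lra.
Qed.

Lemma y_ge_int z (n : int) s t : EE z = 0 -> n%:~R <= (phi s z).2 -> s < t ->
  n%:~R < (phi t z).2.
Proof.
move=> z0 h st; apply: (barrier (fun r => phi_y r z0) _ h st) => r _ E.
have {}E : (phi r z).2 = n%:~R := E.
rewrite /u2 E -[n%:~R]addr0 C2_addint /C2 mulr0 cos0 subrr mul0r subr0.
exact: ltr01.
Qed.

Definition bounded_above z := exists M, forall t, 0 <= t -> (phi t z).2 <= M.

(** Integer levels are crossed upwards only, so a level once reached is kept; a bounded trajectory
    has a last one. *)
Lemma eventual_floor z : EE z = 0 -> bounded_above z ->
  exists n : int, exists2 T, 0 <= T & forall t, T <= t -> n%:~R <= (phi t z).2 < n%:~R + 1.
Proof.
move=> z0 [M MP]; pose m := Num.floor z.2.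
pose Q (k : nat) := exists2 t, 0 <= t & (m + k%:Z)%:~R <= (phi t z).2.
have Q0 : Q 0%N by exists 0 => //; rewrite phi0 addr0 floor_le.
have [K KP] : exists K : nat, ~ Q K.
  exists (Num.truncn (M - m%:~R)).+1 => -[t t0].
  have := MP t t0; have := truncnS_gt (M - m%:~R).
  by rewrite intrD -pmulrn; lra.
have [k Qk Qk1] : exists2 k, Q k & ~ Q k.+1.
  elim: K KP => [//|K IH] KP; have [QK|nQK] := pselect (Q K); first by exists K.
  exact: IH.
have [T T0 TP] := Qk; exists (m + k%:Z); exists T => // t Tt; apply/andP; split.
  by move: Tt; rewrite le_eqVlt => /orP[/eqP <-//|Tt]; exact: ltW (y_ge_int z0 TP Tt).
rewrite ltNge; apply/negP => h; apply: Qk1; exists t; first exact: le_trans Tt.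
by rewrite -addn1 PoszD addrA intrD.
Qed.

(* Near integer levels u2 >= 1/2, so a bounded trajectory stays away from them; the level
   n + 1/2 is crossed upwards only, because outside the loop cos(2 pi x) <= 1/2 there. *)
Lemma trapped_zone z : EE z = 0 -> vf z <> 0 -> bounded_above z ->
  exists n : int, exists2 T, 0 <= T &
    (forall t, T <= t -> n%:~R + 1 / 6 <= (phi t z).2 <= n%:~R + 5 / 6) /\
    ((forall t, T <= t -> 0 <= u1 (phi t z)) \/ (forall t, T <= t -> u1 (phi t z) <= 0)).
Proof.
move=> z0 vz bz; have [n [T T0 TP]] := eventual_floor z0 bz.
have noesc S : T <= S -> (forall t, S <= t -> 1 / 2 <= u2 (phi t z)) -> False.
  move=> TS H; have h0 : 0 < 1 / 2 :> R by lra.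
  have [t tS tM] := escape (n%:~R + 1) (fun r => phi_y r z0) h0 H.
  by have /andP[_] := TP t (le_trans TS tS); lra.
have up t : T <= t -> (phi t z).2 < n%:~R + 5 / 6.
  move=> Tt; rewrite ltNge; apply/negP => h.
  have zone y : n%:~R + 5 / 6 <= y < n%:~R + 1 -> 1 / 2 <= C2 y.
    move=> /andP[y1 y2]; rewrite -(subrK n%:~R y) C2int -C2flip.
    by apply: C2_ge_half; apply/andP; split; lra.
  apply: (noesc t Tt) => r tr; apply: u2_near_int; apply: (zone _).
  have /andP[_ ->] := TP r (le_trans Tt tr); rewrite andbT.
  move: tr; rewrite le_eqVlt => /orP[/eqP <-//|tr].
  apply: ltW; apply: (barrier (fun r => phi_y r z0) _ h tr) => s ts E.
  have {}E : (phi s z).2 = n%:~R + 5 / 6 := E.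
  apply: (@lt_le_trans _ _ (1 / 2)); first by lra.
  by apply: u2_near_int; apply: (zone _); rewrite E; apply/andP; split; lra.
have zone y : n%:~R <= y <= n%:~R + 1 / 6 -> 1 / 2 <= C2 y.
  move=> /andP[y1 y2]; rewrite -(subrK n%:~R y) C2int.
  by apply: C2_ge_half; apply/andP; split; lra.
have [T1 TT1 T1P] : exists2 T1, T <= T1 & n%:~R + 1 / 6 <= (phi T1 z).2.
  apply: contrapT => H; apply: (noesc T (lexx _)) => t Tt; apply: u2_near_int; apply: (zone _).
  have /andP[-> _] /= := TP t Tt; rewrite leNgt; apply/negP => h.
  by apply: H; exists t => //; exact: ltW.
have lo t : T1 <= t -> n%:~R + 1 / 6 <= (phi t z).2.
  rewrite le_eqVlt => /orP[/eqP <-//|Tt].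
  apply: ltW; apply: (barrier (fun r => phi_y r z0) _ T1P Tt) => s ts E.
  have {}E : (phi s z).2 = n%:~R + 1 / 6 := E.
  apply: (@lt_le_trans _ _ (1 / 2)); first by lra.
  by apply: u2_near_int; apply: (zone _); rewrite E; apply/andP; split; lra.
have u1n w : u1 w = u1 (w.1, w.2 - n%:~R).
  by rewrite -(u1_int rho w (0, - n)); congr u1; apply: injective_projections => /=;
    rewrite ?mulrNz ?addr0.
exists n.
have [[T2 T12 T2P]|no] := pselect (exists2 T2, T1 <= T2 & n%:~R + 1 / 2 <= (phi T2 z).2).
  have hi t : T2 <= t -> n%:~R + 1 / 2 <= (phi t z).2.
    rewrite le_eqVlt => /orP[/eqP <-//|Tt].
    apply: ltW; apply: (barrier (fun r => phi_y r z0) _ T2P Tt) => s ts E.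
    have {}E : (phi s z).2 = n%:~R + 1 / 2 := E.
    have c1 := mid_line (EE_eq0_phi rho_ge0 rho_le1 L_gt0 vL s z0) E.
    have c2 : C2 (phi s z).2 = -1 by rewrite E C2_addint C2_half.
    have ge : 0 <= u2 (phi s z) by rewrite /u2 c2; lra.
    (* [u1] vanishes on the whole level [n + 1 / 2], so [u2 = 0] would make this point a
       singularity. *)
    rewrite lt_neqAle ge andbT; apply/eqP => e.
    apply: (@phi_vf_neq0 z s vz); apply/vf_eq0; split; last by rewrite -e.
    by rewrite /u1 c2 E S2_addint S2_half; lra.
  have TT2 : T <= T2 by exact: le_trans T12.
  exists T2; first exact: le_trans TT2.
  split; first by move=> t tt; rewrite lo ?(le_trans T12)// ltW// up// (le_trans TT2).
  right=> t tt; rewrite u1n; apply: u1_le0 => //.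
  have := hi t tt; have := up t (le_trans TT2 tt) => a b.
  by apply/andP; split; lra.
exists T1; first exact: le_trans TT1.
split; first by move=> t tt; rewrite lo// ltW// up// (le_trans TT1).
left=> t tt; rewrite u1n; apply: u1_ge0 => //.
have a := lo t tt.
have b : (phi t z).2 < n%:~R + 1 / 2.
  by rewrite ltNge; apply/negP => h; apply: no; exists t.
by apply/andP; split; lra.
Qed.

(** [HH] is conserved and [HH + pi * x] is bounded on a horizontal band. *)
Lemma H_bounds_x z : EE z = 0 -> forall n : int, exists M, forall t,
  n%:~R <= (phi t z).2 <= n%:~R + 1 -> `|(phi t z).1| <= M.
Proof.
move=> z0 n; pose N : R := `|n%:~R| + 1.
exists ((5 + (4 * N + 1) + `|HH z|) / pi) => t /andP[y1 y2].
have p0 := pi_gt0 R; have p4 := pi_le4 (R := R).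
have := EE_eq0_H rho_ge0 rho_le1 L_gt0 vL t z0.
set w := phi t z in y1 y2 *; rewrite /HH => E.
have B (a b p q : R) : `|a| <= p -> `|b| <= q -> `|a * b| <= p * q.
  by move=> ap bq; rewrite normrM ler_pM.
have a1 := S2_ge w.2; have a2 := S2_le w.2; have b1 := bb_ge w.1; have b2 := bb_le w.1.
have c1 := C2_ge w.2; have c2 := C2_le w.2.
have nN : `|n%:~R : R| <= N - 1 by rewrite /N; lra.
have yN : `|w.2| <= N.
  by move: nN; rewrite !ler_norml => /andP[? ?]; apply/andP; split; lra.
have t1 : `|(1 - C2 w.2) / 2 * bb w.1| <= 1 * 5 by apply: B; rewrite ler_norml; apply/andP; split; lra.
have t2 : `|pi * w.2| <= 4 * N by apply: B => //; rewrite (ger0_norm (ltW p0)).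
have t3 : `|rho * (pi * w.2 + S2 w.2 / 2)| <= 1 * (4 * N + 1).
  apply: B; first by rewrite ger0_norm.
  apply: (le_trans (ler_normD _ _)); apply: lerD => //.
  by rewrite ler_norml; apply/andP; split; lra.
rewrite ler_pdivlMr// mulrC -[X in X * _](ger0_norm (ltW p0)) -normrM.
have -> : pi * w.1 = (1 - C2 w.2) / 2 * bb w.1 + rho * (pi * w.2 + S2 w.2 / 2) - HH z.
  by rewrite /HH -E; ring.
apply: (le_trans (ler_normB _ _)); apply: lerD => //.
by apply: (le_trans (ler_normD _ _)); lra.
Qed.

(** The sign of [u1] makes the first coordinate eventually monotone, and conservation of [HH] keeps
    it bounded. *)
Lemma trapped_x_cauchy z : EE z = 0 -> vf z <> 0 -> bounded_above z ->
  forall e, 0 < e -> exists T, forall s t, T <= s -> T <= t ->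
    `|(phi s z).1 - (phi t z).1| <= e.
Proof.
move=> z0 vz bz e e0; have [n [T T0 [zone mono]]] := trapped_zone z0 vz bz.
have [M MP] := H_bounds_x z0 n.
have xM t : T <= t -> `|(phi t z).1| <= M.
  by move=> /zone/andP[a b]; apply: MP; apply/andP; split; lra.
case: mono => mono.
  have [||T' _ H] := @monotone_cauchy _ (fun t => (phi t z).1) T M _ _ e e0.
  - move=> s t Ts st; apply: (der_ge0_le st (fun r _ => phi_x r z0)) => r /andP[sr _].
    by apply: mono; exact: le_trans sr.
  - by move=> t /xM; exact: le_trans (ler_norm _).
  by exists T' => s t; exact: H.
have [||T' _ H] := @monotone_cauchy _ (fun t => - (phi t z).1) T M _ _ e e0.
- move=> s t Ts st; rewrite lerN2; apply: (der_le0_ge st (fun r _ => phi_x r z0)) => r /andP[sr _].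
  by apply: mono; exact: le_trans sr.
- by move=> t /xM h; rewrite (le_trans (ler_norm _))// normrN.
by exists T' => s t a b; have := H s t a b; rewrite -opprD normrN.
Qed.

End TrappedFlow.

(** * Limit sets *)

Section Density.
Context {R : realType}.

Definition irrational_slope (a : R) := forall p q : int, q != 0 -> a * q%:~R != p%:~R.

Lemma irrational_slopeN a : irrational_slope a -> irrational_slope (- a).
Proof.
move=> H p q q0; have := H (- p) q q0; apply: contra_neq => E.
by rewrite mulrNz -E mulNr opprK.
Qed.

(** One step of Euclid's algorithm on 1 and the current [d]: the remainder [r] of 1 modulo [d] is
    not 0 by irrationality, and [r] or [d - r] is at most [d / 2]. *)
Lemma small_multiple a n : irrational_slope a ->
  exists p q : int, [/\ q != 0, 0 < a * q%:~R - p%:~R & a * q%:~R - p%:~R <= 2^-1 ^+ n].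
Proof.
move=> irr; elim: n => [|n [p [q [q0 d0 dn]]]].
  exists (Num.floor a), 1; have /andP[l1 l2] := floor_itv a; rewrite intrD in l2.
  have := irr (Num.floor a) 1 isT; rewrite mulr1z mulr1 => N.
  split=> //; last by rewrite expr0; lra.
  by rewrite subr_gt0 lt_neqAle eq_sym N.
set d := a * q%:~R - p%:~R in d0 dn.
have d1 : d <= 1 by apply: (le_trans dn); apply: exprn_ile1 => //; lra.
pose m := Num.floor d^-1.
have /andP[m1 m2] := floor_itv d^-1; rewrite -/m intrD in m1 m2.
have m1' : m%:~R * d <= 1 by rewrite -ler_pdivlMr// div1r.
have m2' : 1 < (m%:~R + 1) * d by rewrite -ltr_pdivrMr// div1r.
have mge : (1 <= m)%R.
  by rewrite /m floor_ge_int mulr1z -[leLHS]invr1 lef_pV2 ?posrE.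
pose r := 1 - m%:~R * d.
have rE : r = a * (- (m * q))%:~R - (- (1 + m * p))%:~R.
  by rewrite /r /d !mulrNz intrD !intrM mulr1z; ring.
have N0 : m * q != 0 by rewrite mulf_neq0//; apply/eqP => m0; rewrite m0 in mge.
have r0 : r != 0.
  by rewrite rE subr_eq0; apply: irr; rewrite oppr_eq0.
have rp : 0 < r by rewrite lt_neqAle eq_sym r0 /r; lra.
have rd : r < d by rewrite /r; lra.
have [rh|rh] := leP r (d / 2).
  exists (- (1 + m * p)), (- (m * q)); rewrite -rE; split => //; first by rewrite oppr_eq0.
  by rewrite exprS; lra.
exists (p + (1 + m * p)), (q + m * q).
have -> : a * (q + m * q)%:~R - (p + (1 + m * p))%:~R = d - r.
  by rewrite /r /d !intrD !intrM mulr1z; ring.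
split; [|lra|by rewrite exprS; lra].
have -> : q + m * q = (1 + m) * q by ring.
by rewrite mulf_neq0//; apply/eqP => m0; clear -mge m0; lia.
Qed.

Lemma dense_multiples a x0 xi e (N : nat) : irrational_slope a -> 0 < e ->
  exists2 n : nat, (N <= n)%N & exists k : int, `|x0 + a * n%:R - k%:~R - xi| <= e.
Proof.
move=> irr e0; have [n0 ne] := half_pow_small e0.
have [p [q [q0 d0 dn]]] := small_multiple n0 irr.
have main (b y0 eta : R) (r : nat) (s : int) : 0 < b * r%:R - s%:~R -> b * r%:R - s%:~R <= e ->
  exists2 n : nat, (N <= n)%N & exists k : int, `|y0 + b * n%:R - k%:~R - eta| <= e.
  set d := b * r%:R - s%:~R => dp de.
  (* Walk from [a0] in steps of length [d <= e] towards the next integer [K]: the last position not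
     beyond [K] is within [d] of it. Starting at index [N] makes the index as large as wanted. *)
  pose a0 := y0 + b * N%:R - eta; pose K := Num.floor a0 + 1.
  have Ka : a0 < K%:~R by exact: floorD1_gt.
  pose m := Num.truncn ((K%:~R - a0) / d).
  have mI : m%:R <= (K%:~R - a0) / d < m.+1%:R.
    by apply: truncn_itv; rewrite divr_ge0 ?ltW// subr_gt0.
  move/andP: mI; rewrite ler_pdivlMr// ltr_pdivrMr// -natr1 => -[h1 h2].
  exists (N + r * m)%N; first exact: leq_addr.
  exists (K + s * m%:Z).
  have -> : y0 + b * (N + r * m)%:R - (K + s * m%:Z)%:~R - eta = a0 + m%:R * d - K%:~R.
    by rewrite /a0 /d natrD natrM intrD intrM -pmulrn; ring.
  by rewrite ler_norml; apply/andP; split; lra.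
have dn' := le_trans dn (ltW ne).
have [qp|qn] := leP 0 q.
  have qE : q%:~R = `|q|%N%:R :> R by rewrite pmulrn gez0_abs.
  by apply: (main a x0 xi `|q|%N p); rewrite -qE.
(* The index must be a natural number, so for [q < 0] everything is reflected: [- a], [- x0],
   [- xi]. *)
have qE : - q%:~R = `|q|%N%:R :> R by rewrite pmulrn -mulrNz ltz0_abs.
have [||n Nn [k kP]] := main (- a) (- x0) (- xi) `|q|%N p.
- by rewrite -qE mulrNN.
- by rewrite -qE mulrNN.
exists n => //; exists (- k).
rewrite -normrN; move: kP; rewrite mulrNz.
by congr (`| _ | <= _); ring.
Qed.
End Density.

Section LimitSets.
Context {R : realType}.
Local Notation P := (R * R)%type.
Variable phi : R -> P -> P.

Lemma cvg_P (u : nat -> P) (w : P) :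
  (forall e, 0 < e -> \forall n \near \oo, `|w.1 - (u n).1| <= e /\ `|w.2 - (u n).2| <= e) ->
  u n @[n --> \oo] --> w.
Proof.
move=> H; rewrite [w]surjective_pairing.
have -> : u = fun n => ((u n).1, (u n).2) by apply/funext => n; exact: surjective_pairing.
by apply: cvg_to_pair; apply/cvgrPdist_le => e /H; apply: filterS => n [].
Qed.

Lemma seq_lim_le (f : P -> R) (u : nat -> P) (w : P) (c : R) : continuous f ->
  u n @[n --> \oo] --> w -> (\forall n \near \oo, f (u n) <= c) -> f w <= c.
Proof.
move=> fc uw H; rewrite leNgt; apply/negP => cf.
have fu : f (u n) @[n --> \oo] --> f w by apply: continuous_cvg => //; exact: fc.
have fu2 : \forall n \near \oo, c < f (u n) by apply: (cvgr_gt (f w) fu).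
by have [n [/= h1 h2]] := filter_ex (filterI H fu2); rewrite ltNge h1 in h2.
Qed.

Lemma seq_lim_eq (f : P -> R) (u : nat -> P) (w : P) (c : R) : continuous f ->
  u n @[n --> \oo] --> w -> (forall n, f (u n) = c) -> f w = c.
Proof.
move=> fc uw H; apply/eqP; rewrite eq_le (seq_lim_le fc uw) /=; last first.
  by near=> n; rewrite H.
rewrite -lerN2; apply: (@seq_lim_le (fun z => - f z) u w) => //.
  by move=> z; apply: continuousN; exact: fc.
by near=> n; rewrite H.
Unshelve. all: by end_near. Qed.

Let inv_small (e : R) : 0 < e -> \forall n \near \oo, n.+1%:R^-1 <= e.
Proof. by move=> e0; near=> n; apply: ltW; near: n; exact: near_infty_natSinv_lt (PosNum e0). Unshelve. all: by end_near. Qed.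

Lemma omega_intro z w : (forall e T, 0 < e -> exists2 t, T <= t & exists k,
   `|w.1 - (phi t z - intv R k).1| <= e /\ `|w.2 - (phi t z - intv R k).2| <= e) ->
  omega_limit phi z w.
Proof.
move=> H.
have /choice[f fP] (n : nat) : exists tk : R * (int * int), n%:R <= tk.1 /\
   `|w.1 - (phi tk.1 z - intv R tk.2).1| <= n.+1%:R^-1 /\
   `|w.2 - (phi tk.1 z - intv R tk.2).2| <= n.+1%:R^-1.
  by have [|t t1 [k kP]] := H n.+1%:R^-1 n%:R; [rewrite invr_gt0|exists (t, k)].
exists (fun n => (f n).1), (fun n => (f n).2); split.
  apply/cvgryPge => A; near=> n; have [h _] := fP n; apply: (le_trans _ h).
  by near: n; exact: nbhs_infty_ger.
apply: cvg_P => e e0; near=> n; have [_ [h1 h2]] := fP n.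
have h : n.+1%:R^-1 <= e by near: n; exact: inv_small.
by split; [exact: le_trans h1 h|exact: le_trans h2 h].
Unshelve. all: by end_near. Qed.

Lemma alpha_intro z w : (forall e T, 0 < e -> exists2 t, t <= T & exists k,
   `|w.1 - (phi t z - intv R k).1| <= e /\ `|w.2 - (phi t z - intv R k).2| <= e) ->
  alpha_limit phi z w.
Proof.
move=> H.
have /choice[f fP] (n : nat) : exists tk : R * (int * int), tk.1 <= - n%:R /\
   `|w.1 - (phi tk.1 z - intv R tk.2).1| <= n.+1%:R^-1 /\
   `|w.2 - (phi tk.1 z - intv R tk.2).2| <= n.+1%:R^-1.
  by have [|t t1 [k kP]] := H n.+1%:R^-1 (- n%:R); [rewrite invr_gt0|exists (t, k)].
exists (fun n => (f n).1), (fun n => (f n).2); split.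
  apply/cvgrNyPle => A; near=> n; have [h _] := fP n; apply: (le_trans h).
  by rewrite lerNl; near: n; exact: nbhs_infty_ger.
apply: cvg_P => e e0; near=> n; have [_ [h1 h2]] := fP n.
have h : n.+1%:R^-1 <= e by near: n; exact: inv_small.
by split; [exact: le_trans h1 h|exact: le_trans h2 h].
Unshelve. all: by end_near. Qed.

Lemma closure_seq (A : set P) (u : nat -> P) w : (forall n, A (u n)) ->
  u n @[n --> \oo] --> w -> closure A w.
Proof.
move=> uA uw; apply: (@closed_cvg _ _ \oo _ u (closure A) _ _ _ uw).
  exact: closed_closure.
by near=> n; apply: subset_closure; exact: uA.
Unshelve. all: by end_near. Qed.

End LimitSets.

Section Dynamics.
Context {R : realType}.
Local Notation P := (R * R)%type.
Variable rho : R.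
Hypothesis rho_ge0 : 0 <= rho.
Hypothesis rho_le1 : rho <= 1.
Local Notation u1 := (u1 rho).
Local Notation HH := (HH rho).
Local Notation hs := (hs rho).
Local Notation EE := (EE rho).
Local Notation vf := (vf rho).
Variable L : R.
Hypothesis L_gt0 : 0 < L.
Hypothesis vL : forall i (z w : P),
  `|Defs.comp i (vf z) - Defs.comp i (vf w)| <= L * (`|z.1 - w.1| + `|z.2 - w.2|).
Local Notation phi := (lflow vf L).

Let phiD s t z : phi (s + t) z = phi s (phi t z). Proof. exact: phiD. Qed.
Let phi0 z : phi 0 z = z. Proof. exact: phi0. Qed.
Let phi_int t z k : phi t (z + intv R k) = phi t z + intv R k. Proof. exact: phi_int. Qed.
Let phi_cont t : continuous (phi t). Proof. exact: lflow_cont. Qed.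
Let EE_phi t z : EE z = 0 -> EE (phi t z) = 0. Proof. exact: EE_eq0_phi. Qed.
Let HH_phi t z : EE z = 0 -> HH (phi t z) = HH z. Proof. exact: EE_eq0_H. Qed.
Let fst_cont : continuous (fun z : P => z.1). Proof. by move=> z; exact: cvg_fst. Qed.
Let snd_cont : continuous (fun z : P => z.2). Proof. by move=> z; exact: cvg_snd. Qed.
Let EE_cont : continuous EE. Proof. exact: locally_smc_cont (locally_smc_EE rho). Qed.
Let HH_cont : continuous HH. Proof. exact: smc_cont (smc_HH rho). Qed.

Lemma phi_sub t z k : phi t (z - intv R k) = phi t z - intv R k.
Proof. by rewrite -intvN phi_int. Qed.

Lemma EE_sub z k : EE (z - intv R k) = EE z.
Proof. by rewrite -intvN EE_int. Qed.

Lemma HH_sub z k : HH (z - intv R k) = HH z + pi * k.1%:~R - rho * pi * k.2%:~R.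
Proof. by rewrite -intvN HH_int /= !mulrNz; ring. Qed.

Section Limit.
Variables (z : P) (t : nat -> R) (k : nat -> int * int) (w : P).
Hypothesis z0 : EE z = 0.
Hypothesis toy : t n @[n --> \oo] --> +oo.
Hypothesis uw : (phi (t n) z - intv R (k n)) @[n --> \oo] --> w.

Lemma limit_EE : EE w = 0.
Proof. by apply: (seq_lim_eq EE_cont uw) => n; rewrite EE_sub EE_phi. Qed.

(* The trajectory of [w] has constant first coordinate, so u1 vanishes along it. *)
Lemma trapped_limit : vf z <> 0 -> bounded_above rho L z -> vf w = 0.
Proof.
move=> vz bz; have [m [T T0 [zone _]]] := trapped_zone rho_ge0 rho_le1 L_gt0 vL z0 vz bz.
have late A : \forall n \near \oo, A <= t n by move/cvgryPge : toy; exact.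
have xs s : (phi s w).1 = w.1.
  apply/eqP; rewrite -subr_eq0 -normr_le0; apply/ler_addgt0Pr => e e0; rewrite add0r.
  have [S SP] := trapped_x_cauchy rho_ge0 rho_le1 L_gt0 vL z0 vz bz e0.
  apply: (@seq_lim_le _ (fun p => `|(phi s p).1 - p.1|) _ _ _ _ uw).
    move=> p; apply: cvg_norm; apply: cvgB; last exact: fst_cont.
    exact: (continuous_comp (@phi_cont s p) (@fst_cont _)).
  near=> n; rewrite phi_sub -phiD /= opprB addrA subrK; apply: SP.
    have : S - s <= t n by near: n; exact: late.
    by lra.
  by near: n; exact: late.
have c2 s : C2 (phi s w).2 <= 1 / 2.
  apply: (@seq_lim_le _ (fun p => C2 (phi s p).2) _ _ _ _ uw).
    move=> p; apply: (@continuous_comp _ _ _ (fun p => (phi s p).2) C2).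
      exact: (continuous_comp (@phi_cont s p) (@snd_cont _)).
    exact: der_cont (der_C2 _).
  near=> n; rewrite phi_sub -phiD /= C2_sub.
  have : T - s <= t n by near: n; exact: late.
  move=> h; have Ts : T <= s + t n by lra.
  rewrite -(C2_sub _ m); apply: C2_le_half.
  by have /andP[h1 h2] := zone _ Ts; apply/andP; split; lra.
have w0 := limit_EE.
have u10 s : u1 (phi s w) = 0.
  have D := phi_x rho_ge0 rho_le1 L_gt0 vL s w0.
  have E : (fun t => (phi t w).1) = fun=> w.1 by apply/funext => r; exact: xs.
  by rewrite E in D; exact: der_unique D (der_cst _ _).
have cN s : C2 (phi s w).2 = -1 by exact: u1_eq0 rho_ge0 rho_le1 _ (u10 s) (c2 s).
have sN s : S2 (phi s w).2 = 0.
  have := C2S2 (phi s w).2; rewrite cN => h; apply/eqP; rewrite -sqrf_eq0; apply/eqP; lra.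
have u20 : u2 w = 0.
  have D := der_comp (phi_y rho_ge0 rho_le1 L_gt0 vL 0 w0) (der_S2 (phi 0 w).2).
  have E : (fun t => S2 (phi t w).2) = fun=> 0 by apply/funext => r; exact: sN.
  rewrite E in D; have := der_unique D (der_cst _ _); rewrite cN phi0 => /eqP.
  by rewrite mulf_eq0 mulf_eq0 mulf_eq0 (gt_eqF (pi_gt0 R)) => /orP[/orP[/orP[]|]|] /eqP //; lra.
by apply/vf_eq0; split=> //; have := u10 0; rewrite phi0.
Unshelve. all: by end_near. Qed.
End Limit.

(* The values taken by HH on the lifts of the saddle. *)
Definition Qset : set R := [set h | exists i j : int, h = hs + pi * i%:~R + rho * pi * j%:~R].

Lemma saddle_Q z : in_Z2 (z - zsaddle) -> Qset (HH z).
Proof.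
move=> [k kE]; exists (- k.1), k.2.
have -> : z = zsaddle + intv R k by rewrite -kE addrC subrK.
by rewrite HH_int mulrNz mulrN.
Qed.

Lemma bounded_funP (u : nat -> R) M : (forall n, `|u n| <= M) -> bounded_fun u.
Proof.
move=> uM; exists M; split; first exact: num_real.
by move=> x Mx n _; exact: le_trans (uM n) (ltW Mx).
Qed.

Lemma increasing_seq_ge (f : nat -> nat) : increasing_seq f -> forall n, (n <= f n)%N.
Proof.
move=> fi; elim=> // n IH; apply: (leq_ltn_trans IH).
by rewrite ltnNge; have := fi n.+1 n; rewrite !leEnat => ->; rewrite ltnn.
Qed.

(** Two Bolzano-Weierstrass extractions give a limit point. It is a singularity outside the loop,
    hence a lift of the saddle. The limit is taken in the plane itself, with translation [(0, 0)],
    so that [HH] has the same value there. *)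
Lemma trapped_HQ z : EE z = 0 -> bounded_above rho L z -> Qset (HH z).
Proof.
move=> z0 bz; have [vz|vz] := pselect (vf z = 0).
  by apply: saddle_Q; exact: vf_zero_saddle rho_ge0 rho_le1 _ vz z0.
have [m [T T0 [zone _]]] := trapped_zone rho_ge0 rho_le1 L_gt0 vL z0 vz bz.
have [M MP] := H_bounds_x rho_ge0 rho_le1 L_gt0 vL z0 m.
pose x n : R := (phi (T + n%:R) z).1; pose y n : R := (phi (T + n%:R) z).2.
have zn n : m%:~R + 1 / 6 <= y n <= m%:~R + 5 / 6 by apply: zone; rewrite lerDl.
have xM n : `|x n| <= M by apply: MP; have /andP[? ?] := zn n; rewrite -/(y n); apply/andP; split; lra.
have yM n : `|y n| <= `|m%:~R| + 1.
  have /andP[h1 h2] := zn n.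
  have := ler_norm (m%:~R : R); have := ler_norm (- m%:~R : R); rewrite normrN => h3 h4.
  by rewrite ler_norml; apply/andP; split; lra.
have [f fi fx] := bolzano_weierstrass (bounded_funP xM).
have [g gi gy] := bolzano_weierstrass (bounded_funP (fun n => yM (f n))).
have fge := increasing_seq_ge fi; have gge := increasing_seq_ge gi.
pose t (n : nat) : R := T + (f (g n))%:R.
have toy : t n @[n --> \oo] --> +oo.
  apply/cvgryPge => A; near=> n.
  have h : A <= n%:R by near: n; exact: nbhs_infty_ger.
  apply: (le_trans h); rewrite /t (le_trans (_ : _ <= (f (g n))%:R)) ?lerDr// ler_nat.
  exact: leq_trans (gge n) (fge (g n)).
have goo : g n @[n --> \oo] --> \oo.
  by apply/cvgnyPge => A; near=> n; apply: leq_trans (gge n); near: n; exact: nbhs_infty_ge.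
pose w : P := (limn (x \o f), limn ((y \o f) \o g)).
have uw : (phi (t n) z - intv R (0, 0)) @[n --> \oo] --> w.
  have -> : (fun n => phi (t n) z - intv R (0, 0)) = fun n => (x (f (g n)), y (f (g n))).
    apply/funext => n; rewrite (_ : intv R (0, 0) = 0)// subr0; exact: surjective_pairing.
  apply: cvg_to_pair; last exact: gy.
  by apply: (cvg_comp g (x \o f) goo); exact: fx.
have vw := trapped_limit z0 toy uw vz bz; have w0 := limit_EE z0 uw.
have <- : HH w = HH z.
  by apply: (seq_lim_eq HH_cont uw) => n; rewrite HH_sub /= HH_phi//; ring.
by apply: saddle_Q; exact: vf_zero_saddle rho_ge0 rho_le1 _ vw w0.
Unshelve. all: by end_near. Qed.

Lemma EE_int_y x (m : int) : EE (x, m%:~R) = 0.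
Proof.
apply: ebump_eq0 => -[[_ _ h _] _]; move: h; rewrite /cell /= intrKfloor subrr; lra.
Qed.

Lemma HH_int_y x (m : int) : HH (x, m%:~R) = - (pi * x) + rho * pi * m%:~R.
Proof.
have c1 : C2 (m%:~R : R) = 1 by rewrite -[m%:~R]addr0 C2_addint /C2 mulr0 cos0.
have s1 : S2 (m%:~R : R) = 0 by rewrite -[m%:~R]addr0 S2_addint /S2 mulr0 sin0.
by rewrite /HH /= c1 s1; ring.
Qed.

(** On an integer level [HH] is affine in [x] with slope [- pi], so the level and the value [h]
    determine the point. *)
Definition cross (h : R) (m : int) : P := (rho * m%:~R - h / pi, m%:~R).

Let pi_neq0 : pi != 0 :> R. Proof. by rewrite gt_eqF ?pi_gt0. Qed.

Lemma cross_uniq z (m : int) : z.2 = m%:~R -> z = cross (HH z) m.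
Proof.
move=> E; rewrite [LHS]surjective_pairing /cross E; congr pair.
rewrite [z in HH z]surjective_pairing E HH_int_y.
by move: pi pi_neq0 => p p0; field.
Qed.

Lemma crossing z (m : int) : EE z = 0 -> ~ bounded_above rho L z -> z.2 <= m%:~R ->
  exists2 t, 0 <= t & phi t z = cross (HH z) m.
Proof.
move=> z0 hQ zm.
have [t t0 tm] : exists2 t, 0 <= t & m%:~R <= (phi t z).2.
  apply: contrapT => H; apply: hQ; exists m%:~R => t t0.
  by rewrite leNgt; apply/negP => h; apply: H; exists t => //; exact: ltW.
have yc : continuous (fun t => (phi t z).2).
  by move=> s; exact: der_cont (phi_der2 L_gt0 vL z s).
have [||s] := @IVT R (fun t => (phi t z).2) 0 t m%:~R t0.
- exact: continuous_subspaceT.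
- by rewrite phi0 minEle maxEle (le_trans zm tm) zm tm.
rewrite in_itv /= => /andP[s0 _] sm; exists s => //.
by rewrite (cross_uniq sm) HH_phi.
Qed.

(** Reaching a distant level takes long: this turns large level numbers into large times. *)
Lemma y_speed z t : EE z = 0 -> `|(phi t z).2 - z.2| <= 3 * `|t|.
Proof.
move=> z0.
have := @der_lipschitz _ (fun t => (phi t z).2) (fun t => u2 (phi t z)) 3
  (fun s => phi_y rho_ge0 rho_le1 L_gt0 vL s z0) _ t 0.
rewrite phi0 subr0; apply => s.
have c1 := C2_ge (phi s z).2; have c2 := C2_le (phi s z).2.
have d1 := C2_ge (phi s z).1; have d2 := C2_le (phi s z).1.
rewrite /u2 (le_trans (ler_normB _ _))// normr1 normrM.
have : `|1 - C2 (phi s z).2| * `|C2 (phi s z).1| <= 2 * 1.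
  by apply: ler_pM => //; rewrite ler_norml; apply/andP; split; lra.
by lra.
Qed.

Hypothesis irr : irrational_slope rho.

(** The level [m] is met at abscissa [rho * m - HH z / pi], and these numbers are dense modulo 1. *)
Lemma omega_section z xi : EE z = 0 -> ~ bounded_above rho L z -> omega_limit phi z (xi, 0).
Proof.
move=> z0 hQ; apply: omega_intro => e T e0.
(* By the speed bound 3, no level from [m0] on is reached before time [T]. *)
pose m0 := Num.floor (z.2 + 3 * `|T|) + 1.
have m0E : z.2 + 3 * `|T| < m0%:~R by exact: floorD1_gt.
have [n _ [k kP]] := dense_multiples (rho * m0%:~R - HH z / pi) xi 0 irr e0.
have zm : z.2 <= (m0 + n%:Z)%:~R.
  rewrite intrD -pmulrn; have := normr_ge0 T; have := ler0n R n; lra.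
have [t t0 tE] := crossing z0 hQ zm.
exists t; last first.
  exists (k, m0 + n%:Z); rewrite tE /cross /=; split; last by rewrite subrr subr0 normr0 ltW.
  rewrite -normrN; move: kP; congr (`| _ | <= _).
  by rewrite intrD -pmulrn; ring.
have := y_speed t z0; rewrite tE /cross /= intrD -pmulrn (ger0_norm t0) => h.
have := ler_norm (m0%:~R + n%:R - z.2); have := ler0n R n; have := ler_norm T; lra.
Qed.

(* (x - n rho, - n) flows forward to (x, 0), so no analysis of trapping in the past is needed. *)
Lemma alpha_section x xi : ~ Qset (HH (x, 0)) -> alpha_limit phi (x, 0) (xi, 0).
Proof.
move=> hQ; apply: alpha_intro => e T e0.
have h0 : HH (x, 0) = - (pi * x).
  by rewrite -[0]/(0%:~R) HH_int_y mulr0 addr0.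
have [N NE] : exists N : nat, 3 * `|T| < N%:R.
  by exists (Num.truncn (3 * `|T|)).+1; exact: truncnS_gt.
have [n Nn [k kP]] := dense_multiples x xi N (irrational_slopeN irr) e0.
pose p : P := (x - rho * n%:R, (- n%:Z)%:~R).
have p0 : EE p = 0 by exact: EE_int_y.
have pH : HH p = HH (x, 0).
  by rewrite h0 /p HH_int_y mulrNz -pmulrn; ring.
have [||t t0 tE] := @crossing p 0 p0; first by move/(trapped_HQ p0); rewrite pH.
  by rewrite /p /= mulrNz -pmulrn oppr_le0.
have {}tE : phi t p = (x, 0).
  rewrite tE /cross pH h0; congr pair.
  by move: pi pi_neq0 => q q_neq0; field.
have tE' : phi (- t) (x, 0) = p by rewrite -tE -phiD addNr phi0.
exists (- t).
  have := y_speed t p0; rewrite tE /p /= (ger0_norm t0) mulrNz -pmulrn opprK add0r normr_nat => h.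
  have : N%:R <= n%:R :> R by rewrite ler_nat.
  by have := ler_norm (- T); rewrite normrN; lra.
exists (k, - n%:Z); rewrite tE' /p /=; split; last by rewrite subrr subr0 normr0 ltW.
rewrite -normrN; move: kP; congr (`| _ | <= _).
by ring.
Qed.

End Dynamics.

(** * Avoiding a countable set of values of [HH] *)

Section Countability.
Context {R : realType}.
Local Notation der f x d := (is_derive x (1 : R) (f : R -> R) (d : R)).

Lemma uncountable_itv (a b : R) : a < b -> ~ countable (`]a, b[%classic : set R).
Proof.
move=> ab /countable_lebesgue_measure0; rewrite lebesgue_measure_itv /= lte_fin ab.
by rewrite -EFinB => /eqP; rewrite eqe subr_eq0 gt_eqF.
Qed.

Lemma injective_preimage_countable (f : R -> R) (A Q : set R) : countable Q ->
  {in A &, injective f} -> (forall x, A x -> Q (f x)) -> countable A.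
Proof.
move=> Qc /inj_card_eq/eq_countable <- AQ.
by apply: sub_countable Qc; apply: subset_card_le => _ [x Ax <-]; exact: AQ.
Qed.

(** Otherwise [f] would map ]0, e[ injectively into [Q], and an interval would be countable. A zero
    derivative at 0 is allowed because a path may start where a component of the field vanishes. *)
Lemma decreasing_avoids (f df : R -> R) (e : R) (Q : set R) : countable Q -> 0 < e ->
  (forall s, 0 <= s <= e -> der f s (df s)) -> df 0 <= 0 -> (forall s, 0 < s <= e -> df s < 0) ->
  exists r, [/\ 0 < r < e, f r <= f 0 & ~ Q (f r)].
Proof.
move=> Qc e0 fD d0 dn; apply: contrapT => H.
have dle s : 0 <= s <= e -> df s <= 0.
  move=> /andP[]; rewrite le_eqVlt => /orP[/eqP <- //|s0 se].
  by rewrite ltW// dn// s0.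
apply: (@uncountable_itv 0 e) => //; apply: (injective_preimage_countable (f := f) Qc).
  have dec a b : 0 < a -> a < b -> b < e -> f b < f a.
    move=> a0 ab be; have [|c /andP[c1 c2] E] := der_MVT (ltW ab) (f := f) (df := df).
      by move=> x /andP[x1 x2]; apply: fD; apply/andP; split; lra.
    have : df c < 0 by apply: dn; apply/andP; split; lra.
    by move=> dc; rewrite -subr_lt0 E nmulr_rlt0// subr_gt0.
  move=> a b; rewrite !inE /= !in_itv /= => /andP[a0 ae] /andP[b0 be] fab.
  have [ab|ab|//] := ltgtP a b.
    by have := dec _ _ a0 ab be; rewrite fab ltxx.
  by have := dec _ _ b0 ab ae; rewrite fab ltxx.
move=> r; rewrite /= in_itv /= => /andP[r0 re]; apply: contrapT => Qr; apply: H.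
exists r; split=> //; first by rewrite r0.
rewrite -subr_le0; have [|c /andP[c1 c2] ->] := der_MVT (ltW r0) (f := f) (df := df).
  by move=> x /andP[x1 x2]; apply: fD; apply/andP; split; lra.
have dc : df c <= 0 by apply: dle; apply/andP; split; lra.
by rewrite mulr_le0_ge0// subr0 ltW.
Qed.
End Countability.

Section Perturbation.
Context {R : realType}.
Local Notation P := (R * R)%type.
Local Notation der f x d := (is_derive x (1 : R) (f : R -> R) (d : R)).
Variable rho : R.
Hypothesis rho_ge0 : 0 <= rho.
Hypothesis rho_le1 : rho <= 1.
Local Notation u1 := (u1 rho).
Local Notation HH := (HH rho).
Local Notation hs := (hs rho).
Local Notation EE := (EE rho).
Local Notation D0 := (D0 rho).
Local Notation Qset := (Qset rho).

Lemma Qset_countable : countable Qset.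
Proof.
have -> : Qset = (fun k : int * int => hs + pi * k.1%:~R + rho * pi * k.2%:~R) @` setT.
  rewrite eqEsubset; split=> h; first by move=> [i [j ->]]; exists (i, j).
  by move=> [[i j] _ <-]; exists i, j.
by apply: sub_countable (card_image_le _ _) _.
Qed.

Lemma Qset_int z k : Qset (HH (z + intv R k)) -> Qset (HH z).
Proof.
move=> [i [j E]]; exists (i + k.1), (j - k.2).
by move: E; rewrite HH_int !intrD mulrNz; lra.
Qed.

(** Were [EE (g r)] positive, [g r] would be in the box with [HH > hs]. At the start [HH] is no
    smaller, so [closed_box] would put [g 0] in [D0]. *)
Lemma perturb_path (g : R -> P) (df : R -> R) (e : R) : 0 < e ->
  - (1 / 6) <= (g 0).1 < 5 / 6 -> ~ D0 (g 0) ->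
  (forall s : R, 0 <= s <= e -> der (fun s => HH (g s)) s (df s)) ->
  df 0 <= 0 -> (forall s, 0 < s <= e -> df s < 0) ->
  (forall s, 0 < s < e -> [/\ - (1 / 6) <= (g s).1 < 5 / 6, 0 <= (g s).2 < 1 &
     inbox (g s) -> 1 / 6 <= (g 0).2 <= 5 / 6]) ->
  exists r, [/\ 0 < r < e, EE (g r) = 0 & ~ Qset (HH (g r))].
Proof.
move=> e0 /andP[x1 x2] nD D d0 dn box.
have [r [rI Hr Qr]] := decreasing_avoids Qset_countable e0 D d0 dn.
exists r; split=> //; have [b1 b2 b3] := box _ rI; rewrite EE_cell// ebump_eq0// => -[ib h].
have hw : hs < HH (g 0) by exact: lt_le_trans h Hr.
have xI : - (1 / 6) <= (g 0).1 <= 5 / 6 by rewrite x1 ltW.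
by apply: nD; split; [exact: closed_box xI (b3 ib) hw|exact: hw].
Qed.

Lemma cont_pos_box (f : P -> R) w : continuous f -> 0 < f w ->
  exists2 d, 0 < d & forall w', `|w'.1 - w.1| < d -> `|w'.2 - w.2| < d -> 0 < f w'.
Proof.
move=> fc fw; have N : nbhs w (fun w' => 0 < f w') by apply: (cvgr_gt (f w) (fc w)).
have /nbhs_ballP[d /= d0 dH] := N.
exists d => // w' h1 h2; apply: dH; split; rewrite /ball /=; rewrite distrC.
  exact: h1.
exact: h2.
Qed.

Let u2_cont : continuous (@u2 R). Proof. exact: smc_cont (@smc_u2 R). Qed.

Let half_min (a b c : R) : 0 < a -> 0 < b -> 0 < c ->
  exists d, [/\ 0 < d, d < a, d < b & d < c].
Proof.
move=> a0 b0 c0; exists (Num.min a (Num.min b c) / 2).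
have m0 : 0 < Num.min a (Num.min b c) by rewrite !lt_min a0 b0 c0.
have m1 : Num.min a (Num.min b c) <= a by rewrite ge_min lexx.
have m2 : Num.min a (Num.min b c) <= b by rewrite !ge_min lexx orbT.
have m3 : Num.min a (Num.min b c) <= c by rewrite !ge_min lexx !orbT.
by split; lra.
Qed.

(* Moving along a path on which HH decreases never enters the loop, where HH > hs. *)
Lemma perturb_u2_neq0 (x y e : R) : - (1 / 6) <= x < 5 / 6 -> 0 <= y < 1 -> ~ D0 (x, y) ->
  0 < e -> u2 (x, y) != 0 ->
  exists r, [/\ `|r| < e, EE (x + r, y) = 0 & ~ Qset (HH (x + r, y))].
Proof.
move=> /andP[x1 x2] yI nD e0; rewrite neq_lt => /orP[] u.
  have up : 0 < - u2 (x, y) by rewrite oppr_gt0.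
  have [|d d0 dH] := @cont_pos_box (fun w => - u2 w) (x, y) _ up.
    by move=> w; apply: continuousN; exact: u2_cont.
  (* On the left edge of the cell [u2 = 1 - (1 - C2 y) / 2 >= 0], against [u]; so there is room to
     move left. *)
  have x1' : 0 < x + 1 / 6.
    suff : x != - (1 / 6) by move=> xn; have := lt_neqAle (- (1 / 6)) x; rewrite eq_sym xn x1 /=; lra.
    apply/eqP => xE; move: u; rewrite /u2 /= xE C2N C2_sixth; have := C2_ge y; lra.
  have [b [b0 bd be bx]] := half_min d0 e0 x1'.
  have [||||||r [/andP[r0 rb] rE rQ]] := @perturb_path (fun s => (x - s, y))
    (fun s => pi * u2 (x - s, y)) b b0.
  - by rewrite /= subr0 x1 x2.
  - by rewrite /= subr0.
  - move=> s _; apply: (der_eq (der_HH rho (derD (der_cst x s) (derN (der_id s))) (der_cst y s))).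
    by rewrite /=; ring.
  - by rewrite subr0 pmulr_rle0 ?pi_gt0// ltW.
  - move=> s /andP[s0 sb]; rewrite pmulr_rlt0 ?pi_gt0// -oppr_gt0; apply: dH => /=.
      by rewrite addrAC subrr add0r normrN gtr0_norm//; lra.
    by rewrite subrr normr0.
  - move=> s /andP[s0 sb] /=; split => //; first by apply/andP; split; lra.
    by move=> [_ _ h1 h2]; apply/andP; split; apply: ltW.
  by exists (- r); split=> //; rewrite normrN gtr0_norm//; lra.
have [|d d0 dH] := @cont_pos_box u2 (x, y) _ u; first exact: u2_cont.
have x2' : 0 < 5 / 6 - x by lra.
have [b [b0 bd be bx]] := half_min d0 e0 x2'.
have [||||||r [/andP[r0 rb] rE rQ]] := @perturb_path (fun s => (x + s, y))
  (fun s => - (pi * u2 (x + s, y))) b b0.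
- by rewrite /= addr0 x1 x2.
- by rewrite /= addr0.
- move=> s _; apply: (der_eq (der_HH rho (derD (der_cst x s) (der_id s)) (der_cst y s))).
  by rewrite /=; ring.
- by rewrite addr0 oppr_le0 mulr_ge0 ?pi_ge0// ltW.
- move=> s /andP[s0 sb]; rewrite oppr_lt0 mulr_gt0 ?pi_gt0//; apply: dH => /=.
    by rewrite addrAC subrr add0r gtr0_norm//; lra.
  by rewrite subrr normr0.
- move=> s /andP[s0 sb] /=; split => //; first by apply/andP; split; lra.
  by move=> [_ _ h1 h2]; apply/andP; split; apply: ltW.
by exists r; split=> //; rewrite gtr0_norm//; lra.
Qed.

(** [u2 = 0] forces [C2 y <= 0], so [y] is in the middle band, where [u1] has the sign of
    [1 / 2 - y]: moving vertically away from [1 / 2] decreases [HH]. *)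
Lemma perturb_u2_eq0 (x y e : R) : - (1 / 6) <= x < 5 / 6 -> 0 <= y < 1 -> ~ D0 (x, y) ->
  0 < e -> u2 (x, y) = 0 ->
  exists r, [/\ `|r| < e, EE (x, y + r) = 0 & ~ Qset (HH (x, y + r))].
Proof.
move=> xI /andP[y1 y2] nD e0 u.
have cy : C2 y <= 0.
  move: u; rewrite /u2 /=; have := C2_le x; have := C2_le y => h1 h2 h3.
  have : (1 - C2 y) * C2 x <= (1 - C2 y) * 1 by rewrite ler_wpM2l// subr_ge0.
  lra.
have y1' : 1 / 6 < y.
  by rewrite ltNge; apply/negP => h; have := @C2_ge_half _ y => /(_ ltac:(apply/andP; split; lra)); lra.
have y2' : y < 5 / 6.
  rewrite ltNge; apply/negP => h; have := @C2_ge_half _ (1 - y) => /(_ ltac:(apply/andP; split; lra)).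
  by rewrite C2flip; lra.
have u1n s : 1 / 6 <= s <= 5 / 6 -> s != 1 / 2 -> u1 (x, s) != 0.
  move=> sI sn; apply/eqP => /(u1_eq0 rho_ge0 rho_le1) /= /(_ (C2_le_half sI)) cs.
  by move: sn; rewrite (C2_eqN1 _ cs) ?eqxx//; case/andP: sI => *; apply/andP; split; lra.
have [yh|yh] := leP (1 / 2) y.
  have y2'' : 0 < 5 / 6 - y by lra.
  have [b [b0 be bx _]] := half_min e0 y2'' e0.
  have [||||||r [/andP[r0 rb] rE rQ]] := @perturb_path (fun s => (x, y + s))
    (fun s => pi * u1 (x, y + s)) b b0.
  - by [].
  - by rewrite /= addr0.
  - move=> s _; apply: (der_eq (der_HH rho (der_cst x s) (derD (der_cst y s) (der_id s)))).
    by rewrite /=; ring.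
  - by rewrite addr0 pmulr_rle0 ?pi_gt0// u1_le0//; apply/andP; split; lra.
  - move=> s /andP[s0 sb]; rewrite pmulr_rlt0 ?pi_gt0// lt_neqAle u1n ?u1_le0//=.
      by apply/andP; split; lra.
      by apply/andP; split; lra.
      by rewrite gt_eqF//; lra.
  - by move=> s /andP[s0 sb] /=; split => //; [apply/andP; split; lra|move=> _; apply/andP; split; lra].
  by exists r; split=> //; rewrite gtr0_norm//; lra.
have y1'' : 0 < y - 1 / 6 by lra.
have [b [b0 be bx _]] := half_min e0 y1'' e0.
have [||||||r [/andP[r0 rb] rE rQ]] := @perturb_path (fun s => (x, y - s))
  (fun s => - (pi * u1 (x, y - s))) b b0.
- by [].
- by rewrite /= subr0.
- move=> s _; apply: (der_eq (der_HH rho (der_cst x s) (derD (der_cst y s) (derN (der_id s))))).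
  by rewrite /=; ring.
- by rewrite subr0 oppr_le0 mulr_ge0 ?pi_ge0// u1_ge0//; apply/andP; split; lra.
- move=> s /andP[s0 sb]; rewrite oppr_lt0 mulr_gt0 ?pi_gt0// lt_neqAle eq_sym u1n ?u1_ge0//=.
    by apply/andP; split; lra.
    by apply/andP; split; lra.
    by rewrite lt_eqF//; lra.
- by move=> s /andP[s0 sb] /=; split => //; [apply/andP; split; lra|move=> _; apply/andP; split; lra].
by exists (- r); split=> //; rewrite normrN gtr0_norm//; lra.
Qed.

Lemma perturb w e : EE w = 0 -> 0 < e ->
  exists w', [/\ `|w'.1 - w.1| < e, `|w'.2 - w.2| < e, EE w' = 0 & ~ Qset (HH w')].
Proof.
move=> w0 e0; pose k := cell w.
have [xI yI] := cell_box w; rewrite -/k in xI yI.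
have nD : ~ D0 (w - intv R k) by move/D0_EE_gt0; rewrite -intvN EE_int w0 ltxx.
have back p : EE p = 0 -> ~ Qset (HH p) -> EE (p + intv R k) = 0 /\ ~ Qset (HH (p + intv R k)).
  by move=> p0 pQ; split; [rewrite EE_int|move/Qset_int].
move: xI yI nD; rewrite [w - _]surjective_pairing.
set x := (w - intv R k).1; set y := (w - intv R k).2 => xI yI nD.
have [u|u] := eqVneq (u2 (x, y)) 0.
  have [r [re rE rQ]] := perturb_u2_eq0 xI yI nD e0 u; have [h1 h2] := back _ rE rQ.
  exists ((x, y + r) + intv R k); split=> //.
    by rewrite (_ : _ - _ = 0) ?normr0// /x /=; ring.
  by rewrite (_ : _ - _ = r)// /y /=; ring.
have [r [re rE rQ]] := perturb_u2_neq0 xI yI nD e0 u; have [h1 h2] := back _ rE rQ.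
exists ((x + r, y) + intv R k); split=> //.
  by rewrite (_ : _ - _ = r)// /x /=; ring.
by rewrite (_ : _ - _ = 0) ?normr0// /y /=; ring.
Qed.

End Perturbation.

Lemma int_lt1_eq0 (R : realType) (i : int) : -1 < (i%:~R : R) -> (i%:~R : R) < 1 -> i = 0.
Proof.
move=> i1 i2; have {i2} : i < 1 by rewrite -(ltr_int R).
have {i1} : -1 < i by rewrite -(ltr_int R).
by clear; lia.
Qed.

(** * Recurrent trajectories and the quasi-minimal set *)

Section Recurrence.
Context {R : realType}.
Local Notation P := (R * R)%type.
Variable rho : R.
Hypothesis rho_ge0 : 0 <= rho.
Hypothesis rho_le1 : rho <= 1.
Local Notation u1 := (u1 rho).
Local Notation HH := (HH rho).
Local Notation EE := (EE rho).
Local Notation vf := (vf rho).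
Local Notation D0 := (D0 rho).
Variable L : R.
Hypothesis L_gt0 : 0 < L.
Hypothesis vL : forall i (z w : P),
  `|Defs.comp i (vf z) - Defs.comp i (vf w)| <= L * (`|z.1 - w.1| + `|z.2 - w.2|).
Local Notation phi := (lflow vf L).

Let phiD s t z : phi (s + t) z = phi s (phi t z). Proof. exact: phiD. Qed.
Let phi0 z : phi 0 z = z. Proof. exact: phi0. Qed.
Let phi_int t z k : phi t (z + intv R k) = phi t z + intv R k. Proof. exact: phi_int. Qed.
Let phi_cont t : continuous (phi t). Proof. exact: lflow_cont. Qed.
Let EE_phi t z : EE z = 0 -> EE (phi t z) = 0. Proof. exact: EE_eq0_phi. Qed.
Let HH_phi t z : EE z = 0 -> HH (phi t z) = HH z. Proof. exact: EE_eq0_H. Qed.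
Let EE_cont : continuous EE. Proof. exact: locally_smc_cont (locally_smc_EE rho). Qed.
Let HH_cont : continuous HH. Proof. exact: smc_cont (smc_HH rho). Qed.
Local Notation Qset := (Qset rho).
Local Notation bounded_above := (bounded_above rho L).

Definition conservative : set P := [set z | EE z = 0].

Lemma conservative_closed : closed conservative.
Proof.
have -> : conservative = EE @^-1` [set 0] by [].
by apply: closed_comp => [z _|]; [exact: EE_cont|exact: closed_eq].
Qed.

Lemma limit_push s k0 z (t : nat -> R) k w :
  (phi (t n) z - intv R (k n)) @[n --> \oo] --> w ->
  (phi (s + t n) z - intv R ((k n).1 - k0.1, (k n).2 - k0.2)) @[n --> \oo] --> phi s w + intv R k0.
Proof.
move=> uw.
have -> : (fun n => phi (s + t n) z - intv R ((k n).1 - k0.1, (k n).2 - k0.2)) =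
    fun n => phi s (phi (t n) z - intv R (k n)) + intv R k0.
  apply/funext => n; rewrite phi_sub// -phiD.
  by apply: injective_projections => /=; rewrite intrD mulrNz; ring.
apply: cvgD; last exact: cvg_cst.
by apply: (continuous_cvg _ (@phi_cont s w)).
Qed.

Lemma omega_push s k0 z w : omega_limit phi z w -> omega_limit phi z (phi s w + intv R k0).
Proof.
move=> [t [k [toy uw]]]; exists (fun n => s + t n), (fun n => ((k n).1 - k0.1, (k n).2 - k0.2)).
split; last exact: limit_push.
apply/cvgryPge => A; move/cvgryPge: toy => /(_ (A - s)); apply: filterS => n; lra.
Qed.

Lemma alpha_push s k0 z w : alpha_limit phi z w -> alpha_limit phi z (phi s w + intv R k0).
Proof.
move=> [t [k [toy uw]]]; exists (fun n => s + t n), (fun n => ((k n).1 - k0.1, (k n).2 - k0.2)).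
split; last exact: limit_push.
apply/cvgrNyPle => A; move/cvgrNyPle: toy => /(_ (A - s)); apply: filterS => n; lra.
Qed.

Lemma omega_closure z : omega_limit phi z `<=` closure (trajectory phi z).
Proof.
move=> w [t [k [_ uw]]]; apply: closure_seq uw => n.
by exists (t n), (- (k n).1, - (k n).2); rewrite intvN.
Qed.

Hypothesis irr : irrational_slope rho.

Definition section_orbits : set P := [set w | exists s xi k, w = phi s (xi, 0) + intv R k].

Lemma unbounded_section z : EE z = 0 -> ~ bounded_above z -> section_orbits z.
Proof.
move=> z0 zb; have [|t _ tE] := crossing rho_ge0 rho_le1 L_gt0 vL (m := Num.ceil z.2) z0 zb.
  exact: Num.Theory.ceil_ge.
exists (- t), (rho * (Num.ceil z.2)%:~R - HH z / pi), (0, Num.ceil z.2).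
rewrite -phi_int (_ : _ + intv R _ = phi t z) -?phiD ?addNr ?phi0// tE /cross.
by apply: injective_projections => /=; rewrite ?addr0 ?add0r.
Qed.

(** Arbitrarily close to each point there is one with [HH] outside [Qset]; its trajectory is
    unbounded above and therefore meets the section. *)
Lemma section_orbits_dense : conservative `<=` closure section_orbits.
Proof.
move=> w w0 B /nbhs_ballP[e /= e0 eB].
have [w' [h1 h2 w'0 w'Q]] := perturb rho_ge0 rho_le1 w0 e0.
exists w'; split; last by apply: eB; split; rewrite /ball /= distrC.
by apply: unbounded_section => // /(trapped_HQ rho_ge0 rho_le1 L_gt0 vL w'0).
Qed.

Lemma unbounded_omega z : EE z = 0 -> ~ bounded_above z -> section_orbits `<=` omega_limit phi z.
Proof.
move=> z0 zb _ [s [xi [k ->]]]; apply: omega_push.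
exact: (omega_section rho_ge0 rho_le1 L_gt0 vL irr xi z0 zb).
Qed.

(** One inclusion for two purposes: a non-trivial recurrent trajectory has all of [conservative] in
    its closure, and no smaller closed set attracts an unbounded trajectory. *)
Lemma unbounded_closed z (A : set P) : EE z = 0 -> ~ bounded_above z -> closed A ->
  omega_limit phi z `<=` A -> conservative `<=` A.
Proof.
move=> z0 zb cA zA; apply: (subset_trans section_orbits_dense).
rewrite [X in _ `<=` X](iffLR (closure_id _) cA); apply: closure_subset.
exact: subset_trans (unbounded_omega z0 zb) zA.
Qed.

(** Inside the loop [HH] increases strictly at a non-singular point and never falls again, so the
    trajectory cannot return there. *)
Lemma recurrent_conservative z : omega_limit phi z z -> vf z <> 0 -> EE z = 0.
Proof.
move=> [t [k [toy uw]]] vz; apply/eqP; rewrite eq_le EE_ge0 andbT leNgt; apply/negP => z0.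
pose k0 := cell z; pose w := z - intv R k0.
have wD : D0 w by exact: EE_gt0_D0.
have phiw s : phi s w = phi s z - intv R k0 by rewrite phi_sub.
have lim : (phi (t n) w - intv R (k n)) @[n --> \oo] --> w.
  have -> : (fun n => phi (t n) w - intv R (k n)) =
      fun n => phi (t n) z - intv R (k n) - intv R k0.
    by apply/funext => n; rewrite phiw addrAC.
  by apply: cvgB => //; exact: cvg_cst.
have inD s : D0 (phi s w) by exact: D0_inv.
(* The point and its translate are both in the open box, whose sides have length at most 1; so the
   translation is 0 and [HH] is not shifted. *)
have evk : \forall n \near \oo, k n = (0, 0).
  have : \forall n \near \oo, D0 (phi (t n) w - intv R (k n)) by exact: lim (D0_open wD).
  apply: filterS => n -[[a1 a2 a3 a4] _]; have [[b1 b2 b3 b4] _] := inD (t n).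
  move: a1 a2 a3 a4; case: (k n) => i j /= a1 a2 a3 a4.
  by congr pair; apply: int_lt1_eq0; lra.
have uw0 : vf w <> 0 by rewrite /w -intvN vf_int.
have pos : 0 < pi * EE (phi 0 w) * (u1 (phi 0 w) ^+ 2 + u2 (phi 0 w) ^+ 2).
  have wE : 0 < EE w by exact: (D0_EE_gt0 wD).
  rewrite phi0; apply: mulr_gt0; first by apply: mulr_gt0 => //; exact: pi_gt0.
  rewrite lt_neqAle addr_ge0 ?sqr_ge0// andbT eq_sym paddr_eq0 ?sqr_ge0// !sqrf_eq0.
  by apply/negP => /andP[/eqP h1 /eqP h2]; apply: uw0; apply/vf_eq0.
have [e e0 eH] := der_gt0_local (phi_derH L_gt0 vL w 0) pos.
have h1 : HH w < HH (phi (e / 2) w).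
  rewrite -[w in HH w]phi0; apply: (eH _ _).1; last by lra.
  by rewrite subr0 gtr0_norm; lra.
have : HH (phi (e / 2) w) <= HH w; last by rewrite leNgt h1.
rewrite -lerN2; apply: (@seq_lim_le _ (fun p => - HH p) _ _ _ _ lim).
  by move=> p; apply: continuousN; exact: HH_cont.
near=> n; rewrite lerN2.
have -> : k n = (0, 0) by near: n.
rewrite (_ : intv R (0, 0) = 0)// subr0; apply: (phi_H_ge L_gt0 vL).
by near: n; move/cvgryPge : toy; exact.
Unshelve. all: by end_near. Qed.

Lemma recurrent_unbounded z : omega_limit phi z z -> vf z <> 0 -> EE z = 0 -> ~ bounded_above z.
Proof.
move=> [t [k [toy uw]]] vz z0 zb; apply: (vz).
exact: (trapped_limit rho_ge0 rho_le1 L_gt0 vL z0 toy uw vz zb).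
Qed.

(** A closed trajectory accumulates on itself, so it lies outside the loop and would be unbounded.
    But conservation of [HH] and irrationality give [k.2 = 0], so it would come back to an integer
    level already crossed upwards. *)
Lemma no_periodic_point z : ~ periodic_point vf phi z.
Proof.
move=> [/eqP vz [T [T0 [k kE]]]].
have step : phi T z = z + intv R k by rewrite -kE addrC subrK.
have iterE n : phi (n%:R * T) z - intv R (n%:Z * k.1, n%:Z * k.2) = z.
  elim: n => [|n IH].
    by rewrite !mul0r phi0 (_ : intv R _ = 0) ?subr0.
  rewrite (_ : n.+1%:R * T = T + n%:R * T) ?phiD; last by rewrite -natr1; ring.
  have -> : phi (n%:R * T) z = z + intv R (n%:Z * k.1, n%:Z * k.2) by rewrite -[in RHS]IH subrK.
  rewrite phi_int step; apply: injective_projections => /=; rewrite -addn1 PoszD !mulrDl !intrD; ring.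
have zo : omega_limit phi z z.
  exists (fun n => n%:R * T), (fun n => (n%:Z * k.1, n%:Z * k.2)); split.
    apply/cvgryPge => A; near=> n; rewrite -ler_pdivrMr//.
    by near: n; exact: nbhs_infty_ger.
  rewrite (_ : (fun n => _) = fun=> z); last by apply/funext => n; exact: iterE.
  exact: cvg_cst.
have z0 := recurrent_conservative zo vz; have zb := recurrent_unbounded zo vz z0.
have k20 : k.2 = 0.
  apply/eqP; apply: contrapT => /negP k2.
  have := HH_phi T z0; rewrite step HH_int => h; have /eqP := irr k.1 k2; apply.
  apply: (mulfI (lt0r_neq0 (pi_gt0 R))); lra.
have [|t _ tE] := crossing rho_ge0 rho_le1 L_gt0 vL (m := Num.ceil z.2) z0 zb.
  exact: Num.Theory.ceil_ge.
have tm : (Num.ceil z.2)%:~R <= (phi t z).2 by rewrite tE.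
have tT : t < t + T by rewrite ltrDl.
have := y_ge_int rho_ge0 rho_le1 L_gt0 vL z0 tm tT.
by rewrite phiD step phi_int /= k20 addr0 tE ltxx.
Unshelve. all: by end_near. Qed.

Lemma nontrivial_recurrent_conservative z : nontrivial_recurrent vf phi z ->
  EE z = 0 /\ ~ bounded_above z.
Proof.
move=> [rz [/eqP vz _]].
have [|zo _] := rz z; first by exists 0, (0, 0); rewrite phi0 (_ : intv R _ = 0) ?addr0.
have z0 := recurrent_conservative zo vz; split=> //; exact: recurrent_unbounded.
Qed.

Lemma quasi_minimalE z : nontrivial_recurrent vf phi z -> quasi_minimal_set_of phi z = conservative.
Proof.
move=> /nontrivial_recurrent_conservative[z0 zb]; rewrite eqEsubset; split.
  rewrite [X in _ `<=` X](iffLR (closure_id _) conservative_closed); apply: closure_subset.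
  by move=> _ [t [k ->]]; rewrite /conservative /= EE_int EE_phi.
by apply: (unbounded_closed z0 zb); [exact: closed_closure|exact: omega_closure].
Qed.

Lemma u2_section (x : R) : u2 (x, 0) = 1.
Proof.
have c0 : C2 0 = 1 :> R by rewrite /C2 mulr0 cos0.
by rewrite /u2 /= c0 subrr mul0r subr0.
Qed.

Lemma nontrivial_recurrent_exists : exists z, nontrivial_recurrent vf phi z.
Proof.
(* On the section [HH] has constant derivative [- pi], so some point of it has a value outside
   [Qset]. *)
have [|||r [_ _ rQ]] := @decreasing_avoids _ (fun s => HH (s, 0)) (fun=> - pi) 1 Qset
    (Qset_countable rho) ltr01.
- move=> s _; apply: (der_eq (der_HH rho (der_id s) (der_cst 0 s))).
  by rewrite u2_section; ring.
- by rewrite oppr_le0 pi_ge0.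
- by move=> _ _; rewrite oppr_lt0 pi_gt0.
pose z : P := (r, 0); have z0 : EE z = 0 by exact: (EE_int_y rho r 0).
have zb : ~ bounded_above z by move/(trapped_HQ rho_ge0 rho_le1 L_gt0 vL z0).
have zN : vf z <> 0 by move/vf_eq0 => [_]; rewrite u2_section => /eqP; rewrite oner_eq0.
exists z; split; last by split; [exact/eqP|exact: no_periodic_point].
move=> _ [t [k ->]]; split.
  by apply: omega_push; exact: (omega_section rho_ge0 rho_le1 L_gt0 vL irr r z0 zb).
by apply: alpha_push; exact: (alpha_section rho_ge0 rho_le1 L_gt0 vL irr r rQ).
Qed.

Lemma conservative_realm : conservative `<=` realm phi conservative.
Proof. by move=> z z0 w [t [k [_ uw]]]; exact: (limit_EE rho_ge0 rho_le1 L_gt0 vL z0 uw). Qed.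

End Recurrence.

(** * The attractor *)

Lemma smc_measurable (R : realType) (f : R * R -> R) : smc f -> measurable_fun setT f.
Proof.
elim=> [a|||g h _ gm _ hm|g h _ gm _ hm|g h gD _ hm].
- exact: measurable_cst.
- exact: measurable_fst.
- exact: measurable_snd.
- exact: measurable_realfun.measurable_funD.
- exact: measurable_realfun.measurable_funM.
- apply: (@measurableT_comp _ _ _ _ _ _ (g 0%N) setT h) => //.
  by apply: measurable_realfun.continuous_measurable_fun => x; exact: der_cont (gD 0%N x).
Qed.

Section Attractor.
Context {R : realType}.
Local Notation P := (R * R)%type.
Variable rho : R.
Hypothesis rho_ge0 : 0 <= rho.
Hypothesis rho_le1 : rho <= 1.
Local Notation u1 := (u1 rho).
Local Notation HH := (HH rho).
Local Notation EE := (EE rho).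
Local Notation vf := (vf rho).
Variable L : R.
Hypothesis L_gt0 : 0 < L.
Hypothesis vL : forall i (z w : P),
  `|Defs.comp i (vf z) - Defs.comp i (vf w)| <= L * (`|z.1 - w.1| + `|z.2 - w.2|).
Local Notation phi := (lflow vf L).

Local Notation Qset := (Qset rho).
Local Notation bounded_above := (bounded_above rho L).
Local Notation conservative := (conservative rho).
Hypothesis irr : irrational_slope rho.

(** A rectangle below the box, so [EE = 0] on it, and with [u1 > 0], so that [HH] is strictly
    increasing in [y]. *)
Definition strip : set P := `]0, 1 / 2[%classic `*` `]0, 1 / 6[%classic.

Lemma stripP x y : strip (x, y) <-> 0 < x < 1 / 2 /\ 0 < y < 1 / 6.
Proof. by rewrite /strip /= !in_itv. Qed.

Lemma strip_conservative : strip `<=` conservative.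
Proof.
move=> [x y] /stripP[/andP[x0 x1] /andP[y0 y1]].
rewrite /conservative /= EE_cell/= ?ebump_eq0//; try by apply/andP; split; lra.
by move=> [[_ _ /= h _] _]; lra.
Qed.

Lemma strip_measurable : measurable strip.
Proof. by apply: measurableX. Qed.

Lemma leb2_strip : (0 < leb2 strip)%E.
Proof.
rewrite /leb2 product_measure1E//.
have E (a : R) : 0 < a -> lebesgue_measure (`]0, a[%classic : set R) = a%:E.
  by move=> a0; rewrite lebesgue_measure_itv /= lte_fin a0 -EFinB subr0.
by apply: mule_gt0; rewrite [ltRHS]E ?lte_fin ?divr_gt0.
Qed.

Lemma strip_open : open strip.
Proof.
rewrite openE => -[x y] [/= xI yI].
exists (`]0, 1 / 2[%classic, `]0, 1 / 6[%classic) => //.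
by split; apply: open_nbhs_nbhs; split => //; exact: interval_open.
Qed.

Definition strip_resonant : set P := strip `&` HH @^-1` Qset.

(** [HH] is injective on each vertical slice, so the slice meets the preimage of [Qset] in a
    countable set; the product measure integrates these null slices. *)
Lemma strip_resonant_null : (@leb2 R).-negligible strip_resonant.
Proof.
exists strip_resonant; split=> //.
  apply: measurableI; first exact: strip_measurable.
  rewrite -[X in measurable X]setTI; apply: (smc_measurable (smc_HH rho)) => //.
  by apply: countable_measurable (Qset_countable rho) => t; exact: measurable_set1.
rewrite /leb2 /product_measure1; apply: integral0_eq => x _ /=.
apply: countable_lebesgue_measure0.
apply: (injective_preimage_countable (f := fun y => HH (x, y)) (Qset_countable rho)); last first.
  by move=> y; rewrite /xsection /= inE => -[].
have inc a b : strip (x, a) -> strip (x, b) -> a < b -> HH (x, a) < HH (x, b).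
  move=> /stripP[xI /andP[a0 a1]] /stripP[_ /andP[b0 b1]] ab.
  have [|c /andP[c1 c2] E] := der_MVT (ltW ab) (f := fun y => HH (x, y)) (df := fun y => pi * u1 (x, y)).
    move=> y _; apply: (der_eq (der_HH rho (der_cst x y) (der_id y))).
    by rewrite /=; ring.
  rewrite -subr_gt0 E; apply: mulr_gt0; last by rewrite subr_gt0.
  rewrite mulr_gt0 ?pi_gt0// /u1 /= ltr_pwDl//.
    rewrite mulr_gt0//; first by apply: S2_gt0; apply/andP; split; lra.
    by apply: lt_le_trans (bb_ge x).
  by rewrite mulr_ge0//; have := C2_ge c; lra.
move=> a b; rewrite /xsection !inE /= !inE => -[sa _] [sb _] fab.
have [ab|ab|//] := ltgtP a b.
  by have := inc _ _ sa sb ab; rewrite fab ltxx.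
by have := inc _ _ sb sa ab; rewrite fab ltxx.
Qed.

Lemma strip_not_null : ~ (@leb2 R).-negligible strip.
Proof.
move=> [B [mB B0 sB]].
have := leb2_strip; rewrite ltNge => /negP; apply; rewrite -B0.
by apply: le_measure => //; rewrite inE//; exact: strip_measurable.
Qed.

(** A non-resonant point of [strip] has an unbounded trajectory, which accumulates on all of
    [conservative]; so it is not in the realm of a smaller closed set. The difference of the two
    realms then contains [strip] up to a null set. *)
Lemma conservative_attractor : attractor phi conservative.
Proof.
split; [|split].
- by split; [exact: conservative_closed|move=> z k; rewrite /conservative /= EE_int].
- move=> [B [mB B0 sB]]; apply: strip_not_null; exists B; split=> //.
  apply: subset_trans sB; apply: subset_trans strip_conservative _.
  exact: (conservative_realm rho_ge0 rho_le1 L_gt0 vL).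
move=> [A' [[cA' _] [[sA' nA'] ae]]]; apply: strip_not_null.
have : (@leb2 R).-negligible (((realm phi A' `\` realm phi conservative) `|`
    (realm phi conservative `\` realm phi A')) `|` strip_resonant).
  exact: (@negligibleU _ _ _ (lebesgue_measure \x lebesgue_measure)%E _ _ ae strip_resonant_null).
move=> [B [mB B0 sB]]; exists B; split=> //; apply: subset_trans sB => z sz.
have z0 := strip_conservative sz.
have [zQ|zQ] := pselect (Qset (HH z)); first by right.
left; right; split; first exact: (conservative_realm rho_ge0 rho_le1 L_gt0 vL).
move=> zA'; apply: nA'.
apply: (unbounded_closed rho_ge0 rho_le1 L_gt0 vL irr z0 _ cA' zA').
by move/(trapped_HQ rho_ge0 rho_le1 L_gt0 vL z0).
Qed.

Lemma conservative_realm_interior : nonempty_interior (realm phi conservative).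
Proof.
exists (1 / 4, 1 / 12); apply: (@interiorS _ strip).
  apply: subset_trans strip_conservative _.
  exact: (conservative_realm rho_ge0 rho_le1 L_gt0 vL).
rewrite (interior_id strip).1; last exact: strip_open.
by apply/stripP; split; apply/andP; split; lra.
Qed.

End Attractor.

(** * Singularities and rotation number *)

Lemma det_mx2 (A : comNzRingType) (M : 'M[A]_2) : \det M = M 0 0 * M 1 1 - M 0 1 * M 1 0.
Proof.
rewrite (expand_det_row _ 0) !big_ord_recl big_ord0 addr0 /cofactor !det_mx11 !mxE /=.
rewrite (_ : lift 0 0 = 1); last exact: val_inj.
rewrite (_ : lift 1 0 = 0); last exact: val_inj.
by rewrite /= expr0 expr1 mul1r mulN1r mulrN.
Qed.

Section Eigenvalues.
Context {R : realType}.

(** Real and imaginary part of the characteristic polynomial at [p + i q]. *)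
Lemma eigenvalueCP (M : 'M[R]_2) (p q : R) : eigenvalueC M (complex.Complex p q) <->
  (p - M 0 0) * (p - M 1 1) - q ^+ 2 - M 0 1 * M 1 0 = 0 /\
  q * (2 * p - (M 0 0 + M 1 1)) = 0.
Proof.
rewrite /eigenvalueC (_ : map_poly _ _ = map_poly (real_complex R) (char_poly M))//.
rewrite /char_poly det_mx2 /char_poly_mx !mxE /= !mulr1n !mulr0n !sub0r.
rewrite rmorphB !rmorphM !rmorphB !rmorphN /= !map_polyX !map_polyC /= rootE !hornerE /=.
simpc; rewrite eq_complex /= expr2; split=> [/andP[/eqP h1 /eqP h2]|[h1 h2]].
  by split=> //; rewrite -h2; ring.
by apply/andP; split; apply/eqP => //; rewrite -[RHS]h2; ring.
Qed.

(** A non-real eigenvalue has half the trace as its real part; a real one [p >= 0] would make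
    [p ^+ 2 - p * trace + det] positive. *)
Lemma eigenvalueC_stable (M : 'M[R]_2) l : M 0 0 + M 1 1 < 0 ->
  0 < M 0 0 * M 1 1 - M 0 1 * M 1 0 -> eigenvalueC M l -> complex.Re l < 0.
Proof.
case: l => p q tr det /eigenvalueCP[h1 /eqP]; rewrite mulf_eq0 => /orP[/eqP q0|/eqP h2] /=; last by lra.
move: h1; rewrite q0 => h1; rewrite ltNge; apply/negP => p0.
have := mulr_ge0 p0 p0; have : p * (M 0 0 + M 1 1) <= 0 by rewrite mulr_ge0_le0// ltW.
by move=> ? ?; lra.
Qed.

(** With zero diagonal the eigenvalues are plus and minus the square root of [M 0 1 * M 1 0]. *)
Lemma eigenvalueC_hyperbolic (M : 'M[R]_2) : M 0 0 = 0 -> M 1 1 = 0 -> 0 < M 0 1 * M 1 0 ->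
  [/\ forall l, eigenvalueC M l -> complex.Re l != 0,
      exists l, eigenvalueC M l /\ complex.Re l < 0 &
      exists l, eigenvalueC M l /\ 0 < complex.Re l].
Proof.
move=> a0 d0 c0; have s0 : 0 < Num.sqrt (M 0 1 * M 1 0) by rewrite sqrtr_gt0.
have sE : Num.sqrt (M 0 1 * M 1 0) ^+ 2 = M 0 1 * M 1 0 by rewrite sqr_sqrtr// ltW.
split.
- move=> [p q] /eigenvalueCP[]; rewrite a0 d0 /= => h1 h2; apply/eqP => p0.
  by have := sqr_ge0 q; move: h1; rewrite p0; lra.
- exists (complex.Complex (- Num.sqrt (M 0 1 * M 1 0)) 0); split; last by rewrite /= oppr_lt0.
  by apply/eigenvalueCP; rewrite a0 d0; split; lra.
exists (complex.Complex (Num.sqrt (M 0 1 * M 1 0)) 0); split=> //.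
by apply/eigenvalueCP; rewrite a0 d0; split; lra.
Qed.

End Eigenvalues.

Section Singularities.
Context {R : realType}.
Local Notation P := (R * R)%type.
Variable rho : R.
Hypothesis rho_ge0 : 0 <= rho.
Hypothesis rho_le1 : rho <= 1.
Local Notation u1 := (u1 rho).
Local Notation EE := (EE rho).
Local Notation vf := (vf rho).

Lemma derdir_eq (f : P -> R) z v a b : is_derive z v f a -> a = b -> is_derive z v f b.
Proof. by move=> D <-. Qed.

Lemma u1_dir (z : P) b : is_derive z (edir R b) u1
  (if b then 2 * pi * C2 z.2 * bb z.1 - rho * (2 * pi * S2 z.2) else S2 z.2 * (2 * pi * C2 z.1)).
Proof.
have d1 := derdir_fst z b; have d2 := derdir_snd z b.
have dS := derdir_comp d2 (der_S2 z.2); have dC := derdir_comp d2 (der_C2 z.2).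
have db := derdir_comp d1 (derD (der_cst 4 z.1) (der_S2 z.1)).
have dr := derdir_comp d2 (derM (der_cst rho z.2) (derD (der_cst 1 z.2) (der_C2 z.2))).
have D := is_deriveD (derdirM dS db) dr.
apply: (derdir_eq D).
by case: b {d1 d2 dS dC db dr D}; rewrite ?/bb /=; ring.
Qed.

Lemma u2_dir (z : P) b : is_derive z (edir R b) (@u2 R)
  (if b then - (2 * pi * S2 z.2) * C2 z.1 else (1 - C2 z.2) * (2 * pi * S2 z.1)).
Proof.
have d1 := derdir_fst z b; have d2 := derdir_snd z b.
have dC := derdir_comp d2 (derD (der_cst (-1) z.2) (der_C2 z.2)).
have db := derdir_comp d1 (der_C2 z.1).
have D := is_deriveD (is_derive_cst (1 : R) z (edir R b)) (derdirM dC db).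
have E : (@u2 R) = (fun=> 1) + (fun w : P => (-1 + C2 w.2) * C2 w.1).
  by apply/funext => w; rewrite /u2 /= fctE; ring.
rewrite E; apply: (derdir_eq D).
by case: b {d1 d2 dC db D}; rewrite /=; ring.
Qed.

(** At a common zero the derivatives of [EE] are multiplied by [u1] or [u2], that is by 0, so they
    can remain unknown. *)
Lemma jacobian_zero (z : P) : u1 z = 0 -> u2 z = 0 ->
  let J := Defs.jacobian vf z in
  [/\ J 0 0 = - (EE z * (4 * pi * S2 z.1)), J 0 1 = - (2 * pi * bb z.1),
      J 1 0 = 4 * pi * S2 z.1 & J 1 1 = - (EE z * (2 * pi * bb z.1))].
Proof.
move=> h1 h2; have [c2 c1] := u_eq0 rho_ge0 rho_le1 h1 h2.
have s2 : S2 z.2 = 0.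
  by have := C2S2 z.2; rewrite c2 => h; apply/eqP; rewrite -sqrf_eq0; apply/eqP; lra.
have dE b : exists d, is_derive z (edir R b) EE d.
  exists ('D_(edir R b) EE z); apply: derivableP.
  exact: locally_smc_derivable (locally_smc_EE rho).
have row0 b : 'D_(edir R b) (fun w => Defs.comp false (vf w)) z =
    (if b then - (2 * pi * bb z.1) else - (EE z * (4 * pi * S2 z.1))).
  have [d D] := dE b; have D' := is_deriveB (u1_dir z b) (derdirM D (u2_dir z b)).
  rewrite (@derive_val _ _ _ _ _ _ _ D') c2 s2 h2.
  by case: b {D D'}; rewrite /=; ring.
have row1 b : 'D_(edir R b) (fun w => Defs.comp true (vf w)) z =
    (if b then - (EE z * (2 * pi * bb z.1)) else 4 * pi * S2 z.1).
  have [d D] := dE b; have D' := is_deriveD (u2_dir z b) (derdirM D (u1_dir z b)).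
  rewrite (@derive_val _ _ _ _ _ _ _ D') c2 s2 h1.
  by case: b {D D'}; rewrite /=; ring.
by split; rewrite /Defs.jacobian mxE; [exact: (row0 false)|exact: (row0 true)|
  exact: (row1 false)|exact: (row1 true)].
Qed.

Lemma u_zero_mid (x : R) : C2 x = 1 / 2 -> u1 (x, 1 / 2) = 0 /\ u2 (x, 1 / 2) = 0.
Proof. by move=> cx; rewrite /u1 /u2 /= C2_half S2_half cx; split; field. Qed.

Lemma zsink_hyperbolic : hyperbolic_sink vf (@zsink R).
Proof.
have [h1 h2] := u_zero_mid C2_sixth; have [e00 e01 e10 e11] := jacobian_zero h1 h2.
split; first exact/vf_eq0.
move=> l; have s0 := S2_sixth_gt0 (R := R); have E0 := EE_sink rho.
have b0 : 0 < bb (1 / 6) :> R by apply: lt_le_trans (bb_ge _).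
have p0 := pi_gt0 R.
have a1 : 0 < 4 * pi * S2 (1 / 6) :> R by rewrite !mulr_gt0.
have b1 : 0 < 2 * pi * bb (1 / 6) :> R by rewrite !mulr_gt0.
apply: eigenvalueC_stable; rewrite e00 e11 ?e01 ?e10 /=.
  by have := mulr_gt0 E0 a1; have := mulr_gt0 E0 b1; rewrite /zsink; lra.
rewrite !mulNr mulrN !opprK; apply: addr_gt0; last exact: mulr_gt0.
by apply: mulr_gt0; apply: mulr_gt0.
Qed.

Lemma zsaddle_hyperbolic : hyperbolic_saddle vf (@zsaddle R).
Proof.
have cN : C2 (- (1 / 6)) = 1 / 2 :> R by rewrite C2N C2_sixth.
have [h1 h2] := u_zero_mid cN; have [e00 e01 e10 e11] := jacobian_zero h1 h2.
have E0 : EE zsaddle = 0.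
  rewrite /zsaddle EE_cell /=; try by apply/andP; split; lra.
  by apply: ebump_eq0 => -[[/= h _ _ _] _]; lra.
rewrite E0 !mul0r oppr0 in e00 e11.
have s0 := S2_sixth_gt0 (R := R); have p0 := pi_gt0 R.
have b0 : 0 < bb (- (1 / 6)) :> R by apply: lt_le_trans (bb_ge _).
split; first exact/vf_eq0.
have [|H1 H2 H3] := eigenvalueC_hyperbolic e00 e11; last by split; [exact: H1|split].
rewrite e01 e10 /= S2N mulrN mulrNN; apply: mulr_gt0; first by rewrite !mulr_gt0.
by rewrite !mulr_gt0.
Qed.

Lemma zsink_neq_zsaddle : ~ in_Z2 (@zsink R - zsaddle).
Proof.
move=> [[i j] [h _]]; have {}h : 3 * i%:~R = 1 :> R by move: h => /= <-; lra.
have : (3 * i)%:~R = 1%:~R :> R by rewrite intrM h.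
by move/intr_inj; clear; lia.
Qed.

End Singularities.

Lemma irrational_slope_ratr (R : realType) (rho : R) :
  (forall q : rat, rho != ratr q) -> irrational_slope rho.
Proof.
move=> H p q q0; have := H (p%:Q / q%:Q); apply: contra_neq => E.
rewrite fmorph_div /= !ratr_int -E mulfK// intr_eq0//.
Qed.

Section Rotation.
Context {R : realType}.
Local Notation P := (R * R)%type.
Variable rho : R.
Hypothesis rho_ge0 : 0 <= rho.
Hypothesis rho_le1 : rho <= 1.
Local Notation EE := (EE rho).
Local Notation vf := (vf rho).
Variable L : R.
Hypothesis L_gt0 : 0 < L.
Hypothesis vL : forall i (z w : P),
  `|Defs.comp i (vf z) - Defs.comp i (vf w)| <= L * (`|z.1 - w.1| + `|z.2 - w.2|).
Local Notation phi := (lflow vf L).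

(** Equating the values of [HH] on the levels 0 and 1 gives [x + rho] at every actual return; the
    translation also supplies a continuous value where there is no return. *)
Lemma return_map_translation : return_map_lift phi (fun x => x + rho).
Proof.
split; first by move=> x; apply: cvgD; [exact: cvg_id|exact: cvg_cst].
split; first by move=> x y; rewrite lerD2r.
split; first by move=> x; rewrite addrAC.
move=> x t _ y1 _; have E0 : EE (x, 0) = 0 := EE_int_y rho x 0.
have := EE_eq0_H rho_ge0 rho_le1 L_gt0 vL t E0.
rewrite [phi t _]surjective_pairing y1 (HH_int_y rho _ 1) (HH_int_y rho x 0) /= => h.
apply: (mulfI (lt0r_neq0 (pi_gt0 R))); lra.
Qed.

Lemma vf_rotation_number : rotation_number_of_flow vf phi rho.
Proof.
split.
  move=> x; have E0 : EE (x, 0) = 0 := EE_int_y rho x 0.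
  by rewrite vf_EE0 //= u2_section.
exists (fun x => x + rho); split; first exact: return_map_translation.
exists rho; split; last by exists 0; rewrite subr0.
have iterE n : iter n (fun x => x + rho) 0 = n%:R * rho.
  by elim: n => [|n IH] /=; rewrite ?mul0r// IH -natr1 mulrDl mul1r.
apply: cvg_near_cst; near=> n; rewrite iterE mulrAC mulfV ?mul1r// pnatr_eq0 -lt0n.
by near: n; exact: nbhs_infty_gt.
Unshelve. all: by end_near. Qed.

Lemma vf_cherry : irrational_slope rho -> cherry_flow vf phi.
Proof.
move=> irr; split; first exact: vf_smooth.
split; first exact: lflow_flow.
split; first by move=> z; exact: (no_periodic_point rho_ge0 rho_le1 L_gt0 vL irr).
exists zsink, zsaddle; split; first exact: zsink_hyperbolic.
split; first exact: zsaddle_hyperbolic.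
split; first exact: zsink_neq_zsaddle.
by move=> z; exact: vf_zero.
Qed.

End Rotation.

Theorem theorem2 (R : realType) (rho : R) :
  0 <= rho -> rho < 1 -> (forall q : rat, rho != ratr q) ->
  exists (v : R * R -> R * R) (phi : R -> R * R -> R * R),
    cherry_flow v phi /\ rotation_number_of_flow v phi rho /\
    (exists z, nontrivial_recurrent v phi z) /\
    (forall z, nontrivial_recurrent v phi z ->
       attractor phi (quasi_minimal_set_of phi z) /\
       nonempty_interior (realm phi (quasi_minimal_set_of phi z))).
Proof.
move=> rho0 /ltW rho1 /irrational_slope_ratr irr; have [L L0 vL] := vf_lip rho.
exists (vf rho), (lflow (vf rho) L); split; first exact: vf_cherry.
split; first exact: vf_rotation_number.
split; first exact: nontrivial_recurrent_exists.
move=> z /(quasi_minimalE rho0 rho1 L0 vL irr) ->; split.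
  exact: conservative_attractor.
exact: conservative_realm_interior.
Qed.
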